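(* For $a \in (-1,2)$ let $g(a)$ be Calabi's $U(2)$-invariant extremal toric Kähler metric on $\mathbb{CP}^2\sharp -\mathbb{CP}^2$ in the Kähler class whose moment polytope is $$P_a = \{(x_1,x_2)\in\mathbb{R}^2 : 1+x_1\ge 0,\ 1+x_2\ge 0,\ a+x_1+x_2\ge 0,\ 1-x_1-x_2\ge 0\},$$ and let $$g_a = \frac{2\sqrt{2}}{\sqrt{(a+1)(5-a)}}\, g(a)$$ be its rescaling to volume $16\pi^2$. Let $a_c$ be the unique zero in the range $a\in[-1,2]$ of the polynomial $$p(a) = 2a^4 - 85a^3 + 777a^2 - 2233a + 1763.$$ Then the first non-zero $\mathbb{T}^2$-invariant eigenvalue $\lambda_1^{\mathbb{T}}$ of the Laplacian of $g_a$ satisfies $$\lambda_1^{\mathbb{T}} \le \frac{\sqrt{2(a+1)}\,(13a^4 - 272a^3 + 2076a^2 - 7400a + 9679)}{10\sqrt{5-a}\,(a^2-4a+13)(a^2-16a+37)} \quad \text{if } -1<a<a_c,$$ and $$\lambda_1^{\mathbb{T}} \le -\frac{3\sqrt{2}\,(5-a)^{3/2}(a^3 - 105a^2 + 597a - 917)}{10\sqrt{a+1}\,(a^2-16a+37)^2} \quad \text{if } a_c\le a<2.$$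
   Context: $\mathbb{CP}^2\sharp -\mathbb{CP}^2$ is the one-point blow-up of $\mathbb{CP}^2$, with its standard $\mathbb{T}^2$-action, $\mathbb{T}^2 = (\mathbb{R}/2\pi\mathbb{Z})^2$. Symplectic coordinates: for a toric Kähler metric with moment polytope $P\subset\mathbb{R}^2$, there is a dense open subset of the manifold identified with $P^\circ\times\mathbb{T}^2$ (with $P^\circ$ the interior of $P$), with coordinates $(x_1,x_2,\theta_1,\theta_2)$, $\theta_i$ being $2\pi$-periodic, on which $$g = \sum_{i,j} u_{ij}\,dx_i\,dx_j + \sum_{i,j} u^{ij}\,d\theta_i\,d\theta_j ,$$ where $(u_{ij}) = D^2u$ is the Euclidean Hessian of a convex function $u:P^\circ\to\mathbb{R}$ (the symplectic potential) and $(u^{ij})$ is its inverse matrix. The symplectic potential has the form $u = \frac12\sum_k \psi_k\log\psi_k + f$ with $f$ smooth on $P$, where $\psi_k$ are the affine functions defining $P$; for $P_a$ these are $\psi_1 = 1+x_1$, $\psi_2 = 1+x_2$, $\psi_3 = a+x_1+x_2$, $\psi_4 = 1-x_1-x_2$. Extremal: a Kähler metric is extremal if the gradient of its scalar curvature is a real holomorphic vector field. For a toric Kähler metric this is equivalent to the scalar curvature $S = -\sum_{i,j}\partial_i\partial_j u^{ij}$ being an affine function of $x$. The metric $g(a)$ is explicitly given, with $t = x_1+x_2$, by $$D^2u = \frac12\begin{pmatrix} \frac{1}{x_1+1}+\frac{z(t)^{-1}-1}{2+t} & \frac{z(t)^{-1}-1}{2+t}\\[4pt] \frac{z(t)^{-1}-1}{2+t}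 & \frac{1}{x_2+1}+\frac{z(t)^{-1}-1}{2+t}\end{pmatrix},$$ $$z(t) = \frac{(t-1)(a+t)\left(a^2t - 4a^2 + 2at^2 + 10at + 36a - 4t^2 - 33t - 74\right)}{(t+2)^2(a+1)(a^2-16a+37)},\qquad t\in[-a,1].$$ Its scalar curvature is $S = \alpha(x_1+x_2)+\beta$ with $\alpha = \frac{48(2-a)}{(a+1)(a^2-16a+37)}$ and $\beta = \frac{12(4a-3a^2+13)}{(a+1)(a^2-16a+37)}$. First non-zero invariant eigenvalue: $\lambda_1^{\mathbb{T}}$ is the smallest $\lambda>0$ for which there is a non-zero $\mathbb{T}^2$-invariant smooth function $f$ on the manifold with $\Delta f = \lambda f$, where $\Delta = d^*d\ge 0$ is the ordinary Laplacian on functions of the metric in question (here $g_a$). *)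

(* Defs.v *)
From HB Require Import structures.
From mathcomp Require Import all_boot all_order all_algebra.
From mathcomp Require Import all_classical all_reals all_analysis.
Set Implicit Arguments.
Unset Strict Implicit.
Unset Printing Implicit Defensive.
Import Order.TTheory GRing.Theory Num.Theory.
Import numFieldNormedType.Exports.
Local Open Scope classical_set_scope.
Local Open Scope ring_scope.

Section Smooth.
Variables (R : realType) (m n : nat).
Implicit Types (f : 'M[R]_(m, n) -> R) (U Z : set 'M[R]_(m, n)).

Definition partial (ij : 'I_m * 'I_n) f : 'M[R]_(m, n) -> R :=
  fun x => 'D_(delta_mx ij.1 ij.2) f x.

Definition iter_partial (s : seq ('I_m * 'I_n)) f := foldr partial f s.

Definition smooth_on U f :=
  forall s x, U x ->
    {for x, continuous (iter_partial s f)} /\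
    forall ij, derivable (iter_partial s f) x (delta_mx ij.1 ij.2).

(* Smoothness of a function on a closed submanifold [Z] of Euclidean space;
   the values of [f] off [Z] are irrelevant. *)
Definition smooth_along Z f :=
  forall z, Z z -> exists U h,
    [/\ open U, U z, smooth_on U h & forall w, U w -> Z w -> f w = h w].

End Smooth.

(* The nonnegative Laplacian d^*d of a metric with Gram matrix [G], in
   coordinates: - |G|^(-1/2) d_i (|G|^(1/2) G^{ij} d_j f). *)
Definition laplacian (R : realType) (n : nat) (G : 'rV[R]_n -> 'M[R]_n)
    (f : 'rV[R]_n -> R) (x : 'rV[R]_n) : R :=
  - (Num.sqrt (\det (G x)))^-1 *
    \sum_(i < n) partial (ord0, i) (fun y => Num.sqrt (\det (G y)) *
      \sum_(j < n) invmx (G y) i j * partial (ord0, j) f y) x.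

Section CalabiSurface.
Variable R : realType.
Implicit Types (a : R) (x theta : 'rV[R]_2).

(* Row [k] of [normals] is the inward normal of the facet [psi_k = 0]. *)
Definition normals : 'M[R]_(4, 2) :=
  \matrix_(k, j) nth 0 (nth [::] [:: [:: 1; 0]; [:: 0; 1]; [:: 1; 1]; [:: -1; -1]] k) j.

Definition offsets a : 'rV[R]_4 := \row_k nth 0 [:: 1; 1; a; 1] k.

Definition psi a x : 'rV[R]_4 := offsets a + x *m normals^T.

Definition moment_polytope a : set 'rV[R]_2 :=
  [set x | forall k, 0 <= psi a x ord0 k].

(* CP^2 # -CP^2 with its moment polytope is realised by Delzant's
   construction. A point of C^4 is a 4 x 2 matrix with rows (Re z_k, Im z_k).
   The manifold is the quotient of the compact submanifold [delzant_level a]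
   by the free action of the torus [exp (ker normals)], and the residual
   action of T^2 = T^4 / exp (ker normals) is lifted to
   (theta_1, theta_2, 0, 0). *)
Definition delzant_level a : set 'M[R]_(4, 2) :=
  [set z | exists2 x, moment_polytope a x &
     forall k, z k (inord 0) ^+ 2 + z k (inord 1) ^+ 2 = 2 * psi a x ord0 k].

Definition torus_act (eta : 'rV[R]_4) (z : 'M[R]_(4, 2)) : 'M[R]_(4, 2) :=
  \matrix_(k, j)
    let c := cos (eta ord0 k) in let s := sin (eta ord0 k) in
    if j == inord 0 then c * z k (inord 0) - s * z k (inord 1)
    else s * z k (inord 0) + c * z k (inord 1).

Definition T2_act theta (z : 'M[R]_(4, 2)) : 'M[R]_(4, 2) :=
  torus_act (row_mx theta (0 : 'rV[R]_2)) z.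

(* A smooth function on the quotient manifold is a smooth function on the
   level set that is constant on the orbits of the Delzant torus. *)
Definition smooth_on_manifold a (f : 'M[R]_(4, 2) -> R) :=
  smooth_along (delzant_level a) f /\
  forall eta z, eta *m normals = 0 -> delzant_level a z ->
    f (torus_act eta z) = f z.

Definition T2_invariant a (f : 'M[R]_(4, 2) -> R) :=
  forall theta z, delzant_level a z -> f (T2_act theta z) = f z.

(* The symplectic coordinates (x, theta) on the dense open set P^o x T^2, lifted
   to the level set: z = e^(i theta) . (sqrt (2 psi_k (x)))_k. *)
Definition toric_point a (y : 'rV[R]_(2 + 2)) : 'M[R]_(4, 2) :=
  T2_act (rsubmx y)
    (\matrix_(k, j) if j == inord 0
                    then Num.sqrt (2 * psi a (lsubmx y) ord0 k) else 0).

Definition calabi_z a (t : R) : R :=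
  (t - 1) * (a + t) *
  (a ^+ 2 * t - 4 * a ^+ 2 + 2 * a * t ^+ 2 + 10 * a * t + 36 * a
     - 4 * t ^+ 2 - 33 * t - 74) /
  ((t + 2) ^+ 2 * (a + 1) * (a ^+ 2 - 16 * a + 37)).

(* The Hessian D^2 u of the symplectic potential of Calabi's extremal
   metric. *)
Definition calabi_hessian a x : 'M[R]_2 :=
  let t := x ord0 (inord 0) + x ord0 (inord 1) in
  \matrix_(i, j) (2^-1 * ((if i == j then (x ord0 i + 1)^-1 else 0) +
                  ((calabi_z a t)^-1 - 1) / (2 + t))).

(* Calabi's metric g(a) = u_ij dx_i dx_j + u^ij dtheta_i dtheta_j. *)
Definition calabi_metric a (y : 'rV[R]_(2 + 2)) : 'M[R]_(2 + 2) :=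
  let H := calabi_hessian a (lsubmx y) in block_mx H 0 0 (invmx H).

Definition normalised_metric a (y : 'rV[R]_(2 + 2)) : 'M[R]_(2 + 2) :=
  (2 * Num.sqrt 2 / Num.sqrt ((a + 1) * (5 - a))) *: calabi_metric a y.

(* Both sides of the eigenvalue equation are smooth on the manifold, so it is
   enough to impose it on the dense open set of symplectic coordinates. *)
Definition invariant_eigenvalue a (lambda : R) :=
  exists f : 'M[R]_(4, 2) -> R,
    [/\ smooth_on_manifold a f, T2_invariant a f,
        exists2 z, delzant_level a z & f z != 0 &
        forall y : 'rV[R]_(2 + 2), (moment_polytope a)° (lsubmx y) ->
          laplacian (normalised_metric a) (f \o toric_point a) y =
          lambda * f (toric_point a y)].

Definition first_invariant_eigenvalue a (lambda : R) :=
  [/\ 0 < lambda, invariant_eigenvalue a lambda &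
      forall mu, 0 < mu -> invariant_eigenvalue a mu -> lambda <= mu].

Definition critical_poly (a : R) : R :=
  2 * a ^+ 4 - 85 * a ^+ 3 + 777 * a ^+ 2 - 2233 * a + 1763.

End CalabiSurface.

(* Main.v *)
Require Import Defs.
From mathcomp Require Import all_boot all_order all_algebra.
From mathcomp Require Import all_classical all_reals all_analysis.
From mathcomp Require Import ring lra.
Import Order.TTheory GRing.Theory Num.Theory.
Import numFieldNormedType.Exports.

(* The radial function [u = (1 - x1 - x2) / (1 + a)] separates the
   T^2-invariant spectrum of [g_a]: a function [H u], or
   [(x1 - x2) H u / (2 + x1 + x2)], is an eigenfunction as soon as
   [p H' = sg G], [G' = (w0 + w1 u) H] with [p = u (1 - u) (1 - al u + be u^2)]
   and both [H] and the flux [G] are regular at [u = 0] and [u = 1].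
   The solution regular at [u = 0] is a power series whose coefficients are
   [O(1/n)] on [H] and absolutely summable on [G], uniformly and Lipschitz in
   the spectral parameter; it is regular at [u = 1] iff [G 1 = 0].  Moving the
   parameter up from [0] while [H > 0] (resp. [G > 0]) stops exactly when
   [G 1 = 0], and by Picone's identity it stops before the Rayleigh quotient of
   the test function [x1 - x2] (resp. [x1 + x2]).  These two quotients are the
   two bounds. *)

Set Implicit Arguments.
Unset Strict Implicit.
Unset Printing Implicit Defensive.
Local Open Scope classical_set_scope.
Local Open Scope ring_scope.

(** * Power series *)

Section PowerSeries.
Variable R : realType.
Implicit Types (c d : nat -> R) (x r : R).

(** By minimality in [first_invariant_eigenvalue], each bound follows from a single eigenvalue below
    it. The Rayleigh quotient therefore never passes through a variational principle on the
    manifold: it serves as an a priori bound on the shooting parameter, and what must be produced is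
    a genuine eigenfunction, smooth across every facet. The radial mode competes with the constants.
    Its first non-constant solution changes sign but its flux does not, so positivity of [G]
    replaces positivity of [H], and the parameter is placed in [sg] so that the constants drop out.
    At [u = 1] the solution regular at [0] has in general a logarithm, while [G] remains continuous;
    this is why the estimates are made on coefficients, up to the closed end point. They must
    survive [a] near 2, where a root of [1 - al u + be u^2] tends to 1 and |al| + |be| exceeds 1, so
    that the recurrence is not diagonally dominant as it stands. *)

Definition psum c x : R := limn (pseries c x).

Definition psconv r c := forall x, `|x| < r -> cvgn (pseries c x).

Definition cshift c n : R := if n is k.+1 then c k else 0.

Lemma pseries_le_cvg c d x : (forall n, `|c n| <= d n) ->
  cvgn (pseries d `|x|) -> cvgn (pseries c x).
Proof.
move=> cd dx; apply: normed_cvg; apply: series_le_cvg dx => [n|n|n] /=.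
- exact: normr_ge0.
- by rewrite mulr_ge0 ?exprn_ge0// (le_trans _ (cd n)).
- by rewrite normrM normrX ler_wpM2r ?exprn_ge0.
Qed.

Lemma psconv_geometric c (C rho r : R) : 0 <= rho -> r * rho <= 1 ->
  (forall n, `|c n| <= C * rho ^+ n) -> psconv r c.
Proof.
move=> rho0 rrho cC x xr.
have C0 : 0 <= C by have := cC 0%N; rewrite expr0 mulr1; apply: le_trans.
apply: (pseries_le_cvg cC); rewrite /pseries.
rewrite (_ : (fun i => _) = geometric C (rho * `|x|)); last first.
  by apply/funext => n /=; rewrite exprMn mulrA.
apply: is_cvg_geometric_series.
have [->|rho1] := eqVneq rho 0; first by rewrite mul0r normr0.
rewrite ger0_norm ?mulr_ge0//; apply: (lt_le_trans _ rrho).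
by rewrite mulrC ltr_pM2r// lt0r rho1.
Qed.

(** The bound is [1 / (1 - theta)]: each of the first n + 1 powers of [theta] is at least
    [theta ^+ n]. *)
Lemma mul_geometric_bounded (theta : R) : 0 <= theta < 1 ->
  exists C, forall n : nat, n.+1%:R * theta ^+ n <= C.
Proof.
case/andP=> t0 t1; exists (1 / (1 - theta)) => n.
rewrite ler_pdivlMr ?subr_gt0//.
elim: n => [|n IH]; first by rewrite expr0 !mul1r; lra.
have tn : theta ^+ n.+1 <= 1 by rewrite exprn_ile1// ltW.
have tn0 : 0 <= theta ^+ n by rewrite exprn_ge0.
move: IH tn; rewrite exprS -(natr1 n.+1).
have n0 : 0 <= n.+1%:R :> R by [].
set N := n.+1%:R in n0 *; set q := theta ^+ n in tn0 *.
move=> IH tn; have : theta * (N * q * (1 - theta)) <= theta by rewrite ler_piMr.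
have : theta * q * (1 - theta) <= 1 - theta by rewrite ler_piMl// subr_ge0 ltW.
by move=> ? ?; lra.
Qed.

Lemma psconv_diffs r c : psconv r c -> psconv r (pseries_diffs c).
Proof.
move=> cr x xr.
(* Radii |x| < q < y < r: convergence at [y] bounds |c n| by [C / y ^+ n], and the factor n + 1
   produced by differentiation is absorbed by [(q / y) ^+ n]. *)
pose y := (`|x| + r) / 2.
have x0 := normr_ge0 x.
have y0 : 0 < y by rewrite /y; lra.
have xy : `|x| < y by rewrite /y; lra.
have /cvg_series_bounded [K [_ Kc]] : cvgn (pseries c y).
  by apply: cr; rewrite gtr0_norm// /y; lra.
have [C HC] : exists C, forall n : nat, `|c n| * y ^+ n <= C.
  exists (`|K| + 1) => n; rewrite -[X in _ * X]gtr0_norm ?exprn_gt0// -normrM.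
  by apply: Kc => //; rewrite (le_lt_trans (ler_norm K))// ltrDl.
pose q := (`|x| + y) / 2.
have q0 : 0 < q by rewrite /q; lra.
have [D HD] : exists D, forall n : nat, n.+1%:R * (q / y) ^+ n <= D.
  apply: mul_geometric_bounded; rewrite divr_ge0 ?ltW//=.
  by rewrite ltr_pdivrMr// mul1r /q; lra.
apply: (@psconv_geometric _ (C / y * D) q^-1 q) => //.
- by rewrite invr_ge0 ltW.
- by rewrite divff// gt_eqF.
- move=> n; rewrite /pseries_diffs normrM ger0_norm// exprVn ler_pdivlMr ?exprn_gt0//.
  have -> : n.+1%:R * `|c n.+1| * q ^+ n =
      (`|c n.+1| * y ^+ n.+1 / y) * (n.+1%:R * (q / y) ^+ n).
    rewrite (expr_div_n q y n) exprS; have y1 : y != 0 by rewrite gt_eqF.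
    have yn1 : y ^+ n != 0 by rewrite expf_neq0.
    by field; rewrite y1 yn1.
  apply: ler_pM => //.
  + exact: divr_ge0 (mulr_ge0 (normr_ge0 _) (exprn_ge0 _ (ltW y0))) (ltW y0).
  + exact: mulr_ge0 (ler0n _ _) (exprn_ge0 _ (divr_ge0 (ltW q0) (ltW y0))).
  + by apply: ler_wpM2r => //; rewrite invr_ge0; exact: ltW.
- by rewrite /q; lra.
Qed.

Lemma is_derive_psum r c x : psconv r c -> `|x| < r ->
  is_derive x (1 : R) (psum c) (psum (pseries_diffs c) x).
Proof.
move=> cr xr; have x0 := normr_ge0 x.
have K0 : 0 <= (`|x| + r) / 2 by lra.
have Kr : `|(`|x| + r) / 2| < r by rewrite (ger0_norm K0); lra.
have xK : `|x| < `|(`|x| + r) / 2| by rewrite (ger0_norm K0); lra.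
have dr := psconv_diffs cr; have ddr := psconv_diffs dr.
exact: (pseries_snd_diffs (cr _ Kr) (dr _ Kr) (ddr _ Kr) xK).
Qed.

Lemma psum0 c : psum c 0 = c 0%N.
Proof.
apply: lim_near_cst => //; near=> n.
rewrite /pseries /series /=.
have n0 : (0 < n)%N by near: n; exists 1%N.
rewrite (bigD1_seq 0%N) ?iota_uniq ?mem_index_iota//=.
rewrite expr0 mulr1 big1 ?addr0// => i /negbTE i0.
by rewrite expr0n i0 mulr0.
Unshelve. all: by end_near. Qed.

Lemma is_cvg_pseries_lin (a b : R) c d x : cvgn (pseries c x) -> cvgn (pseries d x) ->
  cvgn (pseries (fun n => a * c n + b * d n) x).
Proof.
move=> cx dx; rewrite /pseries.
rewrite (_ : (fun i => _) =
  a *: (fun i => c i * x ^+ i : R^o) + b *: (fun i => d i * x ^+ i : R^o)).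
  by apply: is_cvg_seriesD; apply: is_cvg_seriesZ.
by apply/funext => n; rewrite /= mulrDl -!mulrA.
Qed.

Lemma psum_lin (a b : R) c d x : cvgn (pseries c x) -> cvgn (pseries d x) ->
  psum (fun n => a * c n + b * d n) x = a * psum c x + b * psum d x.
Proof.
move=> cx dx; rewrite /psum /pseries.
rewrite (_ : (fun i => _) =
  a *: (fun i => c i * x ^+ i : R^o) + b *: (fun i => d i * x ^+ i : R^o)).
  rewrite lim_seriesD; [|exact: is_cvg_seriesZ..].
  by rewrite !lim_seriesZ.
by apply/funext => n; rewrite /= mulrDl -!mulrA.
Qed.

Lemma pseries_cshiftE c x n :
  pseries (cshift c) x n.+1 = x * pseries c x n.
Proof.
rewrite /pseries /series /= big_nat_recl//= mul0r add0r big_distrr /=.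
by apply: eq_bigr => i _; rewrite exprS; ring.
Qed.

Lemma cvg_cshift c x : cvgn (pseries c x) ->
  pseries (cshift c) x @ \oo --> x * psum c x.
Proof.
move=> cx; rewrite -cvg_shiftS /=; under eq_fun do rewrite pseries_cshiftE.
by apply: cvgMl_tmp.
Qed.

Lemma is_cvg_pseries_cshift c x : cvgn (pseries c x) -> cvgn (pseries (cshift c) x).
Proof. by move=> /cvg_cshift/cvgP. Qed.

Lemma psum_cshift c x : cvgn (pseries c x) -> psum (cshift c) x = x * psum c x.
Proof. by move=> /cvg_cshift/cvg_lim; apply. Qed.

Lemma psum_le_sum c d x (B : R) : cvgn (pseries c x) ->
  (forall n, `|c n * x ^+ n| <= d n) ->
  (forall n, \sum_(0 <= k < n) d k <= B) -> `|psum c x| <= B.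
Proof.
move=> cx cd isd_sub; rewrite ler_norml; apply/andP; split.
- apply: limr_ge => //; near=> n; rewrite lerNl; apply: le_trans (isd_sub n).
  rewrite -sumrN; apply: ler_sum => i _; apply: le_trans (cd i).
  by rewrite -normrN ler_norm.
- apply: limr_le => //; near=> n; apply: le_trans (isd_sub n).
  by apply: ler_sum => i _; apply: le_trans (cd i); rewrite ler_norm.
Unshelve. all: by end_near. Qed.

Lemma sum_geometric_le (q : R) n : 0 <= q < 1 ->
  \sum_(0 <= k < n) q ^+ k <= (1 - q)^-1.
Proof.
case/andP=> q0 q1; rewrite -div1r ler_pdivlMr ?subr_gt0//.
have -> : (\sum_(0 <= k < n) q ^+ k) * (1 - q) = 1 - q ^+ n.
  elim: n => [|n IH]; first by rewrite big_nil expr0 mul0r subrr.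
  by rewrite big_nat_recr//= mulrDl IH exprS; ring.
by rewrite gerBl exprn_ge0.
Qed.

End PowerSeries.

(** * Frobenius solutions *)

Section Frobenius.
Variables (R : realType) (al be sg w0 w1 : R).

(* Partial sums of [frobg], then [n * frobh n] and [frobh n], the last two
   together with their predecessors. *)
Fixpoint frob_state n : R * (R * R) * (R * R) :=
  if n is k.+1 then
    let: (s, (z, z'), (h, h')) := frob_state k in
    let s1 := s + (w0 * h + w1 * h') / k.+1%:R in
    let z1 := al * z - be * z' + sg * s1 in
    (s1, (z1, z), (z1 / k.+1%:R, h))
  else (0, (0, 0), (1, 0)).

Definition frobS n := (frob_state n).1.1.
Definition frobz n := (frob_state n).1.2.1.
Definition frobh n := (frob_state n).2.1.
Definition frobg n := frobS n - cshift frobS n.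

Lemma frob_state_prev n :
  (frob_state n).1.2.2 = cshift frobz n /\ (frob_state n).2.2 = cshift frobh n.
Proof.
case: n => [//|n]; rewrite /frobz /frobh /=.
by case: (frob_state n) => [[s [z z']] [h h']].
Qed.

Lemma frobSS n : frobS n.+1 = frobS n + (w0 * frobh n + w1 * cshift frobh n) / n.+1%:R.
Proof.
have [_ <-] := frob_state_prev n; rewrite /frobS /frobh /=.
by case: (frob_state n) => [[s [z z']] [h h']].
Qed.

(** Coefficient form of [G' = (w0 + w1 u) H]. *)
Lemma frobgS n : n.+1%:R * frobg n.+1 = w0 * frobh n + w1 * cshift frobh n.
Proof. by rewrite /frobg /= frobSS addrC addKr mulrC divfK// pnatr_eq0. Qed.

(** Coefficient form of [p H' = sg G] divided by [1 - u]: [frobz] lists the coefficients of [u H'],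
    and dividing the series [frobg] by [1 - u] produces its partial sums [frobS]. Only the quadratic
    factor of [p] survives in the recurrence, so the singular point [u = 1] no longer makes the
    coefficients grow. *)
Lemma frobz_rec n :
  frobz n = al * cshift frobz n - be * cshift (cshift frobz) n + sg * frobS n.
Proof.
case: n => [|n]; first by rewrite /frobz /frobS /=; ring.
have [zE hE] := frob_state_prev n.
move: zE hE (frobSS n); rewrite /frobS /frobz /frobh /= => <- <-.
by case: (frob_state n) => [[s [z z']] [h h']].
Qed.

Lemma frobzE n : frobz n = n%:R * frobh n.
Proof.
case: n => [|n]; first by rewrite /frobz /= mul0r.
rewrite /frobz /frobh /=; case: (frob_state n) => [[s [z z']] [h h']] /=.
by rewrite [RHS]mulrC divfK// pnatr_eq0.
Qed.

Lemma frobh0 : frobh 0 = 1. Proof. by []. Qed.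
Lemma frobg0 : frobg 0 = 0. Proof. exact: subrr. Qed.

Lemma frobS_sum n : frobS n = \sum_(0 <= k < n.+1) frobg k.
Proof.
elim: n => [|n IH]; first by rewrite big_nat1 frobg0.
by rewrite big_nat_recr//= -IH /frobg /= addrC subrK.
Qed.

Lemma frobzE_diffs : frobz = cshift (pseries_diffs frobh).
Proof.
apply/funext => -[|n]; first by rewrite frobzE mul0r.
by rewrite frobzE.
Qed.

(** A crude bound for arbitrary parameters. It yields some positive radius of convergence, which is
    all that the expansion at the other end point [u = 1] requires. *)
Lemma frob_geometric : exists2 rho : R, 1 <= rho &
  forall n, `|frobh n| <= rho ^+ n /\ `|frobS n| <= rho ^+ n.
Proof.
pose W := 1 + `|w0| + `|w1|.
pose rho := W * (1 + `|al| + `|be| + `|sg| * W).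
have W1 : 1 <= W by rewrite /W -addrA lerDl addr_ge0.
have F1 : 1 <= 1 + `|al| + `|be| + `|sg| * W.
  rewrite -!addrA lerDl !addr_ge0// mulr_ge0//; exact: le_trans W1.
have Wrho : W <= rho by rewrite /rho ler_peMr//; exact: le_trans W1.
have Frho : `|al| + `|be| + `|sg| * W <= rho.
  apply: (@le_trans _ _ (1 + `|al| + `|be| + `|sg| * W)); first by lra.
  by rewrite /rho ler_peMl//; exact: le_trans F1.
have rho1 : 1 <= rho by exact: le_trans Wrho.
have rho0 : 0 <= rho by exact: le_trans rho1.
have mono m n : (m <= n)%N -> rho ^+ m <= rho ^+ n by move=> mn; rewrite ler_weXn2l.
exists rho => // n.
suff : [/\ `|frobh n| <= rho ^+ n, `|frobS n| <= rho ^+ n, `|frobz n| <= rho ^+ n,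
   `|cshift frobz n| <= rho ^+ n & `|cshift frobh n| <= rho ^+ n] by case.
elim: n => [|n [IHh IHS IHz IHz' IHh']].
  by rewrite /frobz /= !expr0 normr1 !normr0 lexx !ler01.
have rn0 : 0 <= rho ^+ n by exact: exprn_ge0.
have S1 : `|frobS n.+1| <= W * rho ^+ n.
  rewrite frobSS; apply: le_trans (ler_normD _ _) _.
  rewrite /W -addrA [leRHS]mulrDl mul1r lerD// normrM normfV.
  rewrite ler_pdivrMr ?normr_gt0 ?pnatr_eq0// (ger0_norm (ler0n _ _)).
  apply: (@le_trans _ _ ((`|w0| + `|w1|) * rho ^+ n)); last first.
    by rewrite ler_peMr ?mulr_ge0 ?addr_ge0// ler1n.
  apply: le_trans (ler_normD _ _) _.
  by rewrite !normrM mulrDl lerD// ler_wpM2l.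
have z1 : `|frobz n.+1| <= rho ^+ n.+1.
  rewrite frobz_rec exprS.
  apply: (@le_trans _ _ ((`|al| + `|be| + `|sg| * W) * rho ^+ n)); last first.
    by rewrite ler_wpM2r.
  apply: le_trans (ler_normD _ _) _; rewrite mulrDl lerD//.
    apply: le_trans (ler_normB _ _) _.
    by rewrite !normrM mulrDl lerD// ler_wpM2l.
  by rewrite normrM -mulrA ler_wpM2l.
split => //.
- have <- : frobz n.+1 / n.+1%:R = frobh n.+1.
    by rewrite frobzE mulrC mulKf// pnatr_eq0.
  rewrite normrM normfV ler_pdivrMr ?normr_gt0 ?pnatr_eq0//.
  apply: le_trans z1 _; rewrite ler_peMr ?exprn_ge0//.
  by rewrite ger0_norm// ler1n.
- by apply: le_trans S1 _; rewrite exprS ler_wpM2r.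
- by apply: le_trans IHz _; exact: mono.
- by apply: le_trans IHh _; exact: mono.
Qed.

Section Solution.
Variable r : R.
Hypotheses (hr : psconv r frobh) (Sr : psconv r frobS).

Lemma frobg_psconv : psconv r frobg.
Proof.
move=> x xr.
have -> : frobg = (fun n => 1 * frobS n + (-1) * cshift frobS n).
  by apply/funext => n; rewrite /frobg; ring.
by apply: is_cvg_pseries_lin (Sr xr) (is_cvg_pseries_cshift (Sr xr)).
Qed.

Lemma is_derive_frobG u : `|u| < r ->
  is_derive u (1 : R) (psum frobg) ((w0 + w1 * u) * psum frobh u).
Proof.
move=> ur; apply: is_derive_eq (is_derive_psum frobg_psconv ur) _.
have -> : pseries_diffs frobg = (fun n => w0 * frobh n + w1 * cshift frobh n).
  by apply/funext => n; exact: frobgS.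
rewrite psum_lin ?psum_cshift; [ring|exact: hr..|].
by apply: is_cvg_pseries_cshift; exact: hr.
Qed.

Lemma frobH_ode u : `|u| < r ->
  u * (1 - u) * (1 - al * u + be * u ^+ 2) * psum (pseries_diffs frobh) u =
  sg * psum frobg u.
Proof.
move=> ur; have cS := Sr ur.
have cz : cvgn (pseries frobz u).
  rewrite frobzE_diffs; apply: is_cvg_pseries_cshift.
  exact: (psconv_diffs hr).
have gE : psum frobg u = (1 - u) * psum frobS u.
  have -> : frobg = (fun n => 1 * frobS n + (-1) * cshift frobS n).
    by apply/funext => n; rewrite /frobg; ring.
  rewrite psum_lin ?psum_cshift//; first ring.
  exact: is_cvg_pseries_cshift.
have zE : psum frobz u = u * psum (pseries_diffs frobh) u.
  rewrite frobzE_diffs psum_cshift//; exact: (psconv_diffs hr).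
have czz : cvgn (pseries (cshift frobz) u) by exact: is_cvg_pseries_cshift.
have : psum frobz u = al * (u * psum frobz u) - be * (u * (u * psum frobz u)) +
    sg * psum frobS u.
  have {1}-> : frobz = (fun n => 1 * (al * cshift frobz n + (- be) * cshift (cshift
      frobz) n)
      + sg * frobS n).
    by apply/funext => n; rewrite frobz_rec; ring.
  have c1 : cvgn (pseries (cshift (cshift frobz)) u) by exact: is_cvg_pseries_cshift.
  have c2 : cvgn (pseries (fun n => al * cshift frobz n +
      (- be) * cshift (cshift frobz) n) u) by exact: is_cvg_pseries_lin.
  by rewrite (psum_lin _ _ c2 cS) (psum_lin _ _ czz c1) !psum_cshift//; ring.
rewrite gE zE; set Z := psum _ u; set S := psum frobS u => E.
have E2 : sg * S = (1 - al * u + be * u ^+ 2) * (u * Z) by rewrite expr2; lra.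
have -> : sg * ((1 - u) * S) = (1 - u) * (sg * S) by ring.
rewrite E2; ring.
Qed.

End Solution.

End Frobenius.

(** * Coefficient bounds that are uniform and Lipschitz in the parameters *)

Section UniformBounds.
Variable R : realType.

Lemma natrSS_le n : n.+2%:R <= 2 * n.+1%:R :> R.
Proof. by rewrite -natrM ler_nat mul2n -addnn addSnnS leq_addl. Qed.

Lemma cshift_le (c B : nat -> R) : (forall n, `|c n| <= B n) ->
  {homo B : m n / (m <= n)%N >-> m <= n} -> forall n, `|cshift c n| <= B n.
Proof.
move=> cB mB [|n] /=; first by rewrite normr0 (le_trans _ (cB 0%N)).
by apply: le_trans (cB n) _; apply: mB.
Qed.

(* Multiplying by [1 + al u + be u^2] (a Graeffe step) turns
   [1 - al u + be u^2] into [1 - (al^2 - 2 be) u^2 + be^2 u^4]; the hypothesis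
   makes the latter diagonally dominant, also when the roots of the former
   come close to the unit circle. *)
Lemma quadratic_recurrence_bound (al be : R) (z T B : nat -> R) :
  `|al ^+ 2 - 2 * be| + be ^+ 2 < 1 ->
  (forall n, z n = al * cshift z n - be * cshift (cshift z) n + T n) ->
  (forall n, `|T n| <= B n) -> {homo B : m n / (m <= n)%N >-> m <= n} ->
  forall n, `|z n| <=
    (1 + `|al| + `|be|) / (1 - (`|al ^+ 2 - 2 * be| + be ^+ 2)) * B n.
Proof.
set ga := al ^+ 2 - 2 * be; set th := `|ga| + be ^+ 2 => th1 zE TB mB.
set M := _ / _.
have B0 n : 0 <= B n by apply: le_trans (TB n).
have th0 : 0 <= th by rewrite addr_ge0 ?sqr_ge0.
have M0 : 0 <= M by apply: divr_ge0; [rewrite !addr_ge0|rewrite subr_ge0 ltW].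
have zE2 n : z n = ga * cshift (cshift z) n - be ^+ 2 * cshift (cshift (cshift (cshift
    z))) n
   + (T n + al * cshift T n + be * cshift (cshift T) n).
  have zE' m : cshift z m = al * cshift (cshift z) m
      - be * cshift (cshift (cshift z)) m + cshift T m.
    by case: m => [|m] /=; [ring|exact: zE].
  have zE'' m : cshift (cshift z) m = al * cshift (cshift (cshift z)) m
      - be * cshift (cshift (cshift (cshift z))) m + cshift (cshift T) m.
    by case: m => [|m] /=; [ring|exact: zE'].
  (* The Graeffe step on coefficients: the recurrence at n, plus [al] times the one at n - 1, plus
     [be] times the one at n - 2. *)
  have e1 := zE n; have e2 := zE' n; have e3 := zE'' n.
  have : z n - al * cshift z n + be * cshift (cshift z) n
    + al * (cshift z n - al * cshift (cshift z) n + be * cshift (cshift (cshift z)) n)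
    + be * (cshift (cshift z) n - al * cshift (cshift (cshift z)) n
            + be * cshift (cshift (cshift (cshift z))) n)
    = T n + al * cshift T n + be * cshift (cshift T) n.
    congr (_ + al * _ + be * _); lra.
  by move=> <-; rewrite /ga; ring.
have T1 := cshift_le TB mB; have T2 := cshift_le T1 mB.
(* [M] is the fixed point that lets the induction reproduce its own constant. *)
have MM n : th * (M * B n) + (1 + `|al| + `|be|) * B n = M * B n.
  by rewrite /M; field; rewrite subr_eq0 gt_eqF.
suff H n : forall m, (m <= n)%N -> `|z m| <= M * B m by move=> n; exact: H (leqnn n).
elim: n => [|n IH] m.
  rewrite leqn0 => /eqP->; rewrite zE2 /= !mulr0 subr0 add0r !addr0.
  rewrite -MM; apply: le_trans (TB 0%N) _.
  apply: (@le_trans _ _ ((1 + `|al| + `|be|) * B 0%N)).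
    by rewrite ler_peMl// -addrA lerDl addr_ge0.
  by rewrite lerDr mulr_ge0 ?(mulr_ge0 M0).
rewrite leq_eqVlt ltnS => /orP[/eqP->|]; last exact: IH.
have zs j : `|(iter j.+1 (@cshift R) z) n.+1| <= M * B n.+1.
  suff : forall k, (k <= n.+1)%N -> `|(iter j.+1 (@cshift R) z) k| <= M * B k by apply.
  elim: j => [|j IHj] [|k] kn /=.
  - by rewrite normr0 (mulr_ge0 M0).
  - by apply: le_trans (IH k kn) _; rewrite ler_wpM2l// mB.
  - by rewrite normr0 (mulr_ge0 M0).
  - by apply: le_trans (IHj k (ltnW kn)) _; rewrite ler_wpM2l// mB.
have z2 := zs 1%N; have z4 := zs 3%N; rewrite /= in z2 z4.
rewrite zE2 -MM; apply: le_trans (ler_normD _ _) _; apply: lerD.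
  apply: le_trans (ler_normB _ _) _.
  rewrite (normrM ga) (normrM (be ^+ 2)) /th mulrDl.
  apply: lerD; first by rewrite ler_wpM2l.
  by rewrite (ger0_norm (sqr_ge0 be)) ler_wpM2l// sqr_ge0.
rewrite !mulrDl mul1r.
apply: le_trans (ler_normD _ _) _; apply: lerD; last first.
  by rewrite normrM ler_wpM2l.
apply: le_trans (ler_normD _ _) _; apply: lerD => //.
by rewrite normrM ler_wpM2l.
Qed.

(* [A_n := sum_(k <= n) |g k|] satisfies [A_(n+1) <= (1 + O(n^-2)) A_n]. *)
Lemma coupled_recurrence_bound (C : R) : 0 <= C -> exists2 K : R, 0 <= K &
  forall (D : R) (h g : nat -> R), 0 <= D -> g 0%N = 0 -> `|h 0%N| <= D ->
  (forall n, n%:R * `|h n| <= C * (\sum_(0 <= k < n.+1) `|g k| + D)) ->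
  (forall n, n.+1%:R * `|g n.+1| <= C * (`|h n| + `|cshift h n| + D / n.+1%:R)) ->
  forall n, \sum_(0 <= k < n.+1) `|g k| <= K * D /\ n.+1%:R * `|h n| <= K * D.
Proof.
(* By [hA], [hA'] and [AD], the three terms bounding [g n.+1] contribute
   [(2 C + 1) + 2 (2 C + 1) + 1 = 6 C + 4]. *)
move=> C0; pose C3 := C * (6 * C + 4).
have C30 : 0 <= C3 by rewrite mulr_ge0// addr_ge0// mulr_ge0.
pose E := expR (2 * C3).
have E1 : 1 <= E by rewrite -expR0 ler_expR mulr_ge0.
exists ((2 * C + 1) * E).
  by rewrite mulr_ge0 ?addr_ge0 ?mulr_ge0// ltW// expR_gt0.
move=> D h g D0 g0 h0 hle gle.
pose A n := \sum_(0 <= k < n.+1) `|g k| + D.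
have AS n : A n.+1 = A n + `|g n.+1| by rewrite /A big_nat_recr//=; ring.
have AD n : D <= A n by rewrite /A lerDr sumr_ge0.
have A0 n : 0 <= A n by apply: le_trans (AD n).
have hA n : n.+1%:R * `|h n| <= (2 * C + 1) * A n.
  case: n => [|n].
    rewrite mul1r; apply: le_trans h0 _; apply: le_trans (AD 0%N) _.
    by rewrite ler_peMl// lerDr mulr_ge0.
  apply: (@le_trans _ _ (2 * (n.+1%:R * `|h n.+1|))).
    by rewrite mulrA ler_wpM2r// natrSS_le.
  apply: (@le_trans _ _ (2 * (C * A n.+1))); first by rewrite ler_wpM2l// hle.
  by rewrite mulrA ler_wpM2r// lerDl.
have hA' n : n.+1%:R * `|cshift h n| <= 2 * ((2 * C + 1) * A n).
  case: n => [|n] /=; first by rewrite normr0 mulr0 !mulr_ge0// addr_ge0 ?mulr_ge0.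
  apply: (@le_trans _ _ (2 * (n.+1%:R * `|h n|))).
    by rewrite mulrA ler_wpM2r// natrSS_le.
  rewrite ler_wpM2l//; apply: le_trans (hA n) _.
  by rewrite ler_wpM2l ?addr_ge0 ?mulr_ge0// AS lerDl.
have gA n : `|g n.+1| <= C3 / n.+1%:R ^+ 2 * A n.
  have n0 : 0 < n.+1%:R :> R by rewrite ltr0n.
  rewrite mulrAC ler_pdivlMr ?exprn_gt0//.
  have := ler_wpM2l (ltW n0) (gle n).
  have -> : n.+1%:R * (n.+1%:R * `|g n.+1|) = `|g n.+1| * n.+1%:R ^+ 2 by ring.
  move=> /le_trans; apply.
  have -> : n.+1%:R * (C * (`|h n| + `|cshift h n| + D / n.+1%:R)) =
     C * (n.+1%:R * `|h n| + n.+1%:R * `|cshift h n| + D).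
    have := lt0r_neq0 n0; set N := n.+1%:R => N0; by field.
  rewrite /C3 -[leRHS]mulrA ler_wpM2l//.
  by have := hA n; have := hA' n; have := AD n; have := A0 n; lra.
(* The exponent is a telescoped majorant of the sum of [C3 / N^2], from
   [1 / N^2 <= 2 (1 / N - 1 / (N + 1))] for [N >= 1]; hence the factor 2 in [E]. *)
have AE n : A n <= D * expR (2 * C3 * (1 - n.+1%:R^-1)).
  elim: n => [|n IH].
    by rewrite invr1 subrr mulr0 expR0 mulr1 /A big_nat1 g0 normr0 add0r.
  rewrite AS; apply: (@le_trans _ _ (A n * expR (C3 / n.+1%:R ^+ 2))).
    have := gA n => /(lerD (lexx (A n)))/le_trans; apply.
    have -> : A n + C3 / n.+1%:R ^+ 2 * A n = A n * (1 + C3 / n.+1%:R ^+ 2) by ring.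
    by rewrite ler_wpM2l// expR_ge1Dx.
  apply: (@le_trans _ _ (D * expR (2 * C3 * (1 - n.+1%:R^-1)) * expR (C3 / n.+1%:R ^+
      2))).
    by rewrite ler_wpM2r// expR_ge0.
  rewrite -mulrA ler_wpM2l// -expRD ler_expR.
  have n0 : 0 < n.+1%:R :> R by rewrite ltr0n.
  have n1 : 1 <= n.+1%:R :> R by rewrite ler1n.
  have -> : n.+2%:R = n.+1%:R + 1 :> R by rewrite natr1.
  move: n0 n1; set N := n.+1%:R => n0 n1.
  rewrite -subr_ge0.
  have -> : 2 * C3 * (1 - (N + 1)^-1) - (2 * C3 * (1 - N^-1) + C3 / N ^+ 2)
    = C3 * ((N - 1) / (N ^+ 2 * (N + 1))).
    by field; rewrite !gt_eqF//; lra.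
  rewrite mulr_ge0// divr_ge0 ?subr_ge0// mulr_ge0 ?sqr_ge0//; lra.
have AK n : A n <= E * D.
  apply: le_trans (AE n) _; rewrite mulrC ler_wpM2r// ler_expR.
  by apply: ler_piMr; [exact: mulr_ge0|rewrite gerBl invr_ge0].
move=> n; split.
  apply: (@le_trans _ _ (A n)); first by rewrite /A lerDl.
  apply: le_trans (AK n) _; rewrite -mulrA ler_peMl ?lerDr ?mulr_ge0//.
  exact: le_trans E1.
by apply: le_trans (hA n) _; rewrite -mulrA ler_wpM2l// addr_ge0 ?mulr_ge0.
Qed.

Variables (al be : R).
Hypothesis graeffe : `|al ^+ 2 - 2 * be| + be ^+ 2 < 1.

Lemma frob_bounds (W : R) : exists2 K : R, 0 <= K & forall sg w0 w1,
  `|sg| <= W -> `|w0| <= W -> `|w1| <= W -> forall n,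
  \sum_(0 <= k < n.+1) `|frobg al be sg w0 w1 k| <= K /\
  n.+1%:R * `|frobh al be sg w0 w1 n| <= K.
Proof.
have [W0|W0] := ltrP W 0.
  by exists 0 => // sg w0 w1 sgW; have := le_lt_trans (le_trans (normr_ge0 _) sgW) W0;
     rewrite ltxx.
pose M := (1 + `|al| + `|be|) / (1 - (`|al ^+ 2 - 2 * be| + be ^+ 2)).
have M0 : 0 <= M by apply: divr_ge0; [rewrite !addr_ge0|rewrite subr_ge0 ltW].
have MW0 : 0 <= M * W by rewrite (mulr_ge0 M0).
have [K K0 HK] := coupled_recurrence_bound (addr_ge0 MW0 W0).
exists K => // sg w0 w1 sgW w0W w1W.
set g := frobg _ _ _ _ _; set h := frobh _ _ _ _ _.
(* Here [D = 1], the size of the leading coefficient [h 0]. *)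
rewrite -[K]mulr1; apply: HK => //.
- exact: frobg0.
- by rewrite /h frobh0 normr1.
- move=> n; have := quadratic_recurrence_bound (T := fun n => sg * frobS al be sg w0 w1 n)
    (B := fun n => W * \sum_(0 <= k < n.+1) `|g k|) graeffe (frobz_rec al be sg w0 w1)
        _ _ n.
  rewrite frobzE normrM (ger0_norm (ler0n _ n)) -/M => /(_ _ _)/le_trans; apply.
  + move=> m; rewrite normrM ler_pM// frobS_sum; exact: ler_norm_sum.
  + move=> m k mk; rewrite ler_wpM2l// (@big_cat_nat _ _ _ m.+1 0 k.+1)//= lerDl.
    exact: sumr_ge0.
  + have S0 : 0 <= \sum_(0 <= k < n.+1) `|g k| by exact: sumr_ge0.
    by rewrite mulrA; apply: ler_pM => //; [rewrite lerDl|rewrite lerDl].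
- move=> n; rewrite -{1}(ger0_norm (ler0n _ n.+1)) -normrM frobgS.
  apply: le_trans (ler_normD _ _) _; rewrite (normrM w0) (normrM w1).
  have h0 := normr_ge0 (h n); have h1 := normr_ge0 (cshift h n).
  apply: (@le_trans _ _ (W * (`|h n| + `|cshift h n|))).
    by rewrite mulrDr lerD// ler_wpM2r.
  by apply: ler_pM; rewrite ?addr_ge0 ?lerDr ?lerDl.
Qed.

(** The difference of two solutions satisfies the same pair of recurrences with extra source terms,
    which [frob_bounds] controls by multiples of [d]. Its leading coefficients vanish, so
    [coupled_recurrence_bound] applies with [D = d] and the estimate is linear in [d]. *)
Lemma frob_lipschitz (W : R) : exists2 L : R, 0 <= L &
  forall sg w0 w1 sg' w0' w1' (d : R),
  `|sg| <= W -> `|w0| <= W -> `|w1| <= W ->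
  `|sg'| <= W -> `|w0'| <= W -> `|w1'| <= W ->
  `|sg - sg'| <= d -> `|w0 - w0'| <= d -> `|w1 - w1'| <= d ->
  forall n,
  \sum_(0 <= k < n.+1) `|frobg al be sg w0 w1 k - frobg al be sg' w0' w1' k| <= L * d /\
  n.+1%:R * `|frobh al be sg w0 w1 n - frobh al be sg' w0' w1' n| <= L * d.
Proof.
have [W0|W0] := ltrP W 0.
  by exists 0 => // sg w0 w1 sg' w0' w1' d sgW;
     have := le_lt_trans (le_trans (normr_ge0 _) sgW) W0; rewrite ltxx.
have [K K0 HK] := frob_bounds W.
pose M := (1 + `|al| + `|be|) / (1 - (`|al ^+ 2 - 2 * be| + be ^+ 2)).
have M0 : 0 <= M by apply: divr_ge0; [rewrite !addr_ge0|rewrite subr_ge0 ltW].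
have MW0 : 0 <= M * (W + K) by rewrite (mulr_ge0 M0) ?addr_ge0.
have WK0 : 0 <= W + 3 * K by rewrite addr_ge0 ?mulr_ge0.
have [L L0 HL] := coupled_recurrence_bound (addr_ge0 MW0 WK0).
exists L => // sg w0 w1 sg' w0' w1' d sgW w0W w1W sgW' w0W' w1W' sgd w0d w1d.
have d0 : 0 <= d by apply: le_trans sgd.
have HK' := HK _ _ _ sgW' w0W' w1W'.
set g := frobg _ _ _ _ _; set g' := frobg _ _ _ _ _.
set h := frobh _ _ _ _ _; set h' := frobh _ _ _ _ _.
have csB (c c' : nat -> R) n : cshift (fun n => c n - c' n) n = cshift c n - cshift c' n.
  by case: n => [|n] //=; rewrite subr0.
apply: (HL d (fun n => h n - h' n) (fun n => g n - g' n)) => //.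
- by rewrite /g /g' !frobg0 subr0.
- by rewrite /h /h' !frobh0 subrr normr0.
- move=> n; pose z := frobz al be sg w0 w1; pose z' := frobz al be sg' w0' w1'.
  pose S := frobS al be sg w0 w1; pose S' := frobS al be sg' w0' w1'.
  have Srec m : z m - z' m = al * cshift (fun m => z m - z' m) m
      - be * cshift (cshift (fun m => z m - z' m)) m + (sg * S m - sg' * S' m).
    have -> : cshift (cshift (fun m => z m - z' m)) m =
        cshift (cshift z) m - cshift (cshift z') m.
      by case: m => [|[|m]] //=; rewrite subr0.
    rewrite csB {1}/z {1}/z' (frobz_rec al be sg) (frobz_rec al be sg') -/z -/z' -/S -/S'.
    ring.
  have := quadratic_recurrence_bound
    (B := fun n => (W + K) * (\sum_(0 <= k < n.+1) `|g k - g' k| + d)) graeffe Srec _ _ n.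
  rewrite /z /z' !frobzE -mulrBr normrM (ger0_norm (ler0n _ n)) -/M => /(_ _
      _)/le_trans; apply.
  + move=> m.
    have -> : sg * S m - sg' * S' m = sg * (S m - S' m) + (sg - sg') * S' m by ring.
    have SS : `|S m - S' m| <= \sum_(0 <= k < m.+1) `|g k - g' k|.
      by rewrite /S /S' !frobS_sum -sumrB; exact: ler_norm_sum.
    have S'K : `|S' m| <= K.
      by apply: le_trans (HK' m).1; rewrite /S' frobS_sum; exact: ler_norm_sum.
    apply: le_trans (ler_normD _ _) _; rewrite !normrM.
    apply: (@le_trans _ _ (W * \sum_(0 <= k < m.+1) `|g k - g' k| + d * K)).
      by apply: lerD; exact: ler_pM.
    have A0 : 0 <= \sum_(0 <= k < m.+1) `|g k - g' k| by exact: sumr_ge0.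
    have := mulr_ge0 W0 d0; have := mulr_ge0 K0 A0; lra.
  + move=> m k mk; rewrite ler_wpM2l ?addr_ge0// lerD2r.
    rewrite (@big_cat_nat _ _ _ m.+1 0 k.+1)//= lerDl.
    exact: sumr_ge0.
  + have S0 : 0 <= \sum_(0 <= k < n.+1) `|g k - g' k| by exact: sumr_ge0.
    rewrite mulrA; apply: ler_wpM2r; first exact: addr_ge0.
    by rewrite lerDl.
- move=> n; rewrite -{1}(ger0_norm (ler0n _ n.+1)) -normrM mulrBr !frobgS csB.
  rewrite -/h -/h'.
  have -> : w0 * h n + w1 * cshift h n - (w0' * h' n + w1' * cshift h' n) =
    w0 * (h n - h' n) + w1 * (cshift h n - cshift h' n) +
    ((w0 - w0') * h' n + (w1 - w1') * cshift h' n) by ring.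
  have n0 : 0 < n.+1%:R :> R by rewrite ltr0n.
  have h'K : `|h' n| <= K / n.+1%:R.
    by rewrite ler_pdivlMr// mulrC; exact: (HK' n).2.
  have csK : `|cshift h' n| <= 2 * K / n.+1%:R.
    rewrite ler_pdivlMr// mulrC; case: n {n0 h'K} => [|n] /=.
      by rewrite normr0 mulr0 mulr_ge0.
    apply: (@le_trans _ _ (2 * (n.+1%:R * `|h' n|))).
      by rewrite mulrA ler_wpM2r// natrSS_le.
    by rewrite ler_wpM2l//; exact: (HK' n).2.
  set p := `|h n - h' n|; set q := `|cshift h n - cshift h' n|.
  apply: (@le_trans _ _ (W * p + W * q + (d * (K / n.+1%:R) + d * (2 * K / n.+1%:R)))).
    apply: le_trans (ler_normD _ _) _; apply: lerD.
      apply: le_trans (ler_normD _ _) _; rewrite !normrM.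
      by apply: lerD; rewrite ler_wpM2r.
    apply: le_trans (ler_normD _ _) _; rewrite !normrM.
    by apply: lerD; apply: ler_pM.
  have -> : W * p + W * q + (d * (K / n.+1%:R) + d * (2 * K / n.+1%:R)) =
     W * (p + q) + 3 * K * (d / n.+1%:R) by ring.
  have pq0 : 0 <= p + q by apply: addr_ge0; exact: normr_ge0.
  have dn0 : 0 <= d / n.+1%:R by rewrite divr_ge0.
  have := mulr_ge0 MW0 pq0; have := mulr_ge0 MW0 dn0.
  have := mulr_ge0 W0 dn0; have := mulr_ge0 K0 pq0.
  set D := d / _; nra.
Qed.

End UniformBounds.

(** * Behaviour of power series at the end point 1 *)

Section Abel.
Variable R : realType.
Implicit Types c : nat -> R.

Lemma is_derive1_continuous (f : R -> R) (x d : R) :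
  is_derive x (1 : R) f d -> {for x, continuous f}.
Proof. by case=> /derivable1_diffP/differentiable_continuous. Qed.

Lemma abs_summable_psconv c (K : R) :
  (forall n, \sum_(0 <= k < n) `|c k| <= K) -> psconv 1 c.
Proof.
move=> cK; apply: (@psconv_geometric _ _ K 1) => // n.
rewrite expr1n mulr1; apply: le_trans (cK n.+1).
by rewrite big_nat_recr//= lerDr sumr_ge0.
Qed.

Lemma abs_summable_cvg1 c (K : R) :
  (forall n, \sum_(0 <= k < n) `|c k| <= K) -> cvgn (series (fun k => `|c k|)).
Proof.
move=> cK; apply: nondecreasing_is_cvgn.
  apply/nondecreasing_seqP => n; rewrite /series /= big_nat_recr//= lerDl.
  exact: normr_ge0.
by exists K => _ [n _ <-]; exact: cK.
Qed.

Lemma psum_split c (N : nat) x : cvgn (pseries c x) ->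
  cvgn (pseries (fun k => if (k < N)%N then 0 else c k) x) /\
  psum c x = (\poly_(k < N) c k).[x] + psum (fun k => if (k < N)%N then 0 else c k) x.
Proof.
move=> cx; pose c0 k := if (k < N)%N then c k else 0.
have c0E n : (N <= n)%N -> pseries c0 x n = (\poly_(k < N) c k).[x].
  move=> Nn; rewrite /pseries /series /= (@big_cat_nat _ _ _ N)//=.
  rewrite [X in _ + X]big_nat_cond [X in _ + X]big1 ?addr0; last first.
    by move=> i /andP[/andP[Ni _] _]; rewrite /c0 ltnNge Ni mul0r.
  rewrite horner_poly big_mkord; apply: eq_bigr => i _.
  by rewrite /c0 ltn_ord.
have cc0 : pseries c0 x @ \oo --> (\poly_(k < N) c k).[x].
  apply: cvg_near_cst; near=> n; apply: c0E; near: n; by exists N.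
have -> : (fun k => if (k < N)%N then 0 else c k) = (fun k => 1 * c k + (-1) * c0 k).
  by apply/funext => k; rewrite /c0; case: ifP => _; ring.
have c0x : cvgn (pseries c0 x) by exact: cvgP cc0.
split; first exact: is_cvg_pseries_lin.
rewrite psum_lin// /psum -[limn (pseries c0 x)]/(psum c0 x) /psum (cvg_lim _ cc0)//; ring.
Unshelve. all: by end_near. Qed.

Lemma abs_summable_cvg c (K x : R) : 0 <= x <= 1 ->
  (forall n, \sum_(0 <= k < n) `|c k| <= K) -> cvgn (pseries c x).
Proof.
case/andP=> x0 x1 cK; apply: normed_cvg.
apply: series_le_cvg (abs_summable_cvg1 cK) => [n|n|n] //=.
by rewrite normrM ler_piMr// normrX exprn_ile1// ger0_norm.
Qed.

(** Only the end point 1 is in question. There a tail is at most [e / 3] uniformly on [[0, 1]], and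
    the remaining head is a polynomial. *)
Lemma abs_summable_continuous c (K : R) :
  (forall n, \sum_(0 <= k < n) `|c k| <= K) -> {within `[0, 1], continuous (psum c)}.
Proof.
move=> cK; have c1 := abs_summable_psconv cK.
apply/(continuous_within_itvP _ ltr01); split.
- move=> x; rewrite in_itv/= => /andP[x0 x1].
  apply: is_derive1_continuous (is_derive_psum c1 _).
  by rewrite ger0_norm// ltW.
- apply: cvg_at_right_filter.
  by apply: is_derive1_continuous (is_derive_psum c1 _); rewrite normr0.
- apply/cvgrPdist_le => e e0.
  have e3 : 0 < e / 3 by rewrite divr_gt0.
  have ccv := abs_summable_cvg1 cK.
  have [N _ HN] := (@cvgrPdist_le _ _ _ _ _ _ _).1 ccv _ e3.
  have tail n : \sum_(0 <= k < n) `|if (k < N)%N then 0 else c k| <= e / 3.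
    have cN := HN N (leqnn N).
    have [nN|Nn] := leqP n N.
      rewrite big_nat_cond big1 ?ltW// => k /andP[/andP[_ kn] _].
      by rewrite (leq_trans kn nN) normr0.
    rewrite (@big_cat_nat _ _ _ N)//=; last exact: ltnW.
    rewrite big_nat_cond big1 ?add0r; last first.
      by move=> k /andP[/andP[_ kn] _]; rewrite kn normr0.
    have -> : \sum_(N <= k < n) `|if (k < N)%N then 0 else c k| = \sum_(N <= k < n) `|c
        k|.
      by apply: eq_big_nat => k /andP[Nk _]; rewrite ltnNge Nk.
    apply: le_trans cN; apply: le_trans (ler_norm _).
    rewrite lerBrDr [leLHS]addrC.
    have -> : series (fun k => `|c k|) N + \sum_(N <= k < n) `|c k| = series (fun k =>
        `|c k|) n.
      by rewrite /series /= -big_cat_nat//= ltnW.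
    apply: nondecreasing_cvgn_le => //.
    apply/nondecreasing_seqP => m; rewrite /series /= big_nat_recr//= lerDl.
    exact: normr_ge0.
  have tailx x : 0 <= x <= 1 -> `|psum (fun k => if (k < N)%N then 0 else c k) x| <= e
      / 3.
    move=> /andP[x0 x1].
    apply: psum_le_sum (tail) => [|n].
      by apply: (psum_split N _).1; apply: abs_summable_cvg cK; rewrite x0.
    by rewrite normrM ler_piMr// normrX exprn_ile1// ger0_norm.
  have pc : (\poly_(k < N) c k).[x] @[x --> 1^'-] --> (\poly_(k < N) c k).[1].
    by apply: cvg_at_left_filter; exact: continuous_horner.
  near=> x.
  have x01 : 0 <= x <= 1.
    by apply/andP; split; near: x; [exact: nbhs_left_ge|exact: nbhs_left_le].
  have e01 : (0 : R) <= (1 : R) <= (1 : R) by rewrite ler01 lexx.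
  rewrite (psum_split N (abs_summable_cvg x01 cK)).2.
  rewrite (psum_split N (abs_summable_cvg e01 cK)).2.
  have t1 := tailx _ e01; have t2 := tailx _ x01.
  have : `|(\poly_(k < N) c k).[1] - (\poly_(k < N) c k).[x]| <= e / 3.
    by near: x; exact: (@cvgrPdist_le _ _ _ _ _ _ _).1 pc _ e3.
  move: t1 t2; rewrite !ler_norml; lra.
Unshelve. all: by end_near. Qed.

Lemma sum_prefix (C : R) N n :
  \sum_(0 <= k < n) (if (k < N)%N then C else 0) = C * (minn n N)%:R.
Proof.
elim: n => [|n IH]; first by rewrite big_nil min0n mulr0.
rewrite big_nat_recr//= IH; case: ltnP => nN.
  by rewrite !(minn_idPl _)// 1?ltnW// -natr1 mulrDr mulr1.
by rewrite addr0 !(minn_idPr _)// leqW.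
Qed.

(** Coefficients [O(1/n)] allow at most a logarithm. The first [N] terms stay bounded and are killed
    by [1 - u]; the others add up to at most [(C / N) / (1 - u)], with [C / N] as small as
    desired. *)
Lemma psum_singularity_o c (C : R) :
  (forall n, n.+1%:R * `|c n| <= C) -> (1 - u) * psum c u @[u --> 1^'-] --> (0 : R).
Proof.
move=> cC.
have C0 : 0 <= C by apply: le_trans (cC 0%N); exact: mulr_ge0.
have cC' n : `|c n| <= C / n.+1%:R by rewrite ler_pdivlMr ?ltr0n// mulrC.
have cC1 n : `|c n| <= C * 1 ^+ n.
  by rewrite expr1n; apply: le_trans (cC' n) _; rewrite ler_wpM2l// invf_le1 ?ler1n
      ?ltr0n.
have cr : psconv 1 c by apply: psconv_geometric cC1; rewrite ?mulr1.
apply/cvgrPdist_le => e e0.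
pose N := (Num.trunc (2 * C / e)).+1.
have N0 : 0 < N%:R :> R by rewrite ltr0n.
have CN : C / N%:R <= e / 2.
  rewrite ler_pdivrMr// mulrC mulrA ler_pdivlMr//.
  have : 2 * C / e <= N%:R by rewrite ltW// truncnS_gt.
  rewrite ler_pdivrMr//; lra.
have CN0 : 0 < C * N%:R + 1 by rewrite ltr_wpDl// mulr_ge0// ltW.
near=> u.
have u0 : 0 <= u by near: u; exact: nbhs_left_ge.
have u1 : u < 1 by near: u; exact: nbhs_left_lt.
have uN : (1 - u) * (C * N%:R) <= e / 2.
  apply: (@le_trans _ _ ((1 - u) * (C * N%:R + 1))).
    by rewrite ler_wpM2l ?lerDl// subr_ge0 ltW.
  rewrite -ler_pdivlMr// ltW//; near: u.
  by apply: nbhs_left_ltBl; rewrite !divr_gt0.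
have u1' : 0 <= 1 - u by rewrite subr_ge0 ltW.
rewrite sub0r normrN normrM (ger0_norm u1').
have B : `|psum c u| <= C * N%:R + C / N%:R * (1 - u)^-1.
  apply: (psum_le_sum (d := fun k => (if (k < N)%N then C else 0) + C / N%:R * u ^+ k)).
  - by apply: cr; rewrite ger0_norm.
  - move=> n; rewrite normrM normrX (ger0_norm u0).
    have un : u ^+ n <= 1 by rewrite exprn_ile1// ltW.
    have un0 : 0 <= u ^+ n by rewrite exprn_ge0.
    case: ltnP => nN.
      apply: (@le_trans _ _ (C * 1)); last first.
        by rewrite mulr1 lerDl !mulr_ge0// invr_ge0 ltW.
      by apply: ler_pM => //; rewrite (le_trans (cC1 n))// expr1n mulr1.
    rewrite add0r ler_wpM2r//; apply: le_trans (cC' n) _.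
    rewrite ler_wpM2l// lef_pV2 ?posrE ?ltr0n// ler_nat; exact: leqW.
  - move=> n; rewrite big_split/= lerD//.
      by rewrite sum_prefix ler_wpM2l// ler_nat geq_minr.
    rewrite -mulr_sumr ler_wpM2l ?divr_ge0// sum_geometric_le// u0//.
apply: (@le_trans _ _ ((1 - u) * (C * N%:R + C / N%:R * (1 - u)^-1))).
  by rewrite ler_wpM2l// subr_ge0 ltW.
rewrite mulrDr.
have -> : (1 - u) * (C / N%:R * (1 - u)^-1) = C / N%:R.
  by rewrite mulrCA divff ?mulr1// subr_eq0 gt_eqF.
lra.
Unshelve. all: by end_near. Qed.

End Abel.

(** * Derivatives *)

Section Calculus.
Variables (R : realType) (V : normedModType R).
Implicit Types (f g : V -> R) (x v : V) (a b : R).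

(* Pointwise forms of the [is_derive] rules, whose [fun]-abstractions unify with
   those of explicit formulas. *)
Lemma isd_cst x v a : is_derive x v (fun=> a) 0.
Proof. exact: is_derive_cst. Qed.

Lemma isd_add f g x v a b : is_derive x v f a -> is_derive x v g b ->
  is_derive x v (fun y => f y + g y) (a + b).
Proof. exact: is_deriveD. Qed.

Lemma isd_opp f x v a : is_derive x v f a -> is_derive x v (fun y => - f y) (- a).
Proof. exact: is_deriveN. Qed.

Lemma isd_sub f g x v a b : is_derive x v f a -> is_derive x v g b ->
  is_derive x v (fun y => f y - g y) (a - b).
Proof. exact: is_deriveB. Qed.

Lemma isd_mul f g x v a b : is_derive x v f a -> is_derive x v g b ->
  is_derive x v (fun y => f y * g y) (f x * b + a * g x).
Proof.
move=> fa gb; apply: is_derive_eq (is_deriveM fa gb) _.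
by rewrite /GRing.scale/= (mulrC (g x)).
Qed.

Lemma isd_scale f x v a k : is_derive x v f a -> is_derive x v (fun y => k * f y) (k * a).
Proof. by move=> fa; apply: is_derive_eq (isd_mul (isd_cst x v k) fa) _; rewrite mul0r
    addr0. Qed.

Lemma isd_sqr f x v a : is_derive x v f a ->
  is_derive x v (fun y => f y ^+ 2) (2 * f x * a).
Proof. by move=> fa; apply: is_derive_eq (isd_mul fa fa) _; ring. Qed.

Lemma isd_exp f x v a k : is_derive x v f a ->
  is_derive x v (fun y => f y ^+ k) (k%:R * f x ^+ k.-1 * a).
Proof.
move=> fa; elim: k => [|k IH].
  by apply: is_derive_eq (isd_cst x v 1) _; rewrite !mul0r.
under eq_fun do rewrite exprS.
apply: is_derive_eq (isd_mul fa IH) _; rewrite -natr1 /=.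
by case: k {IH} => [|k] /=; [rewrite !expr0; ring|rewrite exprS; ring].
Qed.

(** Both derivatives are derivatives at 0 along the line [k *: v + x], which reduces the claim to
    the one-variable chain rule. *)
Lemma isd_comp (h : R -> R) f x v a b : is_derive (f x) (1 : R) h b ->
  is_derive x v f a -> is_derive x v (h \o f) (b * a).
Proof.
move=> hb [fd fa].
have E : 'D_v f x = 'D_1 (fun k : R => f (k *: v + x)) 0.
  apply: (congr1 (fun g : R -> R => lim (g @ 0^'))); apply/funext => k /=.
  by rewrite addr0 scale0r add0r [_%:A]mulr1.
have E' : 'D_v (h \o f) x = 'D_1 (fun k : R => h (f (k *: v + x))) 0.
  apply: (congr1 (fun g : R -> R => lim (g @ 0^'))); apply/funext => k /=.
  by rewrite addr0 scale0r add0r [_%:A]mulr1.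
have D1 : is_derive (0 : R) 1 (fun k : R => f (k *: v + x)) a.
  by apply: DeriveDef; [exact: (derivable1P f x v).1 fd|rewrite -E].
have hb' : is_derive (f (0 *: v + x)) (1 : R) h b by rewrite scale0r add0r.
have D2 := @is_derive1_comp _ h (fun k : R => f (k *: v + x)) 0 b a hb' D1.
case: D2 => D2 D3; apply: DeriveDef; first exact: (derivable1P (h \o f) x v).2 D2.
by rewrite E'.
Qed.

Lemma isd_inv f x v a : f x != 0 -> is_derive x v f a ->
  is_derive x v (fun y => (f y)^-1) (- a / f x ^+ 2).
Proof.
move=> fx fa.
have inv_d : is_derive (f x) (1 : R) (fun y : R => y^-1) (- (f x) ^- 2 *: 1).
  exact: (is_deriveV (f := id)).
apply: is_derive_eq (isd_comp inv_d fa) _.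
by rewrite /GRing.scale/= mulr1 mulrC mulrN mulNr.
Qed.

Lemma isd_div f g x v a b : g x != 0 -> is_derive x v f a -> is_derive x v g b ->
  is_derive x v (fun y => f y / g y) ((a * g x - f x * b) / g x ^+ 2).
Proof.
move=> gx fa gb; apply: is_derive_eq (isd_mul fa (isd_inv gx gb)) _.
by field; rewrite gx.
Qed.

End Calculus.

Section OneVariable.
Variable R : realType.
Implicit Types (f : R -> R) (a b x : R).

Lemma isd_id x : is_derive x (1 : R) (fun y : R => y) 1.
Proof. exact: is_derive_id. Qed.

Lemma within_continuous f a b : (forall x, a <= x <= b -> {for x, continuous f}) ->
  {within `[a, b], continuous f}.
Proof.
move=> cf; apply: continuous_in_subspaceT => x; rewrite inE/= in_itv/=.
exact: cf.
Qed.

Lemma derive_ndecr f (df : R -> R) a b : a <= b ->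
  {within `[a, b], continuous f} ->
  (forall x, a < x < b -> is_derive x (1 : R) f (df x)) ->
  (forall x, a < x < b -> 0 <= df x) -> f a <= f b.
Proof.
rewrite le_eqVlt => /orP[/eqP->//|ab] cf fd df0.
have fd' x : x \in `]a, b[ -> is_derive x 1 f (df x) by rewrite in_itv/=; exact: fd.
have [c] := MVT ab fd' cf.
rewrite in_itv/= => /df0 c0 E; rewrite -subr_ge0 E mulr_ge0// subr_ge0 ltW//.
Qed.

Lemma derive_nincr f (df : R -> R) a b : a <= b ->
  {within `[a, b], continuous f} ->
  (forall x, a < x < b -> is_derive x (1 : R) f (df x)) ->
  (forall x, a < x < b -> df x <= 0) -> f b <= f a.
Proof.
move=> ab cf fd df0; rewrite -lerN2.
apply: (@derive_ndecr (fun x => - f x) (fun x => - df x)) => //.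
- by move=> x; apply: continuousN; exact: cf.
- by move=> x xab; apply: isd_opp; exact: fd.
- by move=> x /df0; rewrite oppr_ge0.
Qed.

Lemma derive0_constant f a b : a <= b ->
  {within `[a, b], continuous f} ->
  (forall x, a < x < b -> is_derive x (1 : R) f 0) -> f b = f a.
Proof.
move=> ab cf fd; apply/eqP; rewrite eq_le.
by rewrite (derive_nincr ab cf fd)//= (derive_ndecr ab cf fd).
Qed.

End OneVariable.

(** * Shooting from the end point u = 0 *)

Section SolutionFamily.
Variables (R : realType) (al be : R).

Definition frobp (u : R) : R := u * (1 - u) * (1 - al * u + be * u ^+ 2).
Definition frobH sg w0 w1 : R -> R := psum (frobh al be sg w0 w1).
Definition frobG sg w0 w1 : R -> R := psum (frobg al be sg w0 w1).

Hypothesis graeffe : `|al ^+ 2 - 2 * be| + be ^+ 2 < 1.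
Hypothesis Qpos : forall u : R, 0 <= u <= 1 -> 0 < 1 - al * u + be * u ^+ 2.

Lemma frobp_gt0 (u : R) : 0 < u < 1 -> 0 < frobp u.
Proof.
case/andP=> u0 u1; rewrite /frobp mulr_gt0 ?mulr_gt0 ?subr_gt0//.
by apply: Qpos; rewrite !ltW.
Qed.

Section OneSolution.
Variables sg w0 w1 : R.
Local Notation h := (frobh al be sg w0 w1).
Local Notation g := (frobg al be sg w0 w1).
Local Notation H := (frobH sg w0 w1).
Local Notation G := (frobG sg w0 w1).

Lemma frob_bound1 : exists2 K : R, 0 <= K & forall n,
  \sum_(0 <= k < n) `|g k| <= K /\ n.+1%:R * `|h n| <= K.
Proof.
pose W := `|sg| + `|w0| + `|w1|.
have [K K0 HK] := frob_bounds graeffe W.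
have := HK sg w0 w1; rewrite /W.
have s0 := normr_ge0 sg; have a0 := normr_ge0 w0; have b0 := normr_ge0 w1.
move=> /(_ ltac:(lra) ltac:(lra) ltac:(lra)) {}HK.
exists K => // n; split; last exact: (HK n).2.
case: n => [|n]; first by rewrite big_nil.
exact: (HK n).1.
Qed.

Lemma frobh_psconv1 : psconv 1 h.
Proof.
have [K K0 HK] := frob_bound1.
apply: (@psconv_geometric _ _ K 1) => // n; rewrite expr1n mulr1.
by apply: le_trans (HK n).2; rewrite ler_peMl// ler1n.
Qed.

Lemma frobS_psconv1 : psconv 1 (frobS al be sg w0 w1).
Proof.
have [K K0 HK] := frob_bound1.
apply: (@psconv_geometric _ _ K 1) => // n; rewrite expr1n mulr1 frobS_sum.
by apply: le_trans (HK n.+1).1; exact: ler_norm_sum.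
Qed.

Lemma frobH0 : H 0 = 1. Proof. exact: psum0. Qed.
Lemma frobG0 : G 0 = 0. Proof. by rewrite /frobG psum0 frobg0. Qed.

Lemma frobG_derive (u : R) : 0 <= u < 1 ->
  is_derive u (1 : R) G ((w0 + w1 * u) * H u).
Proof.
case/andP=> u0 u1.
by apply: (is_derive_frobG frobh_psconv1 frobS_psconv1); rewrite ger0_norm.
Qed.

Lemma frobH_derive (u : R) : 0 < u < 1 -> is_derive u (1 : R) H (sg * G u / frobp u).
Proof.
move=> u01; have p0 := frobp_gt0 u01; have /andP[u0 u1] := u01.
have u1' : `|u| < 1 by rewrite ger0_norm// ltW.
apply: is_derive_eq (is_derive_psum frobh_psconv1 u1') _.
rewrite -(frobH_ode frobh_psconv1 frobS_psconv1 u1') -/(frobp u) mulrC mulKf//.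
exact: lt0r_neq0.
Qed.

Lemma frobH_continuous (u : R) : 0 <= u < 1 -> {for u, continuous H}.
Proof.
case/andP=> u0 u1.
by apply: is_derive1_continuous (is_derive_psum frobh_psconv1 _); rewrite ger0_norm.
Qed.

Lemma frobG_continuous (u : R) : 0 <= u < 1 -> {for u, continuous G}.
Proof. by move=> /frobG_derive; exact: is_derive1_continuous. Qed.

Lemma frobG_within : {within `[0, 1], continuous G}.
Proof.
have [K K0 HK] := frob_bound1.
by apply: (@abs_summable_continuous _ _ K) => n; exact: (HK n).1.
Qed.

Lemma frobG_left : G u @[u --> 1^'-] --> G 1.
Proof. by have /(continuous_within_itvP _ ltr01)[] := frobG_within. Qed.

Lemma frobH_o : (1 - u) * H u @[u --> 1^'-] --> (0 : R).
Proof.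
have [K K0 HK] := frob_bound1.
by apply: (@psum_singularity_o _ _ K) => n; exact: (HK n).2.
Qed.

(** Since [G] vanishes at 0, its positivity near 0 has no uniform margin; the continuous quotient
    [G / u] has one by compactness. *)
Lemma frobG_factor : exists G1 : R -> R, [/\ {within `[0, 1], continuous G1},
  G1 0 = w0 & forall u : R, 0 <= u <= 1 -> G u = u * G1 u].
Proof.
have [K K0 HK] := frob_bound1.
have gS n : \sum_(0 <= k < n) `|g k.+1| <= K.
  apply: le_trans (HK n.+1).1.
  by rewrite big_nat_recl//= frobg0 normr0 add0r.
exists (psum (fun n => g n.+1)); split; first exact: abs_summable_continuous gS.
  rewrite psum0; have := frobgS al be sg w0 w1 0.
  by rewrite mul1r /= frobh0 mulr1 mulr0 addr0.
move=> u u01; rewrite -psum_cshift; last exact: abs_summable_cvg gS.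
congr psum; apply/funext => -[|n] //; exact: frobg0.
Qed.

(* Conservation of [E = H^2 + G^2] up to an exponential factor. *)
Lemma frob_no_common_zero (u : R) : 0 < u < 1 -> H u = 0 -> G u = 0 -> False.
Proof.
case/andP=> u0 u1 Hu Gu.
have zero (e : R) : 0 < e < u -> H e = 0.
  case/andP=> e0 eu.
  (* [H H' + G G' = F H G], so any [C >= F^2 + 1] makes the derivative of [E] a sum of nonnegative
     terms. Then [E u = 0] forces [E] to vanish to the left of [u]. *)
  pose F x := sg / frobp x + (w0 + w1 * x).
  have Fc : {within `[e, u], continuous (fun x => F x ^+ 2)}.
    apply: within_continuous => x /andP[ex xu].
    have x01 : 0 < x < 1 by rewrite (lt_le_trans e0 ex) (le_lt_trans xu u1).
    have p0 := lt0r_neq0 (frobp_gt0 x01).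
    have dp : is_derive x (1 : R) frobp _ :=
      isd_mul (isd_mul (isd_id x) (isd_sub (isd_cst x 1 1) (isd_id x)))
         (isd_add (isd_sub (isd_cst x 1 1) (isd_scale al (isd_id x))) (isd_scale be
             (isd_sqr (isd_id x)))).
    apply: is_derive1_continuous.
  have [c _ Hc] := EVT_max (ltW eu) Fc.
  pose C := F c ^+ 2 + 1.
  pose E x := (H x ^+ 2 + G x ^+ 2) * expR (C * x).
  pose dE x := ((2 * H x * G x * F x) + C * (H x ^+ 2 + G x ^+ 2)) * expR (C * x).
  have Ed (x : R) : e <= x <= u -> is_derive x (1 : R) E (dE x).
    move=> /andP[ex xu].
    have x01 : 0 < x < 1 by rewrite (lt_le_trans e0 ex) (le_lt_trans xu u1).
    have x01' : 0 <= x < 1 by case/andP: x01 => /ltW-> ->.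
    apply: is_derive_eq
      (isd_mul (isd_add (isd_sqr (frobH_derive x01)) (isd_sqr (frobG_derive x01')))
          (isd_comp (is_derive_expR (C * x)) (isd_scale C (isd_id x)))) _.
    rewrite /dE /F /=; have p0 := lt0r_neq0 (frobp_gt0 x01). by field.
  have EE : E e <= E u.
    apply: (@derive_ndecr _ E dE e u); first exact: ltW.
    - by apply: within_continuous => x /Ed; exact: is_derive1_continuous.
    - by move=> x /andP[/ltW ex /ltW xu]; apply: Ed; rewrite ex.
    - move=> x /andP[/ltW ex /ltW xu]; apply: mulr_ge0; last exact: expR_ge0.
      have FC : F x ^+ 2 + 1 <= C by rewrite lerD2r; apply: Hc; rewrite in_itv/= ex.
      have A0 : 0 <= H x ^+ 2 + G x ^+ 2 by rewrite addr_ge0 ?sqr_ge0.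
      have := ler_wpM2r A0 FC.
      have -> : 2 * H x * G x * F x + C * (H x ^+ 2 + G x ^+ 2) =
          (C * (H x ^+ 2 + G x ^+ 2) - (F x ^+ 2 + 1) * (H x ^+ 2 + G x ^+ 2)) +
          ((H x * F x + G x) ^+ 2 + ((G x * F x) ^+ 2 + H x ^+ 2)) by ring.
      by move=> CA; rewrite addr_ge0 ?subr_ge0// !addr_ge0// sqr_ge0.
  have : E u = 0 by rewrite /E Hu Gu expr0n/= addr0 mul0r.
  move=> E0; move: EE; rewrite E0 /E pmulr_lle0 ?expR_gt0// => A.
  apply/eqP; rewrite -sqrf_eq0 eq_le sqr_ge0 andbT.
  by apply: le_trans A; rewrite lerDl sqr_ge0.
(* [H] vanishing on all of [(0, u)] contradicts [H 0 = 1]. *)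
have H1 : H @ (0 : R)^'+ --> (1 : R).
  rewrite -frobH0; apply: cvg_at_right_filter.
  by apply: frobH_continuous; rewrite lexx ltr01.
have H2 : H @ (0 : R)^'+ --> (0 : R).
  apply: cvg_near_cst; near=> x; apply: zero; apply/andP; split.
    by near: x; exact: nbhs_right_gt.
  by near: x; exact: nbhs_right_lt.
have E10 : (1 : R) = 0 := cvg_unique (@Rhausdorff R) H1 H2.
by have := oner_neq0 R; rewrite E10 eqxx.
Unshelve. all: by end_near. Qed.

End OneSolution.

(** The weights record the two ends: [frobg] has no constant term, whence the factor [u]; the
    differences of [frobh] are summed against a geometric series, whence the factor [1 - u]. *)
Lemma frob_lipschitz_fun (W : R) : exists2 L : R, 0 <= L &
  forall sg w0 w1 sg' w0' w1' (d : R),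
  `|sg| <= W -> `|w0| <= W -> `|w1| <= W ->
  `|sg'| <= W -> `|w0'| <= W -> `|w1'| <= W ->
  `|sg - sg'| <= d -> `|w0 - w0'| <= d -> `|w1 - w1'| <= d ->
  (forall u : R, 0 <= u <= 1 -> `|frobG sg w0 w1 u - frobG sg' w0' w1' u| <= L * d * u) /\
  (forall u : R, 0 <= u < 1 ->
     (1 - u) * `|frobH sg w0 w1 u - frobH sg' w0' w1' u| <= L * d).
Proof.
have [L L0 HL] := frob_lipschitz graeffe W.
exists L => // sg w0 w1 sg' w0' w1' d a1 a2 a3 a4 a5 a6 a7 a8 a9.
have {a1 a2 a3 a4 a5 a6 a7 a8 a9} HLd := HL _ _ _ _ _ _ _ a1 a2 a3 a4 a5 a6 a7 a8 a9.
have Ld0 : 0 <= L * d by apply: le_trans (HLd 0%N).2; exact: mulr_ge0.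
have [K K0 HK] := frob_bound1 sg w0 w1.
have [K' K'0 HK'] := frob_bound1 sg' w0' w1'.
split=> u /andP[u0 u1].
  have u01 : 0 <= u <= 1 by rewrite u0.
  have c1 := abs_summable_cvg u01 (fun n => (HK n).1).
  have c2 := abs_summable_cvg u01 (fun n => (HK' n).1).
  have -> : frobG sg w0 w1 u - frobG sg' w0' w1' u =
      psum (fun n => 1 * frobg al be sg w0 w1 n + (-1) * frobg al be sg' w0' w1' n) u.
    by rewrite psum_lin// /frobG; ring.
  apply: (psum_le_sum (d := fun k => `|frobg al be sg w0 w1 k - frobg al be sg' w0' w1'
      k| * u)).
  - exact: is_cvg_pseries_lin.
  - move=> n; rewrite mul1r mulN1r normrM.
    case: n => [|n]; last by rewrite normrX ler_wpM2l// ger0_norm// exprS ler_piMr//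
        exprn_ile1.
    by rewrite !frobg0 subrr normr0 !mul0r.
  - move=> n; rewrite -mulr_suml ler_wpM2r//.
    case: n => [|n]; first by rewrite big_nil.
    exact: (HLd n).1.
have u1' : `|u| < 1 by rewrite ger0_norm.
have c1 := frobh_psconv1 (sg := sg) (w0 := w0) (w1 := w1) u1'.
have c2 := frobh_psconv1 (sg := sg') (w0 := w0') (w1 := w1') u1'.
have -> : frobH sg w0 w1 u - frobH sg' w0' w1' u =
    psum (fun n => 1 * frobh al be sg w0 w1 n + (-1) * frobh al be sg' w0' w1' n) u.
  by rewrite psum_lin// /frobH; ring.
have u1'' : 0 < 1 - u by rewrite subr_gt0.
rewrite mulrC -ler_pdivlMr//.
apply: (psum_le_sum (d := fun k => L * d * u ^+ k)).
- exact: is_cvg_pseries_lin.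
- move=> n; rewrite mul1r mulN1r normrM normrX (ger0_norm u0) ler_wpM2r ?exprn_ge0//.
  by apply: le_trans (HLd n).2; rewrite ler_peMl// ler1n.
- by move=> n; rewrite -mulr_sumr ler_wpM2l// sum_geometric_le// u0.
Qed.

End SolutionFamily.

Section Shooting.
Variables (R : realType) (al be : R).
Hypothesis graeffe : `|al ^+ 2 - 2 * be| + be ^+ 2 < 1.
Hypothesis Qpos : forall u : R, 0 <= u <= 1 -> 0 < 1 - al * u + be * u ^+ 2.
Local Notation H := (frobH al be).
Local Notation G := (frobG al be).
Local Notation p := (frobp al be).

Lemma family_lipschitz (s0 s1 a0 a1 b0 b1 M : R) : exists2 L : R, 0 <= L &
  forall m m' : R, 0 <= m <= M -> 0 <= m' <= M ->
  (forall u : R, 0 <= u <= 1 ->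
    `|G (s0 + s1 * m) (a0 + a1 * m) (b0 + b1 * m) u -
      G (s0 + s1 * m') (a0 + a1 * m') (b0 + b1 * m') u| <= L * `|m - m'| * u) /\
  (forall u : R, 0 <= u < 1 ->
    (1 - u) * `|H (s0 + s1 * m) (a0 + a1 * m) (b0 + b1 * m) u -
      H (s0 + s1 * m') (a0 + a1 * m') (b0 + b1 * m') u| <= L * `|m - m'|).
Proof.
pose D := `|s1| + `|a1| + `|b1|.
pose W := `|s0| + `|a0| + `|b0| + D * `|M|.
have [L L0 HL] := frob_lipschitz_fun graeffe W.
have hs0 := normr_ge0 s0; have hs1 := normr_ge0 s1.
have ha0 := normr_ge0 a0; have ha1 := normr_ge0 a1.
have hb0 := normr_ge0 b0; have hb1 := normr_ge0 b1.
have D0 : 0 <= D by rewrite /D; lra.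
have bd (c0 c1 m : R) : 0 <= m <= M -> `|c0| <= `|s0| + `|a0| + `|b0| -> `|c1| <= D ->
    `|c0 + c1 * m| <= W.
  move=> /andP[m0 mM] c0s c1D; apply: le_trans (ler_normD _ _) _.
  rewrite /W lerD// normrM; apply: ler_pM => //.
  by rewrite ger0_norm// (le_trans mM)// ler_norm.
have lip (c0 c1 m m' : R) : `|c1| <= D ->
    `|c0 + c1 * m - (c0 + c1 * m')| <= D * `|m - m'|.
  move=> c1D; have -> : c0 + c1 * m - (c0 + c1 * m') = c1 * (m - m') by ring.
  by rewrite normrM ler_wpM2r.
exists (L * D); first exact: mulr_ge0.
move=> m m' mM mM'; rewrite -!(mulrA L).
have s1D : `|s1| <= D by rewrite /D; lra.
have a1D : `|a1| <= D by rewrite /D; lra.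
have b1D : `|b1| <= D by rewrite /D; lra.
have := HL (s0 + s1 * m) (a0 + a1 * m) (b0 + b1 * m)
  (s0 + s1 * m') (a0 + a1 * m') (b0 + b1 * m') (D * `|m - m'|).
apply; try (by apply: lip); by apply: bd => //; lra.
Qed.

(** The witness is [sup S]: if [P] failed there, the step would produce an element of [S] beyond
    it. *)
Lemma continuation (S : set R) (P : R -> Prop) (M : R) : S 0 ->
  (forall m : R, S m -> 0 <= m <= M) ->
  (forall m : R, 0 <= m <= M -> (forall e : R, 0 < e -> exists2 m', S m' & m - e < m'
      <= m) ->
     ~ P m -> exists2 d, 0 < d & S (m + d)) ->
  exists2 m, 0 <= m <= M & P m.
Proof.
move=> S0 SM Sstep.
have hS : has_sup S by split; [exists 0|exists M => m /SM/andP[]].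
have ub (m : R) : S m -> m <= sup S by move=> Sm; apply: (ub_le_sup hS.2).
have ms : 0 <= sup S <= M.
  rewrite (ub _ S0) /=; apply: ge_sup; first by exists 0.
  by move=> m /SM/andP[].
exists (sup S) => //; apply: contrapT => nP.
have [|d d0 Sd] := Sstep _ ms _ nP.
  move=> e e0; have [m' Sm' em'] := sup_adherent e0 hS.
  by exists m' => //; rewrite em' ub.
by have := ub _ Sd; rewrite gerDl leNgt d0.
Qed.

Lemma approx_ge0 (x L : R) : 0 <= L ->
  (forall e : R, 0 < e -> exists2 y, 0 < y & `|x - y| <= L * e) -> 0 <= x.
Proof.
move=> L0 Hx; rewrite leNgt; apply/negP => x0.
have L1 : 0 < L + 1 by rewrite ltr_wpDl.
have [|y y0] := Hx (- x / (L + 1)); first by rewrite divr_gt0 ?oppr_gt0.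
apply/negP; rewrite -ltNge; apply: (@lt_le_trans _ _ (y - x)); last first.
  by rewrite distrC ler_norm.
apply: (@le_lt_trans _ _ (- x)); last by rewrite ltrDr.
by rewrite mulrA ler_pdivrMr//; lra.
Qed.

Section PositiveSolution.
Variables (v0 c0 c1 M : R).
Hypothesis v0_gt0 : 0 < v0.
Local Notation Hm m := (H 1 (v0 - m * c0) (m * c1)).
Local Notation Gm m := (G 1 (v0 - m * c0) (m * c1)).
Hypothesis bounded : forall m : R, 0 <= m ->
  (forall u : R, 0 <= u < 1 -> 0 < Hm m u) -> 0 < Gm m 1 -> m <= M.

(** [(G H)' = G^2 / p + v0 H^2 >= 0] and [G 0 = 0] give [G H >= 0], hence [(H^2)' >= 0] and
    [H^2 >= 1]. So [H] keeps the sign of [H 0 = 1], and [G] increases from 0. *)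
Lemma positive_solution_zero :
  (forall u : R, 0 <= u < 1 -> 0 < Hm 0 u) /\ 0 < Gm 0 1.
Proof.
set h := Hm 0; set g := Gm 0.
have gd (x : R) : 0 <= x < 1 -> is_derive x (1 : R) g (v0 * h x).
  move=> x01; apply: is_derive_eq (frobG_derive graeffe _ _ _ x01) _.
  by congr (_ * _); ring.
have hd (x : R) : 0 < x < 1 -> is_derive x (1 : R) h (g x / p x).
  by move=> x01; apply: is_derive_eq (frobH_derive graeffe Qpos _ _ _ x01) _; rewrite
      mul1r.
have hc (x : R) : 0 <= x < 1 -> {for x, continuous h} by exact: frobH_continuous.
have gc (x : R) : 0 <= x < 1 -> {for x, continuous g} by exact: frobG_continuous.
have sub (u x : R) : 0 <= u < 1 -> 0 < x < u -> 0 < x < 1.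
  by move=> /andP[_ u1] /andP[-> xu]; exact: lt_trans xu u1.
have sub' (u x : R) : 0 <= u < 1 -> 0 <= x <= u -> 0 <= x < 1.
  by move=> /andP[_ u1] /andP[-> xu]; exact: le_lt_trans xu u1.
have GH (u : R) : 0 <= u < 1 -> 0 <= g u * h u.
  move=> u01; have /andP[u0 u1] := u01.
  have -> : 0 = g 0 * h 0 by rewrite /g frobG0 mul0r.
  apply: (@derive_ndecr _ (fun x => g x * h x)
     (fun x => g x * (g x / p x) + v0 * h x * h x)) => //.
  - apply: within_continuous => x /(sub' _ _ u01) x01.
    by apply: continuousM; [exact: gc|exact: hc].
  - move=> x /(sub _ _ u01) x01; apply: isd_mul; last exact: hd.
    by apply: gd; case/andP: x01 => /ltW-> ->.
  - move=> x /(sub _ _ u01) x01; have p0 := ltW (frobp_gt0 Qpos x01).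
    have -> : g x * (g x / p x) + v0 * h x * h x = g x ^+ 2 / p x + v0 * h x ^+ 2 by ring.
    exact: addr_ge0 (divr_ge0 (sqr_ge0 _) p0) (mulr_ge0 (ltW v0_gt0) (sqr_ge0 _)).
have H2 (u : R) : 0 <= u < 1 -> 1 <= h u ^+ 2.
  move=> u01; have /andP[u0 u1] := u01.
  have -> : 1 = h 0 ^+ 2 by rewrite /h frobH0 expr1n.
  apply: (@derive_ndecr _ (fun x => h x ^+ 2) (fun x => 2 * h x * (g x / p x))) => //.
  - apply: within_continuous => x /(sub' _ _ u01) x01.
    exact: (continuousM (hc _ x01) (hc _ x01)).
  - by move=> x /(sub _ _ u01) x01; apply: isd_sqr; exact: hd.
  - move=> x /(sub _ _ u01) x01.
    have -> : 2 * h x * (g x / p x) = 2 * (g x * h x) / p x by ring.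
    apply: divr_ge0; last exact: ltW (frobp_gt0 Qpos x01).
    by apply: mulr_ge0 => //; apply: GH; case/andP: x01 => /ltW-> ->.
have hpos (u : R) : 0 <= u < 1 -> 0 < h u.
  move=> u01; have /andP[u0 u1] := u01.
  rewrite ltNge; apply/negP => hu.
  have hw : {within `[0, u], continuous h}.
    by apply: within_continuous => x /(sub' _ _ u01); exact: hc.
  have h01 : h 0 = 1 by rewrite /h frobH0.
  have hmm : Num.min (h 0) (h u) <= 0 <= Num.max (h 0) (h u).
    by rewrite h01 ge_min hu orbT le_max ler01.
  have [c] := IVT u0 hw hmm.
  rewrite in_itv/= => /(sub' _ _ u01)/H2 + hc0.
  by rewrite hc0 expr0n/= leNgt ltr01.
split => //.
have g2 : 0 < g 2^-1.
  have [|||c] := @MVT _ g (fun x => v0 * h x) 0 2^-1.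
  - by rewrite invr_gt0.
  - by move=> x; rewrite in_itv/= => /andP[x0 x2]; apply: gd; apply/andP; split; lra.
  - by apply: within_continuous => x /andP[x0 x2]; apply: gc; apply/andP; split; lra.
  - rewrite in_itv/= => /andP[c0' c2]; rewrite /g frobG0 -/g !subr0 => ->.
    rewrite mulr_gt0 ?invr_gt0// mulr_gt0// hpos//; apply/andP; split; lra.
apply: lt_le_trans g2 _.
apply: (@derive_ndecr _ g (fun x => v0 * h x)).
- lra.
- have gw : {within `[0, 1], continuous g} by exact: frobG_within.
  apply: continuous_subspaceW gw => x /=; rewrite !in_itv/= => /andP[x0 ->].
  by rewrite andbT; lra.
- by move=> x /andP[x0 x1]; apply: gd; apply/andP; split; lra.
- move=> x /andP[x0 x1]; rewrite mulr_ge0// ltW// hpos//; apply/andP; split; lra.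
Qed.

(** Positivity of [H] passes to a limit parameter: a zero of a nonnegative [H] inside the interval
    is a minimum, so [H' = 0] and [G = 0] there, against [frob_no_common_zero]. Hence continuation
    can stop only because [G 1 = 0], and [bounded] forces it to stop. *)
Lemma positive_flux_zero : exists2 m : R, 0 < m <= M & Gm m 1 = 0.
Proof.
have [Hm0 Gm0] := positive_solution_zero.
have M0 : 0 <= M by exact: bounded Gm0.
have [L L0 lip] : exists2 L : R, 0 <= L & forall m m' : R,
    0 <= m <= M + 1 -> 0 <= m' <= M + 1 ->
    (forall u : R, 0 <= u <= 1 -> `|Gm m u - Gm m' u| <= L * `|m - m'|) /\
    (forall u : R, 0 <= u < 1 -> (1 - u) * `|Hm m u - Hm m' u| <= L * `|m - m'|).
  have [L L0 HL] := family_lipschitz 1 0 v0 (- c0) 0 c1 (M + 1).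
  exists L => // m m' mM m'M; have := HL _ _ mM m'M.
  have e0 (x : R) : 1 + 0 * x = 1 by ring.
  have e1 (x : R) : v0 + - c0 * x = v0 - x * c0 by ring.
  have e2 (x : R) : 0 + c1 * x = x * c1 by ring.
  rewrite !e0 !e1 !e2 => -[lG lH]; split => // u u01.
  apply: le_trans (lG u u01) _; case/andP: u01 => _ u1.
  by rewrite ler_piMr// mulr_ge0.
pose S : set R := [set m | [/\ 0 <= m, forall u : R, 0 <= u < 1 -> 0 < Hm m u & 0 < Gm
    m 1]].
have SM (m : R) : S m -> 0 <= m <= M by case=> m0 Hp Gp; rewrite m0; exact: bounded.
have S0 : S 0 by [].
suff step (m : R) : 0 <= m <= M -> (forall e : R, 0 < e -> exists2 m', S m' & m - e <
    m' <= m) ->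
    Gm m 1 <> 0 -> exists2 d, 0 < d & S (m + d).
  have [m m0M Gm1] := continuation S0 SM step.
  exists m => //; have /andP[m0 ->] := m0M.
  rewrite andbT lt0r m0 andbT; apply/eqP => mE.
  by move: Gm0; rewrite mE in Gm1; rewrite Gm1 ltxx.
move=> mM close nGm.
have /andP[m0 mM'] := mM.
have mM1 : 0 <= m <= M + 1 by rewrite m0 (le_trans mM')// lerDl.
have close' (e : R) : 0 < e -> exists2 m', S m' & `|m - m'| <= e /\ 0 <= m' <= M + 1.
  move=> /close[m' Sm' /andP[m'1 m'2]]; exists m' => //.
  have /andP[m'0 m'M] := SM _ Sm'; split.
    by rewrite ger0_norm ?subr_ge0//; lra.
  by rewrite m'0; lra.
have Hge (u : R) : 0 <= u < 1 -> 0 <= Hm m u.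
  move=> u01; have u1 : 0 < 1 - u by case/andP: u01; lra.
  rewrite -(pmulr_rge0 _ u1); apply: (approx_ge0 L0) => e e0.
  have [m' [_ Hm' _] [mm' m'M]] := close' _ e0.
  exists ((1 - u) * Hm m' u); first by rewrite mulr_gt0// Hm'.
  rewrite -mulrBr normrM (gtr0_norm u1).
  apply: le_trans ((lip _ _ mM1 m'M).2 u u01) _.
  by rewrite ler_wpM2l.
have G1 : 0 < Gm m 1.
  rewrite lt0r; apply/andP; split; first exact/eqP.
  apply: (approx_ge0 L0) => e e0.
  have [m' [_ _ Gm'] [mm' m'M]] := close' _ e0.
  exists (Gm m' 1) => //; have l01 : (0 : R) <= (1 : R) <= (1 : R) by rewrite ler01 lexx.
  apply: le_trans ((lip _ _ mM1 m'M).1 1 l01) _.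
  by rewrite ler_wpM2l.
have Hgt (u : R) : 0 <= u < 1 -> 0 < Hm m u.
  move=> u01; rewrite lt0r Hge// andbT; apply/eqP => Hu.
  have u0 : 0 < u.
    have /andP[u0 _] := u01; rewrite lt0r u0 andbT; apply/eqP => uE.
    by move: Hu; rewrite uE frobH0 => /eqP; rewrite oner_eq0.
  have u01' : 0 < u < 1 by rewrite u0; case/andP: u01.
  have Hd := frobH_derive graeffe Qpos 1 (v0 - m * c0) (m * c1).
  have D0 : is_derive u (1 : R) (Hm m) 0.
    apply: (@derive1_at_min _ _ 0 1); rewrite ?in_itv//=.
      by move=> t; rewrite in_itv/= => /Hd[].
    by move=> t; rewrite in_itv/= Hu => /andP[/ltW t0 t1]; apply: Hge; rewrite t0.
  have := @derive_val _ _ _ _ _ _ _ (Hd u u01').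
  rewrite (@derive_val _ _ _ _ _ _ _ D0) mul1r => /esym/eqP.
  have p0 := lt0r_neq0 (frobp_gt0 Qpos u01').
  rewrite mulf_eq0 invr_eq0 (negbTE p0) orbF => /eqP Gu.
  exact: frob_no_common_zero graeffe Qpos _ _ _ _ u01' Hu Gu.
(* Openness: near [u = 1] positivity of [G] makes [H] increasing; elsewhere [H]
   is bounded below. *)
have [e /andP[e0 e1] Ge] : exists2 e : R, 0 < e < 1 & forall u : R, e <= u <= 1 -> Gm m
    1 / 2 <= Gm m u.
  have G2 : Gm m 1 / 2 < Gm m 1 by lra.
  have Gl : Gm m u @[u --> 1^'-] --> Gm m 1 by exact: frobG_left.
  have [d /= d0 Hd] := cvgr_ge _ Gl _ G2.
  exists (Num.max (1 - d / 2) 2^-1).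
    by rewrite lt_max gt_max; apply/and3P; split; lra.
  move=> u; rewrite ge_max -andbA => /and3P[ud u2 u1].
  have [->|un1] := eqVneq u 1; first by rewrite ltW.
  have {}u1 : u < 1 by rewrite lt_neqAle un1.
  by apply: Hd => //=; rewrite ger0_norm; lra.
have [k k0 Hk] : exists2 k : R, 0 < k & forall u : R, 0 <= u <= e -> k <= Hm m u.
  have sub (u : R) : 0 <= u <= e -> 0 <= u < 1.
    by move=> /andP[-> /le_lt_trans]; apply.
  have Hw : {within `[0, e], continuous Hm m}.
    by apply: within_continuous => x /sub; exact: frobH_continuous.
  have [c cP Hc] := EVT_min (ltW e0) Hw.
  exists (Hm m c); first by apply: Hgt; apply: sub; rewrite in_itv in cP.
  by move=> u ue; apply: Hc; rewrite in_itv.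
(* The three terms keep [m + d] within [[0, M + 1]], where [L] is valid, keep [G] positive on
   [[e, 1]], and keep [H] positive on [[0, e]]. *)
pose d := Num.min 1 (Num.min (Gm m 1 / (4 * (L + 1))) (k * (1 - e) / (2 * (L + 1)))).
have L1 : 0 < L + 1 by rewrite ltr_wpDl.
have e1' : 0 < 1 - e by rewrite subr_gt0.
have d0 : 0 < d.
  by rewrite !lt_min ltr01 !divr_gt0 ?mulr_gt0.
have d1 : d <= 1 by rewrite ge_min lexx.
have dG : L * d < Gm m 1 / 2.
  have : d <= Gm m 1 / (4 * (L + 1)) by rewrite !ge_min lexx ?orbT.
  rewrite ler_pdivlMr ?mulr_gt0//; have := mulr_ge0 L0 (ltW d0); lra.
have dk : L * d < k * (1 - e).
  have : d <= k * (1 - e) / (2 * (L + 1)) by rewrite !ge_min lexx ?orbT.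
  rewrite ler_pdivlMr ?mulr_gt0//; have := mulr_ge0 L0 (ltW d0).
  have := mulr_gt0 k0 e1'; lra.
exists d => //.
have md0 : 0 <= m + d by rewrite addr_ge0// ltW.
have mdM : 0 <= m + d <= M + 1 by rewrite md0 lerD.
have [lG lH] := lip _ _ mM1 mdM.
have mdE : `|m - (m + d)| = d by rewrite opprD addNKr normrN gtr0_norm.
rewrite mdE in lG lH.
have Gd (u : R) : e <= u <= 1 -> 0 < Gm (m + d) u.
  move=> eu; have /andP[eu0 u1] := eu.
  have u01 : 0 <= u <= 1 by rewrite u1 (le_trans (ltW e0)).
  have := lG u u01; have := Ge u eu; rewrite ler_norml => ? /andP[_ ?].
  have : L * d * u <= L * d by rewrite ler_piMr// mulr_ge0// ltW.
  lra.
have He (u : R) : 0 <= u <= e -> 0 < Hm (m + d) u.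
  move=> ue; have /andP[u0 ue1] := ue.
  have u01 : 0 <= u < 1 by rewrite u0 (le_lt_trans ue1).
  have := lH u u01; have := Hk u ue => kH lHu.
  have lHe : (1 - e) * `|Hm m u - Hm (m + d) u| <= L * d.
    by apply: le_trans lHu; rewrite ler_wpM2r// lerD2l lerN2.
  have : (1 - e) * `|Hm m u - Hm (m + d) u| < (1 - e) * k.
    by apply: le_lt_trans lHe _; rewrite [ltRHS]mulrC.
  rewrite ltr_pM2l// => /(le_lt_trans (ler_norm _)); lra.
split => //; last by apply: Gd; rewrite lexx ltW.
move=> u /andP[u0 u1]; have [ue|eu] := leP u e; first by apply: He; rewrite u0.
apply: (@lt_le_trans _ _ (Hm (m + d) e)); first by apply: He; rewrite lexx ltW.
apply: (@derive_ndecr _ (Hm (m + d))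
  (fun x => 1 * Gm (m + d) x / p x)); first exact: ltW.
- apply: within_continuous => x /andP[ex xu]; apply: frobH_continuous => //.
  by rewrite (le_trans (ltW e0) ex) (le_lt_trans xu u1).
- move=> x /andP[ex xu]; apply: frobH_derive => //.
  by rewrite (lt_trans e0 ex) (lt_trans xu u1).
- move=> x /andP[ex xu]; rewrite mul1r divr_ge0//.
    by apply/ltW/Gd; rewrite (ltW ex) ltW// (lt_trans xu u1).
  by apply/ltW/(frobp_gt0 Qpos); rewrite (lt_trans e0 ex) (lt_trans xu u1).
Qed.

End PositiveSolution.
Section NodalSolution.
Variables (c0 c1 M : R).
Hypothesis W_gt0 : forall u : R, 0 <= u <= 1 -> 0 < c0 - c1 * u.
Local Notation Hm m := (H (- m) c0 (- c1)).
Local Notation Gm m := (G (- m) c0 (- c1)).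
Hypothesis bounded : forall m : R, 0 <= m ->
  (forall u : R, 0 < u <= 1 -> 0 < Gm m u) -> m <= M.

(** For [m = 0] the first equation makes [H] constant, so [G] is a primitive of the positive
    weight. *)
Lemma nodal_solution_zero (u : R) : 0 < u <= 1 -> 0 < Gm 0 u.
Proof.
have H1 (x : R) : 0 <= x < 1 -> Hm 0 x = 1.
  move=> /andP[x0 x1]; rewrite -(frobH0 al be (- 0) c0 (- c1)).
  apply: (@derive0_constant _ (Hm 0)) => //.
    by apply: within_continuous => y /andP[y0 yx]; apply: frobH_continuous => //;
       rewrite y0 (le_lt_trans yx).
  move=> y /andP[y0 yx]; have y01 : 0 < y < 1 by rewrite y0 (lt_trans yx).
  by apply: is_derive_eq (frobH_derive graeffe Qpos _ _ _ y01) _; rewrite oppr0 !mul0r.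
have gd (x : R) : 0 <= x < 1 -> is_derive x (1 : R) (Gm 0) (c0 - c1 * x).
  move=> x01; apply: is_derive_eq (frobG_derive graeffe _ _ _ x01) _.
  by rewrite H1// mulr1 mulNr.
have gw : {within `[0, 1], continuous Gm 0} by exact: frobG_within.
case/andP=> u0 u1.
have gu : {within `[0, u], continuous Gm 0}.
  apply: continuous_subspaceW gw => x /=; rewrite !in_itv/= => /andP[-> xu].
  exact: le_trans xu u1.
have gd' (x : R) : x \in `]0, u[ -> is_derive x (1 : R) (Gm 0) (c0 - c1 * x).
  by rewrite in_itv/= => /andP[x0 xu]; apply: gd; rewrite ltW// (lt_le_trans xu).
have [c] := MVT u0 gd' gu.
rewrite in_itv/= frobG0 !subr0 => /andP[x0 xu] ->.
by rewrite mulr_gt0// W_gt0// ltW//= ltW// (lt_le_trans xu).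
Qed.

(** With [sg = - m], the true flux [p H'] is [- m G]. Dividing it by [- m] discards the constant
    eigenfunction: at [m = 0] the true flux is zero but [G 1] is positive. In the limit, an interior
    zero of [G] would be a minimum, so [G' = 0] and thus [H = 0] there, which [frob_no_common_zero]
    excludes. *)
Lemma nodal_flux_zero : exists2 m : R, 0 < m <= M & Gm m 1 = 0.
Proof.
have G0 := nodal_solution_zero.
have M0 : 0 <= M by exact: bounded G0.
have [L L0 lip] : exists2 L : R, 0 <= L & forall m m' : R,
    0 <= m <= M + 1 -> 0 <= m' <= M + 1 ->
    forall u : R, 0 <= u <= 1 -> `|Gm m u - Gm m' u| <= L * `|m - m'| * u.
  have [L L0 HL] := family_lipschitz 0 (-1) c0 0 (- c1) 0 (M + 1).
  exists L => // m m' mM m'M; have := HL _ _ mM m'M.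
  have e0 (x : R) : 0 + -1 * x = - x by ring.
  have e1 (x : R) : c0 + 0 * x = c0 by ring.
  have e2 (x : R) : - c1 + 0 * x = - c1 by ring.
  by rewrite !e0 !e1 !e2 => -[lG _].
pose S : set R := [set m | 0 <= m /\ forall u : R, 0 < u <= 1 -> 0 < Gm m u].
have SM (m : R) : S m -> 0 <= m <= M by case=> m0 Gp; rewrite m0; exact: bounded.
have S0 : S 0 by [].
have l01 : (0 : R) < (1 : R) <= (1 : R) by rewrite ltr01 lexx.
suff step (m : R) : 0 <= m <= M -> (forall e : R, 0 < e -> exists2 m', S m' & m - e <
    m' <= m) ->
    Gm m 1 <> 0 -> exists2 d, 0 < d & S (m + d).
  have [m m0M Gm1] := continuation S0 SM step.
  exists m => //; have /andP[m0 ->] := m0M.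
  rewrite andbT lt0r m0 andbT; apply/eqP => mE.
  by move: (G0 _ l01); rewrite mE in Gm1; rewrite Gm1 ltxx.
move=> mM close nGm.
have /andP[m0 mM'] := mM.
have mM1 : 0 <= m <= M + 1 by rewrite m0 (le_trans mM')// lerDl.
have Gge (u : R) : 0 < u <= 1 -> 0 <= Gm m u.
  move=> u01; have u01' : 0 <= u <= 1 by case/andP: u01 => /ltW->.
  apply: (approx_ge0 L0) => e /close[m' Sm' /andP[m'1 m'2]].
  have /andP[m'0 m'M] := SM _ Sm'.
  exists (Gm m' u); first exact: Sm'.2.
  have m'M1 : 0 <= m' <= M + 1 by rewrite m'0; lra.
  apply: le_trans (lip _ _ mM1 m'M1 u u01') _.
  rewrite ger0_norm ?subr_ge0//.
  apply: (@le_trans _ _ (L * (m - m'))).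
    by rewrite ler_piMr ?mulr_ge0 ?subr_ge0//; case/andP: u01'.
  by rewrite ler_wpM2l//; lra.
have Ggt (u : R) : 0 < u <= 1 -> 0 < Gm m u.
  move=> u01; rewrite lt0r Gge// andbT; apply/eqP => Gu.
  have u1 : u < 1.
    have /andP[_ u1] := u01; rewrite lt_neqAle u1 andbT; apply/eqP => uE.
    by apply: nGm; rewrite -uE.
  have u0 : 0 < u by case/andP: u01.
  have u01' : 0 < u < 1 by rewrite u0.
  have Gd (x : R) : 0 < x < 1 -> is_derive x (1 : R) (Gm m) ((c0 + - c1 * x) * Hm m x).
    by move=> /andP[/ltW x0 x1]; apply: frobG_derive => //; rewrite x0.
  have D0 : is_derive u (1 : R) (Gm m) 0.
    apply: (@derive1_at_min _ _ 0 1); rewrite ?in_itv//=.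
      by move=> t; rewrite in_itv/= => /Gd[].
    by move=> t; rewrite in_itv/= Gu => /andP[t0 /ltW t1]; apply: Gge; rewrite t0.
  have := @derive_val _ _ _ _ _ _ _ (Gd u u01').
  rewrite (@derive_val _ _ _ _ _ _ _ D0) mulNr => /esym/eqP.
  have W0 : c0 - c1 * u != 0 by rewrite gt_eqF// W_gt0// !ltW.
  rewrite mulf_eq0 (negbTE W0) => /eqP Hu.
  exact: frob_no_common_zero graeffe Qpos _ _ _ _ u01' Hu Gu.
(* Openness near [u = 0], where [G] itself tends to 0: the minimum of [G / u] is compared with the
   Lipschitz estimate, which carries the same factor [u]. *)
have [G1 [G1c G10 G1E]] := frobG_factor graeffe (- m) c0 (- c1).
have [c cP Hc] := EVT_min (@ler01 R) G1c.
have k0 : 0 < G1 c.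
  rewrite in_itv/= in cP; have /andP[c0' c1'] := cP.
  have [cE|cn] := eqVneq c 0.
    by have := W_gt0 (u := 0); rewrite cE G10 lexx ler01 mulr0 subr0; apply.
  have {}c0' : 0 < c by rewrite lt0r cn.
  by have := Ggt c; rewrite G1E// c0' c1' pmulr_rgt0//; apply.
have L1 : 0 < L + 1 by rewrite ltr_wpDl.
pose d := Num.min 1 (G1 c / (2 * (L + 1))).
have d0 : 0 < d by rewrite lt_min ltr01 divr_gt0// mulr_gt0.
have d1 : d <= 1 by rewrite ge_min lexx.
have dk : L * d < G1 c.
  have : d <= G1 c / (2 * (L + 1)) by rewrite ge_min lexx orbT.
  rewrite ler_pdivlMr ?mulr_gt0//; have := mulr_ge0 L0 (ltW d0); lra.
exists d => //.
have md0 : 0 <= m + d by rewrite addr_ge0// ltW.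
have mdM : 0 <= m + d <= M + 1 by rewrite md0 lerD.
split=> // u /andP[u0 u1].
have u01 : 0 <= u <= 1 by rewrite ltW.
have := lip _ _ mM1 mdM u u01.
have -> : `|m - (m + d)| = d by rewrite opprD addNKr normrN gtr0_norm.
rewrite G1E// => /(le_trans (ler_norm _)).
have := Hc u; rewrite in_itv/= u01 => /(_ isT) kG.
have : u * G1 c <= u * G1 u by rewrite ler_wpM2l// ltW.
have : L * d * u < G1 c * u by rewrite ltr_pM2r.
lra.
Qed.

End NodalSolution.
End Shooting.

(** * Regularity at [u = 1] when the flux vanishes there *)

Section Extension.
Variables (R : realType) (al be sg w0 w1 : R).
Hypothesis graeffe : `|al ^+ 2 - 2 * be| + be ^+ 2 < 1.
Hypothesis Qpos : forall u : R, 0 <= u <= 1 -> 0 < 1 - al * u + be * u ^+ 2.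
Local Notation H := (frobH al be sg w0 w1).
Local Notation G := (frobG al be sg w0 w1).
Local Notation p := (frobp al be).

(* The Wronskian with the Frobenius solution at the other end point [u = 1]
   is constant and tends to [0] there. *)
Lemma frobH_extends : G 1 = 0 -> exists d : nat -> R, exists2 r : R, 0 < r <= 1 &
  psconv r d /\ forall u, 1 - r < u < 1 -> H u = psum d (1 - u).
Proof.
move=> G1.
pose q := 1 - al + be.
have q0 : 0 < q.
  have := Qpos (u := 1); rewrite ler01 lexx mulr1 expr1n mulr1; exact.
have q1 : q != 0 by rewrite gt_eqF.
(* In [v = 1 - u] the quadratic factor becomes [q (1 - al' v + be' v^2)], and the weight becomes
   [(w0 + w1) - w1 v]. *)
pose al' := (2 * be - al) / q; pose be' := be / q.
pose h' := frobh al' be' (sg / q) (w0 + w1) (- w1).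
pose g' := frobg al' be' (sg / q) (w0 + w1) (- w1).
(* The reflected quadratic may have a root well inside the unit disc, so the Graeffe estimate is
   replaced by the crude one, at the cost of a small radius. *)
have [rho rho1 Hrho] := frob_geometric al' be' (sg / q) (w0 + w1) (- w1).
have rho0 : 0 < rho by exact: lt_le_trans rho1.
pose r := rho^-1.
have r0 : 0 < r by rewrite invr_gt0.
have r1 : r <= 1 by rewrite invf_le1.
have h'r : psconv r h'.
  apply: (@psconv_geometric _ _ 1 rho) => [||n]; first exact: ltW.
    by rewrite mulVf// gt_eqF.
  by rewrite mul1r; exact: (Hrho n).1.
have S'r : psconv r (frobS al' be' (sg / q) (w0 + w1) (- w1)).
  apply: (@psconv_geometric _ _ 1 rho) => [||n]; first exact: ltW.
    by rewrite mulVf// gt_eqF.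
  by rewrite mul1r; exact: (Hrho n).2.
(* The reflection reverses the derivative, hence the sign in the flux [k]. *)
pose y u := psum h' (1 - u); pose k u := - psum g' (1 - u).
have d1u (u : R) : is_derive u (1 : R) (fun u => 1 - u) (0 - 1) := isd_sub (isd_cst u 1
    1) (isd_id u).
have kd (u : R) : 1 - r < u <= 1 -> is_derive u (1 : R) k ((w0 + w1 * u) * y u).
  move=> /andP[u1r u1].
  have ur : `|1 - u| < r by rewrite ger0_norm; lra.
  apply: is_derive_eq (isd_opp (isd_comp (f := fun z : R => 1 - z) (is_derive_frobG h'r
      S'r ur) (d1u u))) _.
  by rewrite /y /h'; ring.
have yc (u : R) : 1 - r < u <= 1 -> {for u, continuous y}.
  move=> /andP[u1r u1].
  have ur : `|1 - u| < r by rewrite ger0_norm; lra.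
  exact: is_derive1_continuous (isd_comp (f := fun z : R => 1 - z) (is_derive_psum h'r
      ur) (d1u u)).
have yd (u : R) : 1 - r < u < 1 -> is_derive u (1 : R) y (sg * k u / p u).
  move=> /andP[u1r u1].
  have ur : `|1 - u| < r by rewrite ger0_norm; lra.
  apply: is_derive_eq (isd_comp (f := fun z : R => 1 - z) (is_derive_psum h'r ur) (d1u
      u)) _.
  have u01 : 0 < u < 1 by lra.
  have p0 := lt0r_neq0 (frobp_gt0 Qpos u01).
  have ode := frobH_ode h'r S'r ur.
  apply: (mulIf p0); rewrite divfK// sub0r mulrN1 mulNr /k mulrN; congr (- _).
  have -> : p u = q * ((1 - u) * (1 - (1 - u)) * (1 - al' * (1 - u) + be' * (1 - u) ^+
      2)).
    by rewrite /frobp /al' /be' /q; field; exact: q1.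
  set X := (1 - u) * _ * _ in ode *; set Y := psum _ _ in ode *.
  have -> : Y * (q * X) = q * (X * Y) by ring.
  by rewrite ode mulrA [q * _]mulrC divfK.
pose W u := G u * y u - k u * H u.
have Wd (u : R) : 1 - r < u < 1 -> is_derive u (1 : R) W 0.
  move=> u1r.
  have u01 : 0 < u < 1 by lra.
  have u01' : 0 <= u < 1 by lra.
  have u1r' : 1 - r < u <= 1 by lra.
  have p0 := lt0r_neq0 (frobp_gt0 Qpos u01).
  have Gd := frobG_derive graeffe sg w0 w1 u01'.
  have Hd := frobH_derive graeffe Qpos sg w0 w1 u01.
  apply: is_derive_eq (isd_sub (isd_mul Gd (yd u u1r)) (isd_mul (kd u u1r') Hd)) _.
  by field.
have c1u : 1 - u @[u --> 1^'-] --> (0 : R).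
  rewrite -[X in _ --> X](subrr (1 : R)); apply: cvg_at_left_filter.
  exact: is_derive1_continuous (d1u 1).
(* The term [G y] tends to [G 1 = 0]. In [k H], the flux [k] contains a factor [1 - u], which
   defeats the possible logarithm of [H]. *)
have Wlim : W u @[u --> 1^'-] --> (0 : R).
  pose g1 n := g' n.+1.
  have g1r : psconv r g1.
    apply: (@psconv_geometric _ _ (2 * rho) rho) => [||n]; first exact: ltW.
      by rewrite mulVf// gt_eqF.
    rewrite /g1 /g' /frobg /= -mulrA -exprS.
    apply: le_trans (ler_normB _ _) _.
    have := (Hrho n.+1).2; have := (Hrho n).2.
    have : rho ^+ n <= rho ^+ n.+1 by rewrite ler_weXn2l.
    lra.
  have g'E (v : R) : `|v| < r -> psum g' v = v * psum g1 v.
    move=> vr; rewrite -psum_cshift; last exact: g1r.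
    by congr psum; apply/funext => -[|n] //; exact: frobg0.
  have -> : (0 : R) = G 1 * y 1 - (- psum g1 0) * 0 by rewrite G1; ring.
  apply: cvgB.
    apply: cvgM; first exact: frobG_left.
    by apply: cvg_at_left_filter; apply: yc; lra.
  apply: (@cvg_trans _ ((- psum g1 (1 - u)) * ((1 - u) * H u) @[u --> 1^'-])).
    apply: near_eq_cvg; near=> u.
    have ur : 1 - r < u by near: u; apply: nbhs_left_gt; rewrite gtrBl.
    have u1 : u < 1 by near: u; exact: nbhs_left_lt.
    have ur' : `|1 - u| < r by rewrite ger0_norm; lra.
    by rewrite /k g'E//; ring.
  apply: cvgM; last exact: frobH_o.
  apply: cvgN; apply: (cvg_comp _ _ c1u).
  have z : `|0 : R| < r by rewrite normr0.
  exact: is_derive1_continuous (is_derive_psum g1r z).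
have W0 (u : R) : 1 - r < u < 1 -> W u = 0.
  move=> /andP[ur u1].
  have Wu : W x @[x --> 1^'-] --> W u.
    apply: cvg_near_cst; near=> x.
    have ux : u <= x by near: x; exact: nbhs_left_ge.
    have x1 : x < 1 by near: x; exact: nbhs_left_lt.
    apply: (@derive0_constant _ W) => //.
      apply: within_continuous => z /andP[uz zx].
      apply: (@is_derive1_continuous _ _ _ 0); apply: Wd; lra.
    by move=> z /andP[uz zx]; apply: Wd; lra.
  have E : W u = 0 := cvg_unique (@Rhausdorff R) Wu Wlim.
  exact: E.
have y1 : y 1 = 1 by rewrite /y subrr psum0.
have [r' /andP[r'0 r'r] yne] : exists2 r' : R, 0 < r' <= r &
    forall u : R, 1 - r' < u <= 1 -> y u != 0.
  have y1c : {for 1, continuous y} by apply: yc; lra.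
  have half : 2^-1 < y 1 by rewrite y1; lra.
  have [e /= e0 He] := cvgr_gt _ y1c _ half.
  exists (Num.min e r); first by rewrite lt_min e0 r0 ge_min lexx orbT.
  move=> u /andP[ur u1].
  have [er rr] : Num.min e r <= e /\ Num.min e r <= r by rewrite !ge_min !lexx orbT.
  have : 2^-1 < y u by apply: He; rewrite /= ger0_norm; lra.
  by move=> yu; rewrite gt_eqF//; lra.
pose u0 := 1 - r' / 2.
pose c := H u0 / y u0.
(* The zero summand gives [c * h'] the shape handled by [psum_lin]. *)
exists (fun n => c * h' n + 0 * h' n); exists r'; first by rewrite r'0 (le_trans r'r).
have h'r' : psconv r' h' by move=> x xr; apply: h'r; exact: lt_le_trans r'r.
split=> [x xr|u /andP[ur' u1]]; first by apply: is_cvg_pseries_lin; exact: h'r'.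
have ur : `|1 - u| < r' by rewrite ger0_norm; lra.
rewrite psum_lin; [|exact: h'r'..].
rewrite mul0r addr0 -/(y u).
(* [(H / y)' = sg W / (p y^2) = 0]. *)
have rd (x : R) : 1 - r' < x < 1 -> is_derive x (1 : R) (fun x => H x / y x) 0.
  move=> xr; have xr' : 1 - r < x < 1 by lra.
  have x01 : 0 < x < 1 by lra.
  have y0 : y x != 0 by apply: yne; lra.
  have p0 := lt0r_neq0 (frobp_gt0 Qpos x01).
  have Hd := frobH_derive graeffe Qpos sg w0 w1 x01.
  apply: is_derive_eq (isd_div y0 Hd (yd x xr')) _.
  have := W0 x xr'; rewrite /W => WE.
  have -> : sg * G x / p x * y x - H x * (sg * k x / p x) = sg / p x * (G x * y x - k x
      * H x).
    by field.
  by rewrite WE mulr0 mul0r.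
have rcst (x z : R) : 1 - r' < x -> x <= z -> z < 1 -> H x / y x = H z / y z.
  move=> xr xz z1; apply/esym.
  apply: (@derive0_constant _ (fun x => H x / y x)) => //.
    apply: within_continuous => t /andP[xt tz].
    apply: (@is_derive1_continuous _ _ _ 0); apply: rd; lra.
  by move=> t /andP[xt tz]; apply: rd; lra.
have yu : y u != 0 by apply: yne; lra.
have -> : c = H u / y u.
  rewrite /c; have [uu|uu] := leP u u0.
    by apply/esym; apply: rcst => //; rewrite /u0; lra.
  by apply: rcst => //; [rewrite /u0; lra|exact: ltW].
by rewrite divfK.
Unshelve. all: by end_near.
Qed.

End Extension.

(** * Picone identities and the two bounds *)

Section Picone.
Variables (R : realType) (al be b : R).
Hypothesis graeffe : `|al ^+ 2 - 2 * be| + be ^+ 2 < 1.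
Hypothesis Qpos : forall u : R, 0 <= u <= 1 -> 0 < 1 - al * u + be * u ^+ 2.
Local Notation H := (frobH al be).
Local Notation G := (frobG al be).
Local Notation p := (frobp al be).

(* Picone's identity with the test function [s = 3 - b u]. *)
Lemma picone_positive (m : R) :
  let H := frobH al be 1 (2 * b / 3 - m * b) (m * (b ^+ 2 / 3)) in
  let G := frobG al be 1 (2 * b / 3 - m * b) (m * (b ^+ 2 / 3)) in
  (forall u : R, 0 <= u < 1 -> 0 < H u) -> 0 < G 1 ->
  m * (b / 3 * (27 - 27 * b / 2 + 3 * b ^+ 2 - b ^+ 3 / 4)) <=
  b ^+ 2 * (1 / 6 - al / 12 + be / 20) + 2 * b / 3 * (9 - 3 * b + b ^+ 2 / 3).
Proof.
move=> h g h0 g1.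
(* [E] is the primitive of [p s'^2 + w s^2]; the inequality to prove is [0 <= E 1]. *)
pose E (u : R) := b ^+ 2 * (u ^+ 2 / 2 - (1 + al) * u ^+ 3 / 3 + (al + be) * u ^+ 4 / 4
    - be * u ^+ 5 / 5)
  + 2 * b / 3 * (9 * u - 3 * b * u ^+ 2 + b ^+ 2 * u ^+ 3 / 3)
  - m * (b / 3) * (27 * u - 27 * b * u ^+ 2 / 2 + 3 * b ^+ 2 * u ^+ 3 - b ^+ 3 * u ^+ 4
      / 4).
pose s (u : R) := 3 - b * u.
pose w (u : R) := 2 * b / 3 - m * b + m * (b ^+ 2 / 3) * u.
have Ed (u : R) : is_derive u (1 : R) E (b ^+ 2 * p u + s u ^+ 2 * w u).
  by apply: is_derive_eq; rewrite /frobp /s /w /GRing.scale /=; field.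
have sd (u : R) : is_derive u (1 : R) s (- b).
  by apply: is_derive_eq (isd_sub (isd_cst u 1 3) (isd_scale b (isd_id u))) _; ring.
have Gd (u : R) : 0 <= u < 1 -> is_derive u (1 : R) g (w u * h u) by exact: frobG_derive.
have Hd (u : R) : 0 < u < 1 -> is_derive u (1 : R) h (1 * g u / p u) by exact:
    frobH_derive.
have Hc (u : R) : 0 <= u < 1 -> {for u, continuous h} by exact: frobH_continuous.
have sub (x u : R) : 0 <= x < 1 -> 0 <= u <= x -> 0 <= u < 1.
  by move=> /andP[_ x1] /andP[-> ux]; exact: le_lt_trans x1.
(* The Riccati variable [G / H] turns the derivative of [T] into minus a square divided by [p]. *)
pose T (u : R) := s u ^+ 2 * (g u / h u) - E u.
have Tle (x : R) : 0 <= x < 1 -> T x <= 0.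
  move=> x01; have /andP[x0 x1] := x01.
  have T0 : T 0 = 0 by rewrite /T /g frobG0 /E; ring.
  suff : T x <= T 0 by rewrite T0.
  pose dT (u : R) := - ((s u * (g u / h u) + b * p u) ^+ 2 / p u).
  apply: (@derive_nincr _ T dT 0 x x0).
  - apply: within_continuous => u /(sub _ _ x01) u01.
    have h0' := lt0r_neq0 (h0 _ u01).
    apply: continuousB; last exact: is_derive1_continuous (Ed u).
    apply: continuousM; first exact: is_derive1_continuous (isd_sqr (sd u)).
    apply: continuousM; first exact: is_derive1_continuous (Gd u u01).
    by apply: continuousV => //; exact: Hc.
  - move=> u /andP[u0 ux]; have u1 : u < 1 by exact: lt_trans x1.
    have u01 : 0 < u < 1 by rewrite u0.
    have u01' : 0 <= u < 1 by rewrite ltW.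
    have h0' := lt0r_neq0 (h0 _ u01'); have p0 := lt0r_neq0 (frobp_gt0 Qpos u01).
    apply: is_derive_eq (isd_sub (isd_mul (isd_sqr (sd u)) (isd_div h0' (Gd u u01') (Hd
        u u01))) (Ed u)) _.
    by rewrite /dT /w /s; field; rewrite h0' p0.
  - move=> u /andP[u0 ux]; have u01 : 0 < u < 1 by rewrite u0 (lt_trans ux).
    by rewrite oppr_le0 divr_ge0 ?sqr_ge0// ltW// frobp_gt0.
have E1 : 0 <= E 1.
  have EL : E u @[u --> 1^'-] --> E 1.
    by apply: cvg_at_left_filter; exact: is_derive1_continuous (Ed 1).
  have GL : g u @[u --> 1^'-] --> g 1 by exact: frobG_left.
  rewrite -(cvg_lim _ EL)//; apply: limr_ge; first exact: cvgP EL.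
  near=> x.
  have x01 : 0 <= x < 1.
    by apply/andP; split; near: x; [exact: nbhs_left_ge|exact: nbhs_left_lt].
  have gx : 0 < g x by near: x; exact: cvgr_gt GL _ g1.
  have := Tle x x01; rewrite /T subr_le0; apply: le_trans.
  by rewrite mulr_ge0 ?sqr_ge0// divr_ge0// ltW// h0.
move: E1; rewrite /E !expr1n !mulr1; lra.
Unshelve. all: by end_near. Qed.

(* Picone's identity for the flux [G], with [ps] the flux of the test function
   [u - e]. *)
Lemma picone_nodal (m e : R) : 0 < m -> 0 < b -> b < 3 -> 3 * (6 - b) * e = 9 - 2 * b ->
  let H := frobH al be (- m) b (- (b ^+ 2 / 3)) in
  let G := frobG al be (- m) b (- (b ^+ 2 / 3)) in
  (forall u : R, 0 < u <= 1 -> 0 < G u) ->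
  - m * (b * (1 / 3 - e + e ^+ 2) - b ^+ 2 / 3 * (1 / 4 - 2 * e / 3 + e ^+ 2 / 2)
    + 2 * b * (- e / 2 + (b / 9 + e) / 3 - b / 36)) <=
  1 / 6 - al / 12 + be / 20.
Proof.
move=> m0 b0 b3 eE h g g0.
(* Completing the square with [(m ps + p)^2 / p] trades the non-polynomial [ps^2 / p] for the
   polynomial terms [2 m ps + p]. As [ps] vanishes at both ends, the integral of [2 ps] is -2 times
   that of [W (u - e)^2], so [E 1] is the integral of [p] minus [m] times that of [W (u - e)^2]. *)
pose E (u : R) := m * (b * (u ^+ 3 / 3 - e * u ^+ 2 + e ^+ 2 * u)
    - b ^+ 2 / 3 * (u ^+ 4 / 4 - 2 * e * u ^+ 3 / 3 + e ^+ 2 * u ^+ 2 / 2)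
    + 2 * b * (- e * u ^+ 2 / 2 + (b / 9 + e) * u ^+ 3 / 3 - b * u ^+ 4 / 36))
  + (u ^+ 2 / 2 - (1 + al) * u ^+ 3 / 3 + (al + be) * u ^+ 4 / 4 - be * u ^+ 5 / 5).
pose W (u : R) := b + - (b ^+ 2 / 3) * u.
(* The hypothesis on [e] makes it the [W]-weighted mean of [u]; hence the primitive of [W (u - e)]
   vanishing at 0 also vanishes at 1, and factors in this way. *)
pose ps (u : R) := b * (u * (1 - u)) * (b * u / 9 - e).
have Ed (u : R) : is_derive u (1 : R) E (m * (W u * (u - e) ^+ 2 + 2 * ps u) + p u).
  by apply: is_derive_eq; rewrite /frobp /ps /W /GRing.scale /=; field.
have psd (u : R) : is_derive u (1 : R) ps (W u * (u - e)).
  apply: is_derive_eq; apply/eqP; rewrite -subr_eq0; apply/eqP.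
  transitivity (b * u / 9 * (3 * (6 - b) * e - (9 - 2 * b))); last by rewrite eE subrr
      mulr0.
  by rewrite /W /GRing.scale /=; field.
have Gd (u : R) : 0 <= u < 1 -> is_derive u (1 : R) g (W u * h u) by exact: frobG_derive.
have Hd (u : R) : 0 < u < 1 -> is_derive u (1 : R) h (- m * g u / p u) by exact:
    frobH_derive.
have Hc (u : R) : 0 <= u < 1 -> {for u, continuous h} by exact: frobH_continuous.
pose T (u : R) := m * (ps u ^+ 2 * (h u / g u)) - E u.
have Tmono (x z : R) : 0 < x -> x <= z -> z < 1 -> T z <= T x.
  move=> x0 xz z1.
  have sub (u : R) : x <= u <= z -> 0 < u < 1.
    by move=> /andP[xu uz]; rewrite (lt_le_trans x0 xu) (le_lt_trans uz z1).
  pose dT (u : R) := - (m * (W u * ((u - e) - ps u * (h u / g u)) ^+ 2) + (m * ps u + p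
      u) ^+ 2 / p u).
  have Td (u : R) : x <= u <= z -> is_derive u (1 : R) T (dT u).
    move=> /sub u01; have u01' : 0 <= u < 1 by case/andP: u01 => /ltW->.
    have p0 := lt0r_neq0 (frobp_gt0 Qpos u01).
    have gu0 : g u != 0 by rewrite lt0r_neq0// g0//; case/andP: u01 => -> /ltW.
    apply: is_derive_eq
      (isd_sub (isd_scale m (isd_mul (isd_sqr (psd u)) (isd_div gu0 (Hd u u01) (Gd u
          u01')))) (Ed u)) _.
    by rewrite /dT /T; field; rewrite gu0 p0.
  apply: (@derive_nincr _ T dT x z xz).
  - by apply: within_continuous => u /Td; exact: is_derive1_continuous.
  - by move=> u /andP[/ltW xu /ltW uz]; apply: Td; rewrite xu.
  - move=> u /andP[/ltW xu /ltW uz].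
    have u01 : 0 < u < 1 by apply: sub; rewrite xu.
    have p0 := ltW (frobp_gt0 Qpos u01).
    have W0 : 0 <= W u.
      have -> : W u = b * (3 - b * u) / 3 by rewrite /W; field.
      rewrite divr_ge0// mulr_ge0 ?ltW// subr_gt0.
      by apply: le_lt_trans b3; rewrite ler_piMr ?ltW//; case/andP: u01.
    rewrite /dT oppr_le0; apply: addr_ge0; last exact: divr_ge0 (sqr_ge0 _) p0.
    exact: mulr_ge0 (ltW m0) (mulr_ge0 W0 (sqr_ge0 _)).
have EL (u : R) : {for u, continuous E} by exact: is_derive1_continuous (Ed u).
have Tright : T u @[u --> 1^'-] --> - E 1.
  have g1 : g 1 != 0 by rewrite lt0r_neq0// g0// ltr01 lexx.
  pose q (u : R) := m * ((1 - u) * (b * u * (b * u / 9 - e)) ^+ 2).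
  have qc : {for 1, continuous q} by apply: is_derive1_continuous.
  have -> : - E 1 = q 1 * 0 / g 1 - E 1 by ring.
  apply: (@cvg_trans _ (q u * ((1 - u) * h u) / g u - E u @[u --> 1^'-])).
    by apply: near_eq_cvg; near=> u; rewrite /T /q /ps; ring.
  apply: cvgB; last exact: cvg_at_left_filter (EL 1).
  apply: cvgM; first by apply: cvgM; [exact: cvg_at_left_filter qc|exact: frobH_o].
  by apply: cvgV => //; exact: frobG_left.
(* [G] vanishes to first order at 0 because [G1 0 = b] is nonzero, while [ps^2] vanishes to second
   order. *)
have Tleft : T u @[u --> 0^'+] --> (0 : R).
  have [G1 [G1c G10 G1E]] := frobG_factor graeffe (- m) b (- (b ^+ 2 / 3)).
  have /(continuous_within_itvP _ ltr01)[_ G1r _] := G1c.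
  have G1n : G1 0 != 0 by rewrite G10 gt_eqF.
  pose q (u : R) := m * u * (b * (1 - u) * (b * u / 9 - e)) ^+ 2.
  have qc : {for 0, continuous q} by apply: is_derive1_continuous.
  have q0 : q 0 = 0 by rewrite /q mulr0 mul0r.
  have e0 : E 0 = 0 by rewrite /E; ring.
  have L : q 0 * h 0 / G1 0 - E 0 = 0 by rewrite q0 e0 !mul0r subr0.
  rewrite -[X in _ --> X]L.
  apply: (@cvg_trans _ (q u * h u / G1 u - E u @[u --> 0^'+])).
    apply: near_eq_cvg; near=> u.
    have u0 : 0 < u by near: u; exact: nbhs_right_gt.
    have u1 : u <= 1 by near: u; exact: nbhs_right_le.
    have gE : g u = u * G1 u by apply: G1E; rewrite ltW.
    have g1 : G1 u != 0.
      by apply/eqP => z; have := g0 u; rewrite u0 u1 gE z mulr0 ltxx => /(_ isT).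
    by rewrite /T /q /ps gE; field; rewrite g1 gt_eqF.
  apply: cvgB; last exact: cvg_at_right_filter (EL 0).
  apply: cvgM; last exact: cvgV.
  apply: cvgM; first exact: cvg_at_right_filter qc.
  by apply: cvg_at_right_filter; apply: Hc; rewrite lexx ltr01.
have T1 (x : R) : 0 < x < 1 -> - E 1 <= T x.
  move=> /andP[x0 x1]; rewrite -(cvg_lim _ Tright)//.
  apply: limr_le; first exact: cvgP Tright.
  near=> z.
  have xz : x <= z by near: z; exact: nbhs_left_ge.
  have z1 : z < 1 by near: z; exact: nbhs_left_lt.
  exact: Tmono.
have E1 : 0 <= E 1.
  rewrite -oppr_le0 -(cvg_lim _ Tleft)//; apply: limr_ge; first exact: cvgP Tleft.
  near=> x; apply: T1; apply/andP; split; near: x; [exact: nbhs_right_gt|exact: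
      nbhs_right_lt].
move: E1; rewrite /E !expr1n !mulr1; lra.
Unshelve. all: by end_near. 
Qed.

End Picone.

(** * Calabi's parameters: admissibility of [al] and [be], and the values of the two quotients *)

Ltac positivity :=
  first [assumption | lazymatch goal with
  | |- is_true (0 < ?x + ?y)%R => apply: addr_gt0; positivity
  | |- is_true (0 < ?x * ?y)%R => apply: mulr_gt0; positivity
  | |- is_true (0 < ?x ^+ ?n)%R => apply: exprn_gt0; positivity
  | |- is_true (0 < ?n%:R)%R => by rewrite ltr0n
  | |- is_true (0 < 1)%R => exact: ltr01
  end].

Section CalabiParameters.
Variables (R : realType) (a : R).
Hypothesis a_bounds : -1 < a < 2.

Let k0 := a ^+ 2 - 16 * a + 37.
(* Chosen so that [calabi_zE] holds. *)
Definition calabi_al : R := (1 + a) * (41 - 14 * a - a ^+ 2) / (3 * k0).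
Definition calabi_be : R := (1 + a) ^+ 2 * (4 - 2 * a) / (3 * k0).
Local Notation al := calabi_al.
Local Notation be := calabi_be.

Let x0 : 0 < a + 1. Proof. by case/andP: a_bounds; lra. Qed.
Let y0 : 0 < 2 - a. Proof. by case/andP: a_bounds; lra. Qed.

Lemma calabi_denom_gt0 : 0 < a ^+ 2 - 16 * a + 37.
Proof.
have -> : a ^+ 2 - 16 * a + 37 = 9 + 12 * (2 - a) + (2 - a) ^+ 2 by ring.
by rewrite !addr_gt0// ?mulr_gt0// exprn_gt0.
Qed.

Lemma calabi_Q1 : 1 - al + be = (2 - a) / 3.
Proof.
rewrite /al /be /k0; field.
by rewrite gt_eqF// calabi_denom_gt0.
Qed.

Lemma calabi_be_bounds : 0 <= be < 1.
Proof.
have k3 : 0 < 3 * k0 by rewrite mulr_gt0// calabi_denom_gt0.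
apply/andP; split.
  apply: divr_ge0 (mulr_ge0 (sqr_ge0 _) _) (ltW k3).
  by have := y0; lra.
rewrite ltr_pdivrMr// mul1r -subr_gt0 /k0.
(* Bernstein form on [[-1, 2]]: every coefficient in [a + 1] and [2 - a] is positive. *)
have -> : 3 * (a ^+ 2 - 16 * a + 37) - (1 + a) ^+ 2 * (4 - 2 * a) =
  6 * (2 - a) ^+ 3 + 12 * (a + 1) * (2 - a) ^+ 2 + 5 * (a + 1) ^+ 2 * (2 - a) + (a + 1)
      ^+ 3.
  by ring.
by positivity.
Qed.

(** Subtracting the linear term [u Q(1)], with [Q(1) = (2 - a) / 3], leaves the product
    [(1 - u) (1 - be u)]. *)
Lemma calabi_Qpos (u : R) : 0 <= u <= 1 -> 0 < 1 - al * u + be * u ^+ 2.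
Proof.
move=> /andP[u0 u1]; have /andP[be0 be1] := calabi_be_bounds.
have -> : 1 - al * u + be * u ^+ 2 = (1 - u) * (1 - be * u) + (2 - a) / 3 * u.
  by rewrite -calabi_Q1; ring.
have beu : be * u < 1 by apply: le_lt_trans be1; rewrite ler_piMr.
have [->|un1] := eqVneq u 1; first by rewrite subrr mul0r add0r mulr1 divr_gt0.
have {}u1 : u < 1 by rewrite lt_neqAle un1.
by rewrite ltr_wpDr ?mulr_ge0 ?divr_ge0 ?(ltW y0)// mulr_gt0 ?subr_gt0.
Qed.

(* The numerators of [1 - th] for [th = +-(al^2 - 2 be) + be^2] are written in
   the Bernstein basis of [-1, 2]. *)
Lemma calabi_graeffe : `|al ^+ 2 - 2 * be| + be ^+ 2 < 1.
Proof.
have k00 := calabi_denom_gt0; have k3 : 0 < (3 * k0) ^+ 2 by rewrite exprn_gt0// mulr_gt0.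
have k1 : k0 != 0 by rewrite gt_eqF.
rewrite -ltrBrDr ltr_norml; apply/andP; split; rewrite -subr_gt0.
- have -> : al ^+ 2 - 2 * be - - (1 - be ^+ 2) = (36 * (2 - a) ^+ 6
     + 144 * (a + 1) * (2 - a) ^+ 5
     + 240 * (a + 1) ^+ 2 * (2 - a) ^+ 4 + 228 * (a + 1) ^+ 3 * (2 - a) ^+ 3
     + 117 * (a + 1) ^+ 4 * (2 - a) ^+ 2 + 26 * (a + 1) ^+ 5 * (2 - a)
     + 2 * (a + 1) ^+ 6) / (3 * k0) ^+ 2.
    by rewrite /al /be /k0; field; exact: k1.
  by apply: divr_gt0 => //; positivity.
- have -> : 1 - be ^+ 2 - (al ^+ 2 - 2 * be) = (36 * (2 - a) ^+ 6
     + 144 * (a + 1) * (2 - a) ^+ 5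
     + 216 * (a + 1) ^+ 2 * (2 - a) ^+ 4 + 132 * (a + 1) ^+ 3 * (2 - a) ^+ 3
     + 21 * (a + 1) ^+ 4 * (2 - a) ^+ 2 + 2 * (a + 1) ^+ 5 * (2 - a)) / (3 * k0) ^+ 2.
    by rewrite /al /be /k0; field; exact: k1.
  by apply: divr_gt0 => //; positivity.
Qed.

Lemma calabi_zE (t : R) : -a <= t ->
  calabi_z a t * (2 + t) ^+ 2 = 3 * (1 + a) * frobp al be ((1 - t) / (1 + a)).
Proof.
move=> at'; have k1 : k0 != 0 by rewrite gt_eqF// calabi_denom_gt0.
have a1 : 1 + a != 0 by rewrite gt_eqF// addrC.
have a1' : a + 1 != 0 by rewrite gt_eqF.
have t2 : t + 2 != 0 by rewrite gt_eqF//; have := y0; lra.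
rewrite /calabi_z /frobp /al /be /k0; field.
by rewrite a1 t2 andbT; exact: k1.
Qed.

(** The Rayleigh quotient of [x1 - x2] in the scale of the shooting parameter [m]; the eigenvalue is
    [2 * m / rescaling a]. The next definition does the same for [x1 + x2]. *)
Definition positive_bound : R :=
  (13 * a ^+ 4 - 272 * a ^+ 3 + 2076 * a ^+ 2 - 7400 * a + 9679) /
  (5 * (5 - a) * (a ^+ 2 - 4 * a + 13) * k0).

Definition nodal_bound : R :=
  - (3 * (5 - a) * (a ^+ 3 - 105 * a ^+ 2 + 597 * a - 917)) / (5 * (a + 1) * k0 ^+ 2).

Let b := 1 + a.

Lemma positive_mode : exists2 m : R, 0 < m <= positive_bound &
  frobG al be 1 (2 * b / 3 - m * b) (m * (b ^+ 2 / 3)) 1 = 0.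
Proof.
have b0 : 0 < b by rewrite /b addrC.
apply: (positive_flux_zero calabi_graeffe calabi_Qpos); first by rewrite divr_gt0//
    mulr_gt0.
move=> m m0 H0 G1.
have := picone_positive calabi_graeffe calabi_Qpos H0 G1.
have a5 : 0 < 5 - a by have := y0; lra.
have q0 : 0 < a ^+ 2 - 4 * a + 13.
  have -> : a ^+ 2 - 4 * a + 13 = (2 - a) ^+ 2 + 9 by ring.
  by rewrite addr_gt0// exprn_gt0.
have k00 := calabi_denom_gt0.
have -> : b / 3 * (27 - 27 * b / 2 + 3 * b ^+ 2 - b ^+ 3 / 4) =
  (a + 1) * (5 - a) * (a ^+ 2 - 4 * a + 13) / 12 by rewrite /b; field.
rewrite -ler_pdivlMr ?divr_gt0 ?mulr_gt0//.
move=> /le_trans; apply; rewrite le_eqVlt; apply/orP; left; apply/eqP.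
rewrite /positive_bound /al /be /k0 /b; field.
by rewrite !gt_eqF.
Qed.

Lemma nodal_mode : exists2 m : R, 0 < m <= nodal_bound &
  frobG al be (- m) b (- (b ^+ 2 / 3)) 1 = 0.
Proof.
have b0 : 0 < b by rewrite /b addrC.
have b3 : b < 3 by rewrite /b; have := y0; lra.
apply: (nodal_flux_zero calabi_graeffe calabi_Qpos).
  move=> u /andP[u0 u1].
  have -> : b - b ^+ 2 / 3 * u = b * (3 - b * u) / 3 by field.
  rewrite divr_gt0// mulr_gt0// subr_gt0.
  by apply: le_lt_trans b3; rewrite ler_piMr// ltW.
move=> m m0 G0.
have a5 : 0 < 5 - a by have := y0; lra.
have k00 := calabi_denom_gt0.
have k1 : a ^+ 2 - 16 * a + 37 != 0 by rewrite gt_eqF.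
have a51 : 5 - a != 0 by rewrite gt_eqF.
have a1 : a + 1 != 0 by rewrite gt_eqF.
(* Picone's identity for the flux needs [0 < m]; the remaining case [m = 0] is settled by the sign
   of the bound, read off a Bernstein form. *)
have M0 : 0 <= nodal_bound.
  apply: divr_ge0; last by apply/ltW; apply: mulr_gt0; [positivity|exact: exprn_gt0].
  have -> : - (3 * (5 - a) * (a ^+ 3 - 105 * a ^+ 2 + 597 * a - 917)) =
    3 * (5 - a) * (60 * (2 - a) ^+ 3 + 90 * (a + 1) * (2 - a) ^+ 2
      + 36 * (a + 1) ^+ 2 * (2 - a) + 5 * (a + 1) ^+ 3) by ring.
  by apply/ltW; positivity.
move: m0; rewrite le_eqVlt => /orP[/eqP<-//|m0].
have eE : 3 * (6 - b) * ((9 - 2 * b) / (3 * (6 - b))) = 9 - 2 * b.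
  rewrite /b; field; rewrite gt_eqF//; have := y0; lra.
have := picone_nodal calabi_graeffe calabi_Qpos m0 b0 b3 eE G0.
set D := (X in - m * X <= _).
(* This value is the integral of [W (u - e)^2], and [5 - a] is [6 - b]. *)
have -> : - m * D = m * (b * k0 / (108 * (5 - a))).
  by rewrite /D /k0 /b; field.
have D0 : 0 < b * k0 / (108 * (5 - a)) by rewrite divr_gt0 ?mulr_gt0.
rewrite -ler_pdivlMr//.
move=> /le_trans; apply; rewrite le_eqVlt; apply/orP; left; apply/eqP.
rewrite /nodal_bound /al /be /k0 /b; field.
by rewrite k1 a1 a51.
Qed.

End CalabiParameters.

(** * Smooth functions on the Delzant level set *)

Section SmoothAlgebra.
Variables (R : realType) (m n : nat).
Implicit Types (f g : 'M[R]_(m, n) -> R) (U : set 'M[R]_(m, n)).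

Lemma isd_coord (z v : 'M[R]_(m, n)) i j :
  is_derive z v (fun z : 'M[R]_(m, n) => z i j) (v i j).
Proof.
apply: DeriveDef; first exact/diff_derivable/differentiable_coord.
apply: lim_near_cst => //; near=> h.
have h0 : h != 0 by near: h; exact: nbhs_dnbhs_neq.
rewrite /= !mxE addrK; rewrite /GRing.scale /= mulrA mulVf ?mul1r//.
Unshelve. all: by end_near. Qed.

(* Closed under partial derivatives as soon as [F] is closed under derivation. *)
Inductive smooth_alg (F : set (R -> R)) (q : 'M[R]_(m, n) -> R) : set ('M[R]_(m, n) ->
    R) :=
| SmoothCst c : smooth_alg F q (fun=> c)
| SmoothCoord i j : smooth_alg F q (fun z => z i j)
| SmoothComp phi : F phi -> smooth_alg F q (fun z => phi (q z))
| SmoothAdd f g : smooth_alg F q f -> smooth_alg F q g -> smooth_alg F q (fun z => f z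
    + g z)
| SmoothMul f g : smooth_alg F q f -> smooth_alg F q g -> smooth_alg F q (fun z => f z
    * g z).

Section Closure.
Variables (F : set (R -> R)) (q : 'M[R]_(m, n) -> R) (U : set 'M[R]_(m, n)).
Hypothesis Uopen : open U.
Hypothesis F_derive : forall phi, F phi -> exists2 phi', F phi' &
  forall z, U z -> is_derive (q z) (1 : R) phi (phi' (q z)).
Hypothesis q_continuous : continuous q.
Hypothesis q_derive : forall ij : 'I_m * 'I_n, exists2 dq, smooth_alg F q dq &
  forall z, is_derive z (delta_mx ij.1 ij.2 : 'M[R]_(m, n)) q (dq z).

Lemma smooth_alg_continuous f z : smooth_alg F q f -> U z -> {for z, continuous f}.
Proof.
move=> + Uz; elim => {f} [c|i j|phi /F_derive[phi' _ Hphi]|f g _ cf _ cg|f g _ cf _ cg].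
- exact: cst_continuous.
- exact: coord_continuous.
- apply: (@continuous_comp _ _ _ q phi); first exact: q_continuous.
  exact: is_derive1_continuous (Hphi z Uz).
- exact: continuousD.
- exact: continuousM.
Qed.

Lemma smooth_alg_derive f (ij : 'I_m * 'I_n) : smooth_alg F q f ->
  exists2 g, smooth_alg F q g &
  forall z, U z -> is_derive z (delta_mx ij.1 ij.2 : 'M[R]_(m, n)) f (g z).
Proof.
elim => {f} [c|i j|phi Fphi|f g sf [f' sf' df] sg [g' sg' dg]|f g sf [f' sf' df] sg [g'
    sg' dg]].
- by exists (fun=> 0); [exact: SmoothCst|move=> z _; exact: isd_cst].
- exists (fun=> (delta_mx ij.1 ij.2 : 'M[R]_(m, n)) i j); first exact: SmoothCst.
  by move=> z _; exact: isd_coord.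
- have [phi' Fphi' dphi] := F_derive Fphi; have [dq sdq Hdq] := q_derive ij.
  exists (fun z => phi' (q z) * dq z); first exact: SmoothMul (SmoothComp q Fphi') sdq.
  by move=> z Uz; exact: isd_comp (dphi z Uz) (Hdq z).
- exists (fun z => f' z + g' z); first exact: SmoothAdd.
  by move=> z Uz; apply: isd_add; [exact: df|exact: dg].
- exists (fun z => f z * g' z + f' z * g z).
    by apply: SmoothAdd; exact: SmoothMul.
  by move=> z Uz; apply: isd_mul; [exact: df|exact: dg].
Qed.

(** Every iterated partial derivative agrees on [U] with a member of the class. Since [U] is open,
    agreement on [U] is enough to transfer continuity and derivability. *)
Lemma smooth_alg_smooth f : smooth_alg F q f -> smooth_on U f.
Proof.
move=> sf s.
have [g sg fg] : exists2 g, smooth_alg F q g & forall z, U z -> iter_partial s f z = g z.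
  elim: s => [|ij s [g sg fg]]; first by exists f.
  have [g' sg' dg] := smooth_alg_derive ij sg.
  exists g' => // z Uz; rewrite /= /partial.
  have nfg : \forall w \near z, iter_partial s f w = g w.
    exact: filterS (open_nbhs_nbhs (conj Uopen Uz)).
  rewrite (near_eq_derive _ nfg).
  by have [_ ->] := dg z Uz.
move=> x Ux.
have nfg : \forall w \near x, g w = iter_partial s f w.
  by apply: filterS (open_nbhs_nbhs (conj Uopen Ux)) => w /fg.
split.
  have := smooth_alg_continuous sg Ux; rewrite /prop_for /continuous_at fg// => gc.
  apply: cvg_trans gc; exact: (near_eq_cvg nfg).
move=> ij; have [g' _ dg] := smooth_alg_derive ij sg.
by apply: near_eq_derivable nfg _; have [] := dg x Ux.
Qed.

End Closure.

Lemma smooth_alg_sum_sqr F (c : R) i (j j' : 'I_n) :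
  let q (z : 'M[R]_(m, n)) := c * (z i j * z i j + z i j' * z i j') in
  continuous q /\ forall ij : 'I_m * 'I_n, exists2 dq, smooth_alg F q dq &
  forall z, is_derive z (delta_mx ij.1 ij.2 : 'M[R]_(m, n)) q (dq z).
Proof.
move=> q; split=> [z|ij].
  have cc k l : {for z, continuous (fun w : 'M[R]_(m, n) => w k l)} by exact:
      coord_continuous.
  have c0 : {for z, continuous (fun _ : 'M[R]_(m, n) => c)} by exact: cst_continuous.
  exact: continuousM c0 (continuousD (continuousM (cc i j) (cc i j))
    (continuousM (cc i j') (cc i j'))).
pose e := delta_mx ij.1 ij.2 : 'M[R]_(m, n).
exists (fun z => c * ((z i j * e i j + e i j * z i j) + (z i j' * e i j' + e i j' * z i
    j'))).
  have sc := SmoothCst F q; have sx := SmoothCoord F q.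
  by apply: SmoothMul => //; do !apply: SmoothAdd; apply: SmoothMul.
by move=> z; apply: isd_scale; apply: isd_add; apply: isd_mul; exact: isd_coord.
Qed.

End SmoothAlgebra.

Local Notation k0 := (Ordinal (isT : 0 < 4)%N).
Local Notation k1 := (Ordinal (isT : 1 < 4)%N).
Local Notation k2 := (Ordinal (isT : 2 < 4)%N).
Local Notation k3 := (Ordinal (isT : 3 < 4)%N).
Local Notation j0 := (inord 0 : 'I_2).
Local Notation j1 := (inord 1 : 'I_2).

Section LevelSet.
Variable R : realType.
Implicit Types (a : R) (x : 'rV[R]_2) (z : 'M[R]_(4, 2)).

Definition sqmod (k : 'I_4) z : R := z k j0 * z k j0 + z k j1 * z k j1.

Lemma inord0E : j0 = ord0. Proof. by apply/val_inj; rewrite /= inordK. Qed.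
Lemma inord1E : j1 = lift ord0 ord0. Proof. by apply/val_inj; rewrite /= inordK. Qed.

Lemma psi_sum a x k :
  psi a x ord0 k = offsets a ord0 k + (x ord0 j0 * normals R k j0 + x ord0 j1 * normals
      R k j1).
Proof. by rewrite inord0E inord1E !mxE big_ord_recl big_ord1 !mxE. Qed.

Lemma psiE a x :
  [/\ psi a x ord0 k0 = 1 + x ord0 j0, psi a x ord0 k1 = 1 + x ord0 j1,
      psi a x ord0 k2 = a + (x ord0 j0 + x ord0 j1) &
      psi a x ord0 k3 = 1 - (x ord0 j0 + x ord0 j1)].
Proof. by split; rewrite psi_sum !mxE !inordK//=; ring. Qed.

Lemma sqmod_torus_act eta z k : sqmod k (torus_act eta z) = sqmod k z.
Proof.
rewrite /sqmod !mxE eqxx.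
have -> : (j1 == j0) = false by rewrite inord0E inord1E.
have := cos2Dsin2 (eta ord0 k); set c := cos _; set s := sin _ => cs.
rewrite /=; transitivity ((c ^+ 2 + s ^+ 2) * (z k j0 * z k j0 + z k j1 * z k j1));
    first by ring.
by rewrite cs mul1r.
Qed.

Lemma sqmod_toric_point a (y : 'rV[R]_(2 + 2)) k : 0 <= psi a (lsubmx y) ord0 k ->
  sqmod k (toric_point a y) = 2 * psi a (lsubmx y) ord0 k.
Proof.
move=> psi0; rewrite sqmod_torus_act /sqmod ![(\matrix_(_, _) _) _ _]mxE eqxx.
have -> : (j1 == j0) = false by rewrite inord0E inord1E.
by rewrite mulr0 addr0 -expr2 sqr_sqrtr ?mulr_ge0.
Qed.

Lemma sqmod_level a z : delzant_level a z -> exists2 x, moment_polytope a x &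
  forall k, sqmod k z = 2 * psi a x ord0 k.
Proof. by case=> x Px Hz; exists x => // k; rewrite -Hz /sqmod -!expr2. Qed.

Lemma sqmod_continuous k : continuous (sqmod k).
Proof.
move=> z; have cc i j : {for z, continuous (fun w : 'M[R]_(4, 2) => w i j)}
  by exact: coord_continuous.
exact: continuousD (continuousM (cc k j0) (cc k j0)) (continuousM (cc k j1) (cc k j1)).
Qed.

Lemma sqmod_ge0 k z : 0 <= sqmod k z.
Proof. by rewrite /sqmod -!expr2 addr_ge0 ?sqr_ge0. Qed.

Lemma smooth_alg_sqmod F q k : smooth_alg F q (sqmod k).
Proof.
by apply: SmoothAdd; apply: SmoothMul; exact: SmoothCoord.
Qed.

Section Eigenfunction.
Variables (a r A B : R) (d1 d2 : nat -> R) (D : 'M[R]_(4, 2) -> R).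
Hypothesis a_gt : -1 < a.
Hypothesis d1_conv : psconv 1 d1.
Hypothesis r_bounds : 0 < r <= 1.
Hypothesis d2_conv : psconv r d2.
Hypothesis d12 : forall u : R, 1 - r < u < 1 -> psum d1 u = psum d2 (1 - u).
Hypothesis AB_gt0 : forall u : R, 0 <= u <= 1 -> 0 < A + B * u.
Hypothesis D_smooth : forall F q, smooth_alg F q D.
Hypothesis D_act : forall eta z, D (torus_act eta z) = D z.

Let b := 1 + a.
Definition level_u z : R := (2 * b)^-1 * sqmod k3 z.
Let level_v z : R := (2 * b)^-1 * sqmod k2 z.

(* [u = 1] is the exceptional divisor, where the series [psum d1] is continued
   by [psum d2]. *)
Definition radial_ext (u : R) : R := if u < 1 then psum d1 u else psum d2 0.

Definition eigenfunction z : R := D z * ((A + B * level_u z)^-1 * radial_ext (level_u z)).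

Let b_gt0 : 0 < b. Proof. by have := a_gt; rewrite /b; lra. Qed.

Lemma level_uv z : delzant_level a z ->
  [/\ 0 <= level_u z, 0 <= level_v z & level_u z + level_v z = 1].
Proof.
have bi : 0 <= (2 * b)^-1 by rewrite invr_ge0 mulr_ge0// ltW.
move=> /sqmod_level[x _ Hx]; split; [exact: mulr_ge0 (sqmod_ge0 _ _)..|].
have [_ _ p2 p3] := psiE a x.
rewrite /level_u /level_v !Hx p2 p3 /b; field.
by have := b_gt0; rewrite /b => /lt0r_neq0.
Qed.

(** The smallest convenient set containing the two factors of the radial part, [psum d] and the
    inverse of [A' + B' x], and closed under derivation. *)
Let family (A' B' : R) (d : nat -> R) : set (R -> R) := [set phi |
  (exists k, phi = psum (iter k (@pseries_diffs R) d)) \/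
  (exists c k, phi = fun x : R => c * (A' + B' * x)^-1 ^+ k)].

Let family_derive (A' B' r' : R) d (S : set R) : psconv r' d ->
  (forall x : R, S x -> `|x| < r' /\ A' + B' * x != 0) ->
  forall phi, family A' B' d phi -> exists2 phi', family A' B' d phi' &
    forall x : R, S x -> is_derive x (1 : R) phi (phi' x).
Proof.
move=> dr HS phi [[k ->]|[c [k ->]]].
  exists (psum (iter k.+1 (@pseries_diffs R) d)); first by left; exists k.+1.
  move=> x /HS[xr _]; apply: is_derive_psum xr.
  by elim: k => // k IH; exact: psconv_diffs.
exists (fun x : R => - (c * k%:R * B') * (A' + B' * x)^-1 ^+ k.+1).
  by right; exists (- (c * k%:R * B')), k.+1.
move=> x /HS[_ x0].
have dl : is_derive x (1 : R) (fun x : R => A' + B' * x) (0 + B' * 1).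
  exact: isd_add (isd_cst x 1 A') (isd_scale B' (isd_id x)).
have dX : is_derive x (1 : R) (fun x : R => (A' + B' * x)^-1 ^+ k)
    (k%:R * (A' + B' * x)^-1 ^+ k.-1 * (- (0 + B' * 1) / (A' + B' * x) ^+ 2)).
  exact: (isd_exp (f := fun x : R => (A' + B' * x)^-1) k
    (isd_inv (f := fun x : R => A' + B' * x) x0 dl)).
apply: is_derive_eq (isd_scale c dX) _.
case: k {dX} => [|k]; first by rewrite mulr0n; ring.
rewrite /= -[k.+2]addn2 exprD; move: ((A' + B' * x)^-1 ^+ k) => y; by field.
Qed.

(** Two local extensions cover the level set: the series [d1] in [level_u] off the exceptional
    divisor, and [d2] in [level_v] near it. Both variables are quadratic polynomials in [z]. They
    satisfy [u + v = 1] on the level set, which is the only place where the extension has to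
    match. *)
Lemma eigenfunction_smooth : smooth_on_manifold a eigenfunction.
Proof.
split=> [z Zz|eta z _ _]; last first.
  by rewrite /eigenfunction D_act /level_u sqmod_torus_act.
have [u0 v0 uv] := level_uv Zz; have /andP[r0 r1] := r_bounds.
have lin_continuous k : continuous (fun w => (2 * b)^-1 * sqmod k w).
  move=> w; have c0 : {for w, continuous (fun _ : 'M[R]_(4, 2) => (2 * b)^-1)}.
    exact: cst_continuous.
  exact: continuousM c0 (@sqmod_continuous k w).
have chart k (A' B' r' : R) d : psconv r' d ->
    (forall x : R, 0 <= x < r' -> A' + B' * x != 0) ->
    smooth_on [set w | (2 * b)^-1 * sqmod k w < r'] (fun w => D w *
      ((A' + B' * ((2 * b)^-1 * sqmod k w))^-1 * psum d ((2 * b)^-1 * sqmod k w))).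
  move=> dr HAB.
  pose q (w : 'M[R]_(4, 2)) := (2 * b)^-1 * sqmod k w.
  pose U := [set w | q w < r'].
  have [qc qd] := smooth_alg_sum_sqr (family A' B' d) (2 * b)^-1 k j0 j1.
  have Uo : open U by apply: (@open_comp _ _ q [set x | x < r']) => [w _|]; [exact:
      qc|exact: open_lt].
  have US (x : R) : [set q w | w in U] x -> `|x| < r' /\ A' + B' * x != 0.
    case=> w Uw <-; have qw0 : 0 <= q w.
      by rewrite mulr_ge0 ?sqmod_ge0// invr_ge0 mulr_ge0// ltW.
    by rewrite ger0_norm//; split => //; apply: HAB; rewrite qw0.
  apply: (smooth_alg_smooth (F := family A' B' d) (q := q) Uo _ qc qd).
    move=> phi /(family_derive dr US)[phi' Fphi' Hphi].
    by exists phi' => // w Uw; apply: Hphi; exists w.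
  have F1 : family A' B' d (fun x : R => (A' + B' * x)^-1).
    by right; exists 1, 1%N; apply/funext => x; rewrite mul1r expr1.
  have F2 : family A' B' d (psum d) by left; exists 0%N.
  exact: SmoothMul (D_smooth _ _) (SmoothMul (SmoothComp q F1) (SmoothComp q F2)).
have [u1|u1] := ltP (level_u z) 1.
  exists [set w | level_u w < 1].
  exists (fun w => D w * ((A + B * level_u w)^-1 * psum d1 (level_u w))); split => //.
  - by apply: (@open_comp _ _ level_u [set x | x < 1]) => [w _|];
      [exact: lin_continuous|exact: open_lt].
  - apply: chart => // x /andP[x0 x1]; apply/lt0r_neq0/AB_gt0.
    by rewrite x0 ltW.
  - by move=> w /= w1 _; rewrite /eigenfunction /radial_ext w1.
have vz : level_v z = 0 by apply/eqP; rewrite eq_le v0 andbT; lra.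
exists [set w | level_v w < r].
exists (fun w => D w * ((A + B + - B * level_v w)^-1 * psum d2 (level_v w))); split => //.
- by apply: (@open_comp _ _ level_v [set x | x < r]) => [w _|];
    [exact: lin_continuous|exact: open_lt].
- by rewrite /= vz.
- apply: chart => // x /andP[x0 x1]; apply/lt0r_neq0.
  have -> : A + B + - B * x = A + B * (1 - x) by ring.
  by apply: AB_gt0; lra.
- move=> w /= wr Zw; have [uw0 vw0 uvw] := level_uv Zw.
  have uE : level_u w = 1 - level_v w by lra.
  rewrite /eigenfunction uE; congr (_ * (_ * _)); first by congr (_^-1); ring.
  rewrite /radial_ext; case: ltP => w1; last by congr psum; lra.
  by rewrite d12; [congr psum; ring|lra].
Qed.

Lemma eigenfunction_invariant : T2_invariant a eigenfunction.
Proof.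
by move=> theta z _; rewrite /eigenfunction /T2_act D_act /level_u sqmod_torus_act.
Qed.

Lemma eigenfunction_toric (y : 'rV[R]_(2 + 2)) :
  0 < psi a (lsubmx y) ord0 k2 -> 0 <= psi a (lsubmx y) ord0 k3 ->
  let u := (1 - (y ord0 (lshift 2 j0) + y ord0 (lshift 2 j1))) / b in
  eigenfunction (toric_point a y) = D (toric_point a y) * ((A + B * u)^-1 * psum d1 u).
Proof.
move=> p2 p3 u.
have uE : level_u (toric_point a y) = u.
  rewrite /level_u sqmod_toric_point//; have [_ _ _ ->] := psiE a (lsubmx y).
  rewrite !mxE /u; field; exact: lt0r_neq0 b_gt0.
have u1 : u < 1.
  rewrite ltr_pdivrMr// mul1r; move: p2; have [_ _ -> _] := psiE a (lsubmx y).
  by rewrite !mxE /b; lra.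
by rewrite /eigenfunction uE /radial_ext u1.
Qed.

End Eigenfunction.
End LevelSet.

(** * The Laplacian in symplectic coordinates *)

Section ToricLaplacian.
Variables (R : realType) (a : R).
Hypothesis a_bounds : -1 < a < 2.
Lemma interior_polytope_direction (x v : 'rV[R]_2) : (moment_polytope a)° x ->
  exists2 h : R, 0 < h & moment_polytope a (h *: v + x).
Proof.
move=> xi.
have cv : h *: v + x @[h --> (0 : R)] --> x.
  have E : (0 : R) *: v + x = x by rewrite scale0r add0r.
  rewrite -[X in _ --> X]E; apply: cvgD; last exact: cvg_cst.
  exact: (@scalel_continuous _ _ v 0).
have N : \forall h \near (0 : R)^'+, moment_polytope a (h *: v + x).
  exact: (cvg_at_right_filter cv) _ xi.
have P := @nbhs_right_gt R 0.
have [h [h0 hP]] := filter_ex (filterI P N).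
by exists h.
Qed.

(** Each strict inequality comes from a short move towards the corresponding facet, after which the
    weak inequality must still hold. *)
Lemma interior_polytope (x : 'rV[R]_2) : (moment_polytope a)° x ->
  [/\ 0 < x ord0 j0 + 1, 0 < x ord0 j1 + 1, 0 < a + (x ord0 j0 + x ord0 j1) &
      0 < 1 - (x ord0 j0 + x ord0 j1)].
Proof.
move=> xi; split.
- have [h h0 /(_ k0)] := interior_polytope_direction (- delta_mx 0 j0) xi.
  have [-> _ _ _] := psiE a (h *: - delta_mx 0 j0 + x).
  by rewrite !mxE !eqxx /=; lra.
- have [h h0 /(_ k1)] := interior_polytope_direction (- delta_mx 0 j1) xi.
  have [_ -> _ _] := psiE a (h *: - delta_mx 0 j1 + x).
  by rewrite !mxE !eqxx /=; lra.
- have [h h0 /(_ k2)] := interior_polytope_direction (- delta_mx 0 j0) xi.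
  have [_ _ -> _] := psiE a (h *: - delta_mx 0 j0 + x).
  by rewrite !mxE !eqxx -val_eqE /= !inordK//=; lra.
- have [h h0 /(_ k3)] := interior_polytope_direction (delta_mx 0 j0) xi.
  have [_ _ _ ->] := psiE a (h *: delta_mx 0 j0 + x).
  by rewrite !mxE !eqxx -val_eqE /= !inordK//=; lra.
Qed.

Lemma ord2P (i : 'I_2) : i = j0 \/ i = j1.
Proof.
by case: i => [[|[|//]] h]; [left|right]; apply/val_inj; rewrite /= inordK.
Qed.

Lemma inord01_neq : (j0 == j1) = false /\ (j1 == j0) = false.
Proof. by split; rewrite -val_eqE /= !inordK. Qed.

Lemma sum_ord2 (V : nmodType) (F : 'I_2 -> V) : \sum_i F i = F j0 + F j1.
Proof. by rewrite big_ord_recl big_ord1 inord0E inord1E. Qed.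

(** Sherman-Morrison: the Hessian is half of a diagonal matrix plus [rho] times the all-ones matrix,
    with [rho = (1/z - 1) / (2 + t)]. The correction denominator is [1 + rho (2 + t) = 1/z], as the
    [x_i + 1] add up to [2 + t]. *)
Definition inverse_hessian (x : 'rV[R]_2) : 'M[R]_2 :=
  let t := x ord0 j0 + x ord0 j1 in
  \matrix_(i, j) (2 * ((if i == j then x ord0 i + 1 else 0) -
    (x ord0 i + 1) * (x ord0 j + 1) * (1 - calabi_z a t) / (2 + t))).

Lemma calabi_z_gt0 (t : R) : -a < t < 1 -> 0 < calabi_z a t.
Proof.
move=> /andP[ta t1]; have /andP[a1 a2] := a_bounds.
have s0 : 0 < 2 + t by lra.
have b0 : 0 < 1 + a by lra.
rewrite -(pmulr_lgt0 _ (exprn_gt0 2 s0)) calabi_zE ?ltW// mulr_gt0//.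
  by rewrite mulr_gt0.
apply: (frobp_gt0 (calabi_Qpos a_bounds)).
by rewrite divr_gt0 ?subr_gt0//= ltr_pdivrMr// mul1r; lra.
Qed.

Lemma inverse_hessianP (x : 'rV[R]_2) :
  0 < x ord0 j0 + 1 -> 0 < x ord0 j1 + 1 -> - a < x ord0 j0 + x ord0 j1 < 1 ->
  calabi_hessian a x *m inverse_hessian x = 1%:M.
Proof.
move=> x0 x1 tt; have z0 := lt0r_neq0 (calabi_z_gt0 tt).
have x0' := lt0r_neq0 x0; have x1' := lt0r_neq0 x1.
have s0 : 2 + (x ord0 j0 + x ord0 j1) != 0 by apply: lt0r_neq0; lra.
have [e01 e10] := inord01_neq.
apply/matrixP => i j; rewrite !mxE sum_ord2 !mxE.
set t := _ + _ in z0 s0 *; set z := calabi_z a t in z0 *.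
have tE : t = x ord0 j0 + x ord0 j1 by [].
case: (ord2P i) => ->; case: (ord2P j) => ->; rewrite ?eqxx ?e01 ?e10 /=.
all: move: x0' x1' s0 z0; rewrite /t; move: (x ord0 j0) (x ord0 j1) z => p q z x0' x1'
    s0 z0.
all: by field; rewrite ?x0' ?x1' ?s0 ?z0.
Qed.

Local Notation xc i := (fun y : 'rV[R]_(2 + 2) => y ord0 (lshift 2 i)).

Definition toric_interior : set 'rV[R]_(2 + 2) := [set y |
  [/\ 0 < xc j0 y + 1, 0 < xc j1 y + 1, - a < xc j0 y + xc j1 y & xc j0 y + xc j1 y < 1]].

Lemma toric_interior_near (y : 'rV[R]_(2 + 2)) :
  toric_interior y -> \forall y' \near y, toric_interior y'.
Proof.
case=> h0 h1 h2 h3.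
have cX i : {for y, continuous (xc i)} by exact: coord_continuous.
have c0 : {for y, continuous (fun y' => xc j0 y' + 1)}.
  by apply: continuousD; [exact: cX|exact: cst_continuous].
have c1 : {for y, continuous (fun y' => xc j1 y' + 1)}.
  by apply: continuousD; [exact: cX|exact: cst_continuous].
have c2 : {for y, continuous (fun y' => xc j0 y' + xc j1 y')}.
  by apply: continuousD; exact: cX.
near=> y'; split; near: y'.
- exact: cvgr_gt c0 _ h0.
- exact: cvgr_gt c1 _ h1.
- exact: cvgr_gt c2 _ h2.
- exact: cvgr_lt c2 _ h3.
Unshelve. all: by end_near. Qed.

Definition rescaling : R := 2 * Num.sqrt 2 / Num.sqrt ((a + 1) * (5 - a)).

Lemma rescaling_gt0 : 0 < rescaling.
Proof.
have /andP[a1 a2] := a_bounds.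
rewrite divr_gt0 ?mulr_gt0// ?sqrtr_gt0// mulr_gt0//; lra.
Qed.

(** The blocks [H] and its inverse cancel in the determinant, so the volume density is constant and
    the Laplacian is a plain divergence of the flux. *)
Lemma normalised_metric_inverse (y : 'rV[R]_(2 + 2)) : toric_interior y ->
  \det (normalised_metric a y) = rescaling ^+ 4 /\
  invmx (normalised_metric a y) = rescaling^-1 *:
    block_mx (inverse_hessian (lsubmx y)) 0 0 (calabi_hessian a (lsubmx y)).
Proof.
case=> h0 h1 h2 h3.
have HK : calabi_hessian a (lsubmx y) *m inverse_hessian (lsubmx y) = 1%:M.
  by apply: inverse_hessianP; rewrite !mxE// h2 h3.
have [Hu Ku] := mulmx1_unit HK.
have KE : invmx (calabi_hessian a (lsubmx y)) = inverse_hessian (lsubmx y).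
  by rewrite -[LHS]mulmx1 -HK mulKmx.
have c0 := lt0r_neq0 rescaling_gt0.
have detB : \det (calabi_metric a y) = 1.
  rewrite /calabi_metric det_ublock det_inv mulfV//.
  by move: Hu; rewrite unitmxE unitfE.
have Bu : calabi_metric a y \in unitmx by rewrite unitmxE detB unitr1.
split; first by rewrite /normalised_metric detZ detB mulr1.
rewrite /normalised_metric invmxZ; last first.
  by rewrite unitmxZ// unitfE.
congr (_ *: _); rewrite /calabi_metric invmx_block_diag; last first.
  exact: Bu.
by rewrite invmxK KE.
Qed.

(* [fl i] is the flux [u^ij d_j f]. *)
Lemma laplacian_toric (f : 'rV[R]_(2 + 2) -> R) (d fl : 'I_2 -> 'rV[R]_(2 + 2) -> R)
    (gl : 'I_2 -> R) (y : 'rV[R]_(2 + 2)) : toric_interior y ->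
  (forall i y', toric_interior y' -> is_derive y' (delta_mx ord0 (lshift 2 i) :
      'rV[R]_(2 + 2)) f (d i y')) ->
  (forall i y', toric_interior y' -> is_derive y' (delta_mx ord0 (rshift 2 i) :
      'rV[R]_(2 + 2)) f 0) ->
  (forall i y', toric_interior y' -> fl i y' =
     inverse_hessian (lsubmx y') i j0 * d j0 y' + inverse_hessian (lsubmx y') i j1 * d
         j1 y') ->
  (forall i, is_derive y (delta_mx ord0 (lshift 2 i) : 'rV[R]_(2 + 2)) (fl i) (gl i)) ->
  laplacian (normalised_metric a) f y = - rescaling^-1 * (gl j0 + gl j1).
Proof.
move=> yI fd fd0 flE fld.
have c0 := rescaling_gt0; set c := rescaling in c0 *.
have c1 := lt0r_neq0 c0.
have sq (y' : 'rV[R]_(2 + 2)) : toric_interior y' ->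
    Num.sqrt (\det (normalised_metric a y')) = c ^+ 2.
  move=> /normalised_metric_inverse[-> _].
  by rewrite -/c (exprM c 2 2) sqrtr_sqr ger0_norm// exprn_ge0// ltW.
pose Phi (i : 'I_(2 + 2)) (y' : 'rV[R]_(2 + 2)) : R := Num.sqrt (\det
    (normalised_metric a y')) *
      \sum_(j < 2 + 2) invmx (normalised_metric a y') i j * partial (ord0, j) f y'.
have PhiL i y' : toric_interior y' -> Phi (lshift 2 i) y' = c * fl i y'.
  move=> y'I; rewrite /Phi sq// (normalised_metric_inverse y'I).2 -/c.
  rewrite big_split_ord /= [X in _ * (_ + X)]big1 ?addr0; last first.
    by move=> j _; rewrite mxE block_mxEur mxE mulr0 mul0r.
  rewrite sum_ord2 flE// /partial /=.
  have [_ ->] := fd j0 y' y'I; have [_ ->] := fd j1 y' y'I.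
  have cE (M : 'M[R]_(2 + 2)) k l : (c^-1 *: M) k l = c^-1 * M k l by rewrite mxE.
  rewrite !cE !block_mxEul.
  by field.
have PhiR i y' : toric_interior y' -> Phi (rshift 2 i) y' = 0.
  move=> y'I; rewrite /Phi sq// (normalised_metric_inverse y'I).2 -/c.
  rewrite big_split_ord /= !big1 ?addr0 ?mulr0// => j _.
    by rewrite /partial /=; have [_ ->] := fd0 j y' y'I; rewrite mulr0.
  by rewrite mxE block_mxEdl mxE mulr0 mul0r.
rewrite /laplacian sq// big_split_ord /= [X in _ * (_ + X)]big1 ?addr0; last first.
  move=> i _; rewrite /partial /= -/(Phi (rshift 2 i)).
  have N : \forall y' \near y, Phi (rshift 2 i) y' = (fun=> 0) y'.
    by apply: filterS (toric_interior_near yI) => y' /PhiR.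
  by rewrite (near_eq_derive _ N) derive_cst.
have PL i : partial (ord0, lshift 2 i) (Phi (lshift 2 i)) y = c * gl i.
  have N : \forall y' \near y, Phi (lshift 2 i) y' = (fun y' => c * fl i y') y'.
    by apply: filterS (toric_interior_near yI) => y' /PhiL.
  rewrite /partial /= (near_eq_derive _ N).
  by have [_ ->] := isd_scale c (fld i).
by rewrite (eq_bigr (fun i => c * gl i)) => [|i _]; [rewrite sum_ord2; field|exact: PL].
Qed.

End ToricLaplacian.

(** * The two modes as eigenfunctions on the manifold *)

Section Modes.
Variables (R : realType) (a : R).
Hypothesis a_bounds : -1 < a < 2.
Local Notation xc i := (fun y : 'rV[R]_(2 + 2) => y ord0 (lshift 2 i)).
Local Notation al := (calabi_al a).
Local Notation be := (calabi_be a).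
Local Notation c := (rescaling a).

Let b := 1 + a.

Let b_gt0 : 0 < b. Proof. by have /andP[] := a_bounds; rewrite /b; lra. Qed.

Let b_lt3 : b < 3. Proof. by have /andP[] := a_bounds; rewrite /b; lra. Qed.

Definition radial (y : 'rV[R]_(2 + 2)) : R := (1 - (xc j0 y + xc j1 y)) / (1 + a).

Lemma radial_bounds y : toric_interior a y -> 0 < radial y < 1.
Proof.
case=> h0 h1 h2 h3; rewrite /radial divr_gt0 ?subr_gt0//=.
by rewrite ltr_pdivrMr// mul1r /b; lra.
Qed.

Lemma interior_toric y : (moment_polytope a)° (lsubmx y) -> toric_interior a y.
Proof.
by move=> /interior_polytope[]; rewrite !mxE => ? ? ? ?; split => //; lra.
Qed.

(** A point with [u = 0], where [H = 1], and with [x1 - x2 = 3]; neither mode vanishes there. *)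
Definition vertex : 'rV[R]_2 := \row_j (if j == j0 then 2 else -1).

Lemma vertex_toric : exists2 z, delzant_level a z &
  [/\ sqmod k0 z = 6, sqmod k1 z = 0 & sqmod k3 z = 0].
Proof.
have [e01 e10] := inord01_neq.
have vE : vertex ord0 j0 = 2 /\ vertex ord0 j1 = -1 by rewrite !mxE eqxx e10.
pose y : 'rV[R]_(2 + 2) := row_mx vertex 0.
have [p0 p1 p2 p3] := psiE a vertex.
rewrite vE.1 vE.2 in p0 p1 p2 p3.
have pos k : 0 <= psi a vertex ord0 k.
  case: k => [[|[|[|[|//]]]] h].
  - by rewrite (_ : Ordinal h = k0) ?p0; [lra|exact/val_inj].
  - by rewrite (_ : Ordinal h = k1) ?p1; [lra|exact/val_inj].
  - by rewrite (_ : Ordinal h = k2) ?p2; [have := b_gt0; rewrite /b; lra|exact/val_inj].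
  - by rewrite (_ : Ordinal h = k3) ?p3; [lra|exact/val_inj].
have sq k : sqmod k (toric_point a y) = 2 * psi a vertex ord0 k.
  by rewrite sqmod_toric_point row_mxKl.
exists (toric_point a y).
  by exists vertex => // k; rewrite -sq /sqmod -!expr2.
by rewrite !sq p0 p1 p3; split; lra.
Qed.

(** Collects what the modes share: extension through [u = 1], smoothness, invariance and
    non-vanishing. The computation of the Laplacian in the interior is left to each mode. *)
Lemma mode_eigenvalue (sg w0 w1 A B mu : R) (D : 'M[R]_(4, 2) -> R) :
  frobG al be sg w0 w1 1 = 0 ->
  (forall u : R, 0 <= u <= 1 -> 0 < A + B * u) ->
  (forall F q, smooth_alg F q D) ->
  (forall eta z, D (torus_act eta z) = D z) ->
  (forall z, sqmod k0 z = 6 -> sqmod k1 z = 0 -> D z != 0) ->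
  (forall f, (forall y, toric_interior a y -> f y =
      D (toric_point a y) * ((A + B * radial y)^-1 * frobH al be sg w0 w1 (radial y))) ->
    forall y, toric_interior a y -> laplacian (normalised_metric a) f y = mu * f y) ->
  invariant_eigenvalue a mu.
Proof.
move=> G1 AB Dsm Dact Dn Lap.
have gr := calabi_graeffe a_bounds; have Qp := calabi_Qpos a_bounds.
have [d2 [r r01 [d2r d12]]] := frobH_extends gr Qp G1.
have d1r : psconv 1 (frobh al be sg w0 w1) by exact: frobh_psconv1.
have a1 : -1 < a by case/andP: a_bounds.
pose f := eigenfunction a A B (frobh al be sg w0 w1) d2 D.
exists f; split.
- by apply: (eigenfunction_smooth a1 d1r r01 d2r d12 AB Dsm Dact).
- exact: eigenfunction_invariant.
- have [z Zz [s0 s1 s3]] := vertex_toric.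
  exists z => //; rewrite /f /eigenfunction /level_u s3 mulr0 /radial_ext ltr01 psum0.
  rewrite mulr1 mulf_neq0 ?Dn// invr_neq0// lt0r_neq0// AB// lexx ler01//.
- move=> y /interior_toric yI; apply: (Lap (f \o toric_point a)) => // y' y'I.
  have [h0 h1 h2 h3] := y'I.
  have [_ _ p2 p3] := psiE a (lsubmx y').
  rewrite /= /f eigenfunction_toric//.
  + by rewrite p2 !mxE; lra.
  + by rewrite p3 !mxE; lra.
Qed.

Lemma radial_derive (phi : R -> R) (d : R) (y v : 'rV[R]_(2 + 2)) :
  is_derive (radial y) (1 : R) phi d ->
  is_derive y v (fun y => phi (radial y)) (d * ((0 - (xc j0 v + xc j1 v)) / b)).
Proof.
move=> pd.
have rd : is_derive y v radial ((0 - (xc j0 v + xc j1 v)) / b).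
  have E := isd_mul (isd_sub (isd_cst y v 1) (isd_add (isd_coord y v ord0 (lshift 2
      j0)) (isd_coord y v ord0 (lshift 2 j1))))
     (isd_cst y v b^-1).
  by apply: is_derive_eq E _; ring.
exact: isd_comp pd rd.
Qed.

Lemma coord_delta (i : 'I_2) (k : 'I_2) :
  xc k (delta_mx ord0 (lshift 2 i)) = (k == i)%:R /\ xc k (delta_mx ord0 (rshift 2 i))
      = 0.
Proof.
by rewrite /= !mxE eqxx /= eq_lshift eq_lrshift.
Qed.

Lemma calabi_z_radial y : toric_interior a y ->
  calabi_z a (xc j0 y + xc j1 y) =
  3 * b * frobp al be (radial y) / (2 + (xc j0 y + xc j1 y)) ^+ 2.
Proof.
case=> h0 h1 h2 h3; rewrite -calabi_zE ?(ltW h2)// mulfK// expf_neq0// lt0r_neq0//; lra.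
Qed.

(** On functions of [t = x1 + x2], the flux is [2 (x_i + 1) z] times the [t]-derivative.
    Substituting [z = 3 b p / S^2] and [p H' = - m G] cancels [p] and gives [fl], whose divergence
    collapses to [- 2 m H] because the weight is [b S / 3]. *)
Lemma nodal_eigenvalue (m : R) : frobG al be (- m) b (- (b ^+ 2 / 3)) 1 = 0 ->
  invariant_eigenvalue a (2 * m / c).
Proof.
move=> G1; have gr := calabi_graeffe a_bounds; have Qp := calabi_Qpos a_bounds.
have b0 := lt0r_neq0 b_gt0; have c0 := lt0r_neq0 (rescaling_gt0 a_bounds).
apply: (@mode_eigenvalue _ _ _ 1 0 _ (fun=> 1) G1).
- by move=> u _; rewrite mul0r addr0.
- by move=> F q; exact: SmoothCst.
- by [].
- by move=> z _ _; exact: oner_neq0.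
move=> f fE y yI.
set H := frobH al be (- m) b (- (b ^+ 2 / 3)) in fE *.
pose G := frobG al be (- m) b (- (b ^+ 2 / 3)).
have fE' y' : toric_interior a y' -> f y' = H (radial y').
  by move=> y'I; rewrite fE// mul0r addr0 invr1 !mul1r.
have fd y' v : toric_interior a y' -> is_derive y' v f
    (- m * G (radial y') / frobp al be (radial y') * ((0 - (xc j0 v + xc j1 v)) / b)).
  move=> y'I; have r01 := radial_bounds y'I.
  apply: (near_eq_is_derive (f := fun y => H (radial y))).
    by apply: filterS (toric_interior_near y'I) => z /fE' ->.
  by apply: radial_derive; exact: frobH_derive gr Qp _ _ _ _ r01.
pose S (y : 'rV[R]_(2 + 2)) := 2 + (xc j0 y + xc j1 y).
have S0 y' : toric_interior a y' -> S y' != 0.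
  by case=> h0 h1 h2 h3; rewrite lt0r_neq0// /S; lra.
have [e01 e10] := inord01_neq.
pose g : R := (b + - (b ^+ 2 / 3) * radial y) * H (radial y) * (-1 / b).
pose d (i : 'I_2) y := - m * G (radial y) / frobp al be (radial y) * (-1 / b).
pose fl (i : 'I_2) (y : 'rV[R]_(2 + 2)) := 6 * m * ((xc i y + 1) * (G (radial y) / S y
    ^+ 2)).
pose gl (i : 'I_2) := 6 * m * ((xc i y + 1) *
    ((g * S y ^+ 2 - G (radial y) * (2 * S y * 1)) / (S y ^+ 2) ^+ 2) + 1 * (G (radial
        y) / S y ^+ 2)).
transitivity (- c^-1 * (gl j0 + gl j1)).
  apply: (laplacian_toric a_bounds (d := d) (fl := fl) yI).
  - move=> i y' y'I; apply: is_derive_eq (fd y' _ y'I) _.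
    rewrite !(coord_delta i _).1 /d; congr (_ * (_ / _)).
    by case: (ord2P i) => ->; rewrite eqxx ?e01 ?e10 /=; ring.
  - move=> i y' y'I; apply: is_derive_eq (fd y' _ y'I) _.
    by rewrite !(coord_delta i _).2 addr0 subr0 mul0r mulr0.
  - move=> i y' y'I; have s0 := S0 y' y'I.
    have p0 := lt0r_neq0 (frobp_gt0 Qp (radial_bounds y'I)).
    have := calabi_z_radial y'I; rewrite /fl /d !mxE -/(S y').
    set z := calabi_z a _ => zE; rewrite zE.
    move: s0 p0; rewrite /S.
    move: (G (radial y')) (frobp al be (radial y')) => G0 p s0 p0.
    case: (ord2P i) => ->; rewrite ?eqxx ?e01 ?e10;
      move: s0; move: (y' ord0 (lshift 2 j0)) (y' ord0 (lshift 2 j1)) => q0 q1 s0;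
      by field; rewrite ?b0 ?s0 ?p0.
  - move=> i; have r01 := radial_bounds yI.
    have r01' : 0 <= radial y < 1 by case/andP: r01 => /ltW->.
    have s0 : S y ^+ 2 != 0 by rewrite expf_neq0// S0.
    have Gd := radial_derive (delta_mx ord0 (lshift 2 i)) (frobG_derive gr (- m) b (-
        (b ^+ 2 / 3)) r01').
    have Xd k := isd_coord y (delta_mx ord0 (lshift 2 i)) ord0 (lshift 2 k).
    have Sd := isd_add (isd_cst y (delta_mx ord0 (lshift 2 i)) 2) (isd_add (Xd j0) (Xd
        j1)).
    apply: is_derive_eq (isd_scale (6 * m) (isd_mul (isd_add (Xd i) (isd_cst y _ 1))
        (isd_div (g := fun y => S y ^+ 2) s0 Gd (isd_sqr (f := S) Sd)))) _.
    have := (coord_delta i i).1; have := (coord_delta i j1).1; have := (coord_delta i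
        j0).1.
    rewrite /= => -> -> ->; rewrite /gl /g /G /H eqxx.
    by case: (ord2P i) => ->; rewrite eqxx ?e01 ?e10 /=; field; rewrite ?b0 ?(S0 y yI).
rewrite fE'// /gl /g /S.
have s0 := S0 y yI; rewrite /S in s0.
move: (H (radial y)) (G (radial y)) => H0 G0; rewrite /radial -/b.
by field; rewrite ?s0 ?c0 ?b0.
Qed.

(** For [f = T K] with [K = H / S], the part of the flux containing [z] involves only
    [K / S + K_t = H_t / S] (subscript: derivative in [t = x1 + x2]); this is the purpose of
    dividing by [S]. The other part is [4 e_i (x1 + 1) (x2 + 1) K / S], with divergence
    [- 4 T H / S^2], and the term [2 b / 3] of the weight is what compensates it. *)
Lemma positive_eigenvalue (m : R) :
  frobG al be 1 (2 * b / 3 - m * b) (m * (b ^+ 2 / 3)) 1 = 0 ->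
  invariant_eigenvalue a (2 * m / c).
Proof.
move=> G1; have gr := calabi_graeffe a_bounds; have Qp := calabi_Qpos a_bounds.
have b0 := lt0r_neq0 b_gt0; have c0 := lt0r_neq0 (rescaling_gt0 a_bounds).
apply: (@mode_eigenvalue _ _ _ 3 (- b) _ (fun z => 2^-1 * (sqmod k0 z + -1 * sqmod k1
    z)) G1).
- move=> u /andP[u0 u1]; rewrite mulNr subr_gt0.
  by apply: le_lt_trans b_lt3; rewrite ler_piMr// ltW// b_gt0.
- move=> F q; apply: SmoothMul; first exact: SmoothCst.
  apply: SmoothAdd; first exact: smooth_alg_sqmod.
  by apply: SmoothMul; [exact: SmoothCst|exact: smooth_alg_sqmod].
- by move=> eta z; rewrite !sqmod_torus_act.
- by move=> z -> ->; apply: lt0r_neq0; lra.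
move=> f fE y yI.
set H := frobH al be 1 (2 * b / 3 - m * b) (m * (b ^+ 2 / 3)) in fE *.
pose G := frobG al be 1 (2 * b / 3 - m * b) (m * (b ^+ 2 / 3)).
pose S (y : 'rV[R]_(2 + 2)) := 2 + (xc j0 y + xc j1 y).
pose T (y : 'rV[R]_(2 + 2)) := xc j0 y - xc j1 y.
have S0 y' : toric_interior a y' -> S y' != 0.
  by case=> h0 h1 h2 h3; rewrite lt0r_neq0// /S; lra.
have fE' y' : toric_interior a y' -> f y' = T y' * (H (radial y') / S y').
  move=> y'I; have [h0 h1 h2 h3] := y'I; rewrite fE//.
  have [p0 p1 _ _] := psiE a (lsubmx y').
  rewrite !sqmod_toric_point ?p0 ?p1 !mxE; [|lra..].
  have -> : 3 + - b * radial y' = S y' by rewrite /S /radial -/b; field.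
  by rewrite /T; field; exact: S0.
have Xd (y' v : 'rV[R]_(2 + 2)) k := isd_coord y' v ord0 (lshift 2 k).
have Sd (y' v : 'rV[R]_(2 + 2)) : is_derive y' v S (xc j0 v + xc j1 v).
  have E := isd_add (isd_cst y' v 2) (isd_add (Xd y' v j0) (Xd y' v j1)).
  by apply: is_derive_eq E _; rewrite add0r.
have Td (y' v : 'rV[R]_(2 + 2)) : is_derive y' v T (xc j0 v - xc j1 v) := isd_sub (Xd
    y' v j0) (Xd y' v j1).
have Hd (y' v : 'rV[R]_(2 + 2)) : toric_interior a y' -> is_derive y' v (fun y => H
    (radial y))
    (1 * G (radial y') / frobp al be (radial y') * ((0 - (xc j0 v + xc j1 v)) / b)).
  move=> y'I; apply: radial_derive.
  exact: frobH_derive gr Qp _ _ _ _ (radial_bounds y'I).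
have fd (y' v : 'rV[R]_(2 + 2)) : toric_interior a y' -> is_derive y' v f
    (T y' * ((1 * G (radial y') / frobp al be (radial y') * ((0 - (xc j0 v + xc j1 v))
        / b)
       * S y' - H (radial y') * (xc j0 v + xc j1 v)) / S y' ^+ 2)
     + (xc j0 v - xc j1 v) * (H (radial y') / S y')).
  move=> y'I.
  apply: (near_eq_is_derive (f := fun y => T y * (H (radial y) / S y))).
    by apply: filterS (toric_interior_near y'I) => z /fE' ->.
  exact: isd_mul (Td y' v) (isd_div (S0 y' y'I) (Hd y' v y'I) (Sd y' v)).
have [e01 e10] := inord01_neq.
pose e (i : 'I_2) : R := if i == j0 then 1 else -1.
pose d (i : 'I_2) y := T y * ((1 * G (radial y) / frobp al be (radial y) * (-1 / b)
       * S y - H (radial y)) / S y ^+ 2) + e i * (H (radial y) / S y).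
pose fl (i : 'I_2) (y : 'rV[R]_(2 + 2)) :=
  -6 * ((xc i y + 1) * (T y * (G (radial y) / S y ^+ 3))) +
  4 * e i * ((xc j0 y + 1) * ((xc j1 y + 1) * (H (radial y) / S y ^+ 2))).
pose w : R := (2 * b / 3 - m * b + m * (b ^+ 2 / 3) * radial y) * H (radial y) * (-1 / b).
pose h : R := 1 * G (radial y) / frobp al be (radial y) * (-1 / b).
pose gl (i : 'I_2) : R :=
  -6 * ((xc i y + 1) * (T y * ((w * S y ^+ 3 - G (radial y) * (3 * S y ^+ 2)) / (S y ^+
      3) ^+ 2)
        + e i * (G (radial y) / S y ^+ 3))
     + T y * (G (radial y) / S y ^+ 3)) +
  4 * e i * ((xc j0 y + 1) * ((xc j1 y + 1) *
      ((h * S y ^+ 2 - H (radial y) * (2 * S y)) / (S y ^+ 2) ^+ 2)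
        + (i == j1)%:R * (H (radial y) / S y ^+ 2))
     + (i == j0)%:R * ((xc j1 y + 1) * (H (radial y) / S y ^+ 2))).
transitivity (- c^-1 * (gl j0 + gl j1)).
  apply: (laplacian_toric a_bounds (d := d) (fl := fl) yI).
  - move=> i y' y'I; apply: is_derive_eq (fd y' _ y'I) _.
    rewrite !(coord_delta i _).1 /d /e.
    have s0 := S0 y' y'I; have p0 := lt0r_neq0 (frobp_gt0 Qp (radial_bounds y'I)).
    by case: (ord2P i) => ->; rewrite ?eqxx ?e01 ?e10 /=; field; rewrite ?s0 ?p0 ?b0.
  - move=> i y' y'I; apply: is_derive_eq (fd y' _ y'I) _.
    rewrite !(coord_delta i _).2.
    have s0 := S0 y' y'I; have p0 := lt0r_neq0 (frobp_gt0 Qp (radial_bounds y'I)).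
    by field; rewrite ?s0 ?p0 ?b0.
  - move=> i y' y'I; have s0 := S0 y' y'I.
    have p0 := lt0r_neq0 (frobp_gt0 Qp (radial_bounds y'I)).
    have := calabi_z_radial y'I; rewrite /fl /d /e !mxE -/(S y').
    set z := calabi_z a _ => zE; rewrite zE.
    move: s0 p0; rewrite /S /T.
    move: (G (radial y')) (H (radial y')) (frobp al be (radial y')) => G0 H0 p s0 p0.
    case: (ord2P i) => ->; rewrite ?eqxx ?e01 ?e10;
      move: s0; move: (y' ord0 (lshift 2 j0)) (y' ord0 (lshift 2 j1)) => q0 q1 s0;
      by field; rewrite ?b0 ?s0 ?p0.
  - move=> i; have r01 := radial_bounds yI.
    have r01' : 0 <= radial y < 1 by case/andP: r01 => /ltW->.
    have s0 := S0 y yI; have s2 : S y ^+ 2 != 0 by rewrite expf_neq0.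
    have s3 : S y ^+ 3 != 0 by rewrite expf_neq0.
    pose v : 'rV[R]_(2 + 2) := delta_mx ord0 (lshift 2 i).
    have Gd := radial_derive v (frobG_derive gr 1 (2 * b / 3 - m * b) (m * (b ^+ 2 /
        3)) r01').
    have X1 k : is_derive y v (fun y => xc k y + 1) (xc k v + 0) := isd_add (Xd y v k)
        (isd_cst y v 1).
    have D1 := isd_mul (X1 i) (isd_mul (Td y v) (isd_div (g := fun y => S y ^+ 3) s3 Gd
        (isd_exp 3 (Sd y v)))).
    have D2 := isd_mul (X1 j0) (isd_mul (X1 j1) (isd_div (g := fun y => S y ^+ 2) s2
        (Hd y v yI) (isd_sqr (Sd y v)))).
    apply: is_derive_eq (isd_add (isd_scale (-6) D1) (isd_scale (4 * e i) D2)) _.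
    have := (coord_delta i i).1; have := (coord_delta i j1).1; have := (coord_delta i
        j0).1.
    rewrite /v /= => -> -> ->; rewrite /gl /w /h /e /G /H eqxx.
    have p0 := lt0r_neq0 (frobp_gt0 Qp r01).
    by case: (ord2P i) => ->; rewrite ?eqxx ?e01 ?e10 /=; field; rewrite ?s0 ?p0 ?b0.
rewrite fE'// /gl /w /h /e !eqxx !e01 !e10.
have p0 := lt0r_neq0 (frobp_gt0 Qp (radial_bounds yI)).
have s0 := S0 y yI; rewrite /S in s0.
move: (H (radial y)) (G (radial y)) (frobp al be (radial y)) p0 => H0 G0 p p0.
rewrite /S /T /radial -/b /=.
by field; rewrite ?s0 ?c0 ?b0 ?p0.
Qed.

End Modes.

(** * The root of the critical polynomial and the closed forms of the bounds *)

Lemma critical_poly_root (R : realType) :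
  exists a_c : R, unique (fun b : R => -1 <= b <= 2 /\ critical_poly b = 0) a_c.
Proof.
(* The derivative in Bernstein form on [[-1, 2]], visibly negative; with opposite signs at the ends
   this gives exactly one root. *)
pose dp (x : R) := - (150 * (2 - x) ^+ 3 + 218 * (x + 1) * (2 - x) ^+ 2
  + 79 * (x + 1) ^+ 2 * (2 - x) + 3 * (x + 1) ^+ 3).
have pd (x : R) : is_derive x (1 : R) (@critical_poly R) (dp x).
  by rewrite /critical_poly; apply: is_derive_eq; rewrite /dp /GRing.scale /=; ring.
have pc (x y : R) : {within `[x, y], continuous (@critical_poly R)}%classic.
  by apply: within_continuous => z _; exact: is_derive1_continuous (pd z).
have p1 : 0 <= critical_poly (-1 : R) by rewrite /critical_poly; lra.
have p2 : critical_poly (2 : R) <= 0 by rewrite /critical_poly; lra.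
have le12 : -1 <= 2 :> R by lra.
have mm : Num.min (critical_poly (-1 : R)) (critical_poly 2) <= 0 <=
    Num.max (critical_poly (-1 : R)) (critical_poly 2).
  by rewrite ge_min p2 orbT le_max p1.
have [a] := IVT le12 (pc _ _) mm.
rewrite in_itv /= => a12 pa.
have decr (x y : R) : -1 <= x -> y <= 2 -> x < y -> critical_poly y < critical_poly x.
  move=> x1 y2 xy; have pd' z : z \in `]x, y[ -> is_derive z 1 (@critical_poly R) (dp
      z) by [].
  have [z] := MVT xy pd' (pc _ _); rewrite in_itv /= => /andP[xz zy] E.
  rewrite -subr_lt0 E nmulr_rlt0 ?subr_gt0// /dp oppr_lt0.
  have z0 : 0 < z + 1 by lra.
  have z2 : 0 < 2 - z by lra.
  by positivity.
exists a; split=> // x [/andP[x1 x2] px]; have /andP[a1 a2] := a12.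
have [ax|xa|//] := ltgtP a x.
- by have := decr _ _ a1 x2 ax; rewrite pa px ltxx.
- by have := decr _ _ x1 a2 xa; rewrite pa px ltxx.
Qed.

Theorem theorem3p1 (R : realType) :
  exists a_c : R,
    unique (fun b : R => -1 <= b <= 2 /\ critical_poly b = 0) a_c /\
    forall a lambda : R, -1 < a < 2 -> first_invariant_eigenvalue a lambda ->
      (a < a_c ->
         lambda <= Num.sqrt (2 * (a + 1)) *
           (13 * a ^+ 4 - 272 * a ^+ 3 + 2076 * a ^+ 2 - 7400 * a + 9679) /
           (10 * Num.sqrt (5 - a) * (a ^+ 2 - 4 * a + 13) *
              (a ^+ 2 - 16 * a + 37))) /\
      (a_c <= a ->
         lambda <= - (3 * Num.sqrt 2 * (5 - a) `^ (3 / 2) *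
             (a ^+ 3 - 105 * a ^+ 2 + 597 * a - 917) /
           (10 * Num.sqrt (a + 1) * (a ^+ 2 - 16 * a + 37) ^+ 2))).
Proof.
have [a_c a_cP] := critical_poly_root R; exists a_c; split => // a lambda a12 [_ _ lmin].
have c0 := rescaling_gt0 a12; have /andP[a1 a2] := a12.
have x0 : 0 < a + 1 by lra.
have y0 : 0 < 5 - a by lra.
have k0 := lt0r_neq0 (calabi_denom_gt0 a12).
have q0 : a ^+ 2 - 4 * a + 13 != 0.
  have -> : a ^+ 2 - 4 * a + 13 = (2 - a) ^+ 2 + 9 by ring.
  by rewrite lt0r_neq0// ltr_wpDl// sqr_ge0.
have le_mode (m M : R) : 0 < m <= M -> invariant_eigenvalue a (2 * m / rescaling a) ->
    lambda <= 2 * M / rescaling a.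
  move=> /andP[m0 mM] /lmin lm; apply: le_trans (lm _) _.
    exact: divr_gt0 (mulr_gt0 (ltr0Sn _ 1) m0) c0.
  by rewrite ler_pM2r ?invr_gt0// ler_pM2l.
set x := Num.sqrt (a + 1); set y := Num.sqrt (5 - a); set w : R := Num.sqrt 2.
have xn : x != 0 by rewrite lt0r_neq0// sqrtr_gt0.
have yn : y != 0 by rewrite lt0r_neq0// sqrtr_gt0.
have wn : w != 0 by rewrite lt0r_neq0// sqrtr_gt0.
have xE : a + 1 = x ^+ 2 by rewrite sqr_sqrtr// ltW.
have yE : 5 - a = y ^+ 2 by rewrite sqr_sqrtr// ltW.
have wE : 2 = w ^+ 2 by rewrite sqr_sqrtr.
(* The rescaling factor is [2 w / (x y)]. *)
have cE M : 2 * M / rescaling a = M * (x * y) / w.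
  by rewrite /rescaling -/w sqrtrM ?(ltW x0)// -/x -/y; field; rewrite wn xn yn.
split=> _.
- have [m mM /(positive_eigenvalue a12) ev] := positive_mode a12.
  apply: le_trans (le_mode _ _ mM ev) _; rewrite cE le_eqVlt; apply/orP; left; apply/eqP.
  rewrite sqrtrM// -/w -/x /positive_bound yE.
  set N := 13 * a ^+ 4 - _ + _ - _ + _.
  (* [field] treats [w] as an atom, so the relation [w ^+ 2 = 2] is used by hand on one side and [w]
     is cancelled on the other. *)
  transitivity (w ^+ 2 * (x * N) / (10 * y * (a ^+ 2 - 4 * a + 13) * (a ^+ 2 - 16 * a +
      37) * w)).
    by rewrite -wE; field; rewrite wn yn q0 k0.
  by field; rewrite wn yn q0 k0.
- have [m mM /(nodal_eigenvalue a12) ev] := nodal_mode a12.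
  apply: le_trans (le_mode _ _ mM ev) _; rewrite cE le_eqVlt; apply/orP; left; apply/eqP.
  have -> : (5 - a) `^ (3 / 2) = y ^+ 3.
    have -> : 3 / 2 = 1 + 2^-1 :> R by lra.
    rewrite powRD; last by rewrite (gt_eqF y0) implybT.
    by rewrite powRr1 ?(ltW y0)// powR12_sqrt ?(ltW y0)// -/y yE; ring.
  rewrite /nodal_bound xE yE.
  set N := a ^+ 3 - _ + _ - _.
  transitivity (- (w ^+ 2 * (3 * y ^+ 3 * N)) / (10 * x * (a ^+ 2 - 16 * a + 37) ^+ 2 *
      w)).
    by rewrite -wE; field; rewrite wn xn k0.
  by field; rewrite wn xn k0.
Qed.
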